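(* Assume that $b$ and $\nu$ satisfy assumption (A) (stated in the context) with constants $\alpha\in(0,1)$, $p\in[1,\infty)$, $C>0$, and for $n\in\mathbb N$ let $X^n$ be the Euler–Maruyama scheme defined in the context, with marginal distributions $\mu^n_t$ and marginal densities $\ell^n_t$. Then there exist a constant $c_1>0$ depending only on $(d,T,\alpha,p,C)$ and a constant $c_2>0$ depending only on $(d,T,\alpha,p,C)$ and $\nu$ such that for all $0\le s<t\le T$: $$\sup_{n\in\mathbb N}\sup_{r\in[0,T]}\|\ell^n_r\|_{C^\alpha_b}\le c_1\|\ell_\nu\|_{C^\alpha_b},$$ $$\sup_{n\in\mathbb N}\|\ell^n_t-\ell^n_s\|_\infty\le c_2(t-s)^{\frac{\alpha}{2}},$$ $$\sup_{n\in\mathbb N}W_p(\mu^n_t,\mu^n_s)\le c_1(t-s)^{\frac12},$$ $$\sup_{n\in\mathbb N}\int_{\mathbb R^d}(1+|x|^p)\,|\ell^n_t(x)-\ell^n_s(x)|\,dx\le c_2(t-s)^{\frac{\alpha}{2}}s^{-\frac{\alpha}{2}}.$$ (For $s=0$ the right-hand side of the last inequality is read as $+\infty$.) If, in addition, $\int_{\mathbb R^d}(1+|x|^p)\sqrt{\ell_\nu(x)}\,dx\le C$, then for all $0\le s<t\le T$ also $$\sup_{n\in\mathbb N}\int_{\mathbb R^d}(1+|x|^p)\,|\ell^n_t(x)-\ell^n_s(x)|\,dx\le c_2(t-s)^{\frac{\alpha}{4}}.$$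
   Context: Fix $d\in\mathbb N$, $T\in(0,\infty)$ and $p\in[1,\infty)$; $\mathbb N$ denotes the strictly positive integers and $\mathbb R_+=[0,\infty)$. For $q\ge1$, $\mathcal P_q(\mathbb R^d)$ is the set of Borel probability measures on $\mathbb R^d$ with finite $q$-th moment; $\mathcal P_p(\mathbb R^d)$ carries the Wasserstein metric $W_p(\mu,\mu')=\inf_\varrho\left(\int_{\mathbb R^d\times\mathbb R^d}|x-y|^p\,d\varrho(x,y)\right)^{1/p}$, the infimum being over couplings $\varrho$ of $\mu$ and $\mu'$. For $\alpha\in(0,1)$, $C^\alpha_b(\mathbb R^d)$ is the space of functions $f:\mathbb R^d\to\mathbb R$ with finite norm $\|f\|_{C^\alpha_b}=\|f\|_\infty+[f]_\alpha$, where $[f]_\alpha=\sup_{x\ne y}|f(x)-f(y)|/|x-y|^\alpha$. Let $b:[0,T]\times\mathbb R^d\times\mathbb R_+\times\mathcal P_p(\mathbb R^d)\to\mathbb R^d$ be measurable and let $\nu$ be a Borel probability measure on $\mathbb R^d$. Assumption (A): there are constants $\alpha\in(0,1)$, $p\in[1,\infty)$, $C>0$ such that for all $t\in[0,T]$, $x\in\mathbb R^d$, $r,r'\in\mathbb R_+$, $\varrho,\varrho'\in\mathcal P_p(\mathbb R^d)$: (A1) $|b(t,x,r,\varrho)|\le C$; (A2) $\nu\in\mathcal P_{p+\alpha}(\mathbb R^d)$ and $\nu$ has a density $\ell_\nu\in C^\alpha_b(\mathbb R^d)$; (A3) $|b(t,x,r,\varrho)-b(t,x,r',\varrho')|\le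 C\{|r-r'|+W_p(\varrho,\varrho')\}$. Let $(\Omega,\mathcal A,(\mathcal F_t)_{t\ge0},\mathbb P)$ be a filtered probability space satisfying the usual conditions, $(B_t)_{t\ge0}$ a $d$-dimensional Brownian motion with respect to $(\mathcal F_t)$ (the filtration is admissible), and $X_0$ an $\mathcal F_0$-measurable random vector with distribution $\nu$. Euler–Maruyama scheme: for $n\in\mathbb N$ let $\varepsilon_n=T/n$, $t_k=k\varepsilon_n$ for $k\in\{0,\dots,n\}$, and $\tau^n_t=t_k$ if $t\in[t_k,t_{k+1})$ for some $k\in\{0,\dots,n-1\}$. For $t\in[0,T]$, $$X^n_t=X_0+\int_0^t b\big(s,X^n_{\tau^n_s},\ell^n_{\tau^n_s}(X^n_{\tau^n_s}),\mu^n_{\tau^n_s}\big)1_{(\varepsilon_n,T]}(s)\,ds+\sqrt2\,B_t,$$ where $\mu^n_s$ and $\ell^n_s$ are the distribution and the Lebesgue density of $X^n_s$ (defined recursively over the intervals $(t_k,t_{k+1}]$; they exist under (A)). Pointwise statements about $\ell^n_t$ refer to its continuous version; in particular $\ell^n_0=\ell_\nu$. *)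

(* Defs.v *)
From HB Require Import structures.
From mathcomp Require Import all_boot all_order all_algebra.
From mathcomp Require Import all_classical all_reals all_analysis.
From mathcomp Require Import measurable_realfun.

Set Implicit Arguments.
Unset Strict Implicit.
Unset Printing Implicit Defensive.

Import Order.TTheory GRing.Theory Num.Theory.
Import numFieldNormedType.Exports.

Local Open Scope classical_set_scope.
Local Open Scope ring_scope.

(* The Borel sigma-algebra of R^d; the topology of 'rV[R]_d is the product
   topology, i.e. the usual one. *)
Section borel_rV.
Context (R : realType) (d : nat).

Definition rV_borel : set (set 'rV[R]_d) := <<s @open 'rV[R]_d >>.

Let rV_borelC (A : set 'rV[R]_d) : rV_borel A -> rV_borel (~` A).
Proof. exact: sigma_algebraC. Qed.

Definition rV_display : measure_display := sigma_display (@open 'rV[R]_d).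

HB.instance Definition _ := @isMeasurable.Build rV_display 'rV[R]_d rV_borel
  (@sigma_algebra0 _ setT _) rV_borelC (@sigma_algebra_bigcup _ setT _).

End borel_rV.

Section borel_rV_coord.
Context (R : realType) (d : nat).

Lemma open_rV_measurable (U : set 'rV[R]_d) : open U -> measurable U.
Proof. by move=> oU; apply: sub_sigma_algebra. Qed.

Lemma measurable_coord_rV (i : 'I_d) :
  measurable_fun [set: 'rV[R]_d] (fun x : 'rV[R]_d => x 0 i).
Proof.
apply: (measurability _ (RGenOInfty.measurableE R)) => //.
move=> _ [_ [a ->] <-]; rewrite setTI; apply: open_rV_measurable.
apply: open_comp; last exact: interval_open.
by move=> x _; exact: coord_continuous.
Qed.

Let box (q : 'rV[rat]_d * nat) : set 'rV[R]_d :=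
  [set x | forall i, `|ratr (q.1 0 i) - x 0 i| < q.2.+1%:R^-1 ].

Let open_box (U : set 'rV[R]_d) : open U ->
  U = \bigcup_q (if `[< box q `<=` U >] then box q else set0).
Proof.
move=> oU; apply/seteqP; split => [x Ux|x [q _]]; last first.
  by case: ifPn => // /asboolP qU /qU.
have /nbhs_ballP[e /= e0 eU] : nbhs x U by exact: open_nbhs_nbhs.
have [n ne] : exists n : nat, (2 * n.+1%:R^-1 < e :> R).
  have e20 : 0 < e / 2 by rewrite divr_gt0.
  have [N _ /(_ N (leqnn _)) NE] := near_infty_natSinv_lt (PosNum e20).
  by exists N; rewrite mulrC -ltr_pdivlMr.
have /choice[q qx] (i : 'I_d) :
    exists q : rat, `|ratr q - x 0 i| < n.+1%:R^-1 :> R.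
  have h : x 0 i - n.+1%:R^-1 < x 0 i + n.+1%:R^-1.
    by rewrite ltrBlDr -addrA ltrDl addr_gt0// invr_gt0.
  have [q] := rat_in_itvoo h; rewrite inE => /itvP qI.
  have [q1 q2] : x 0 i - n.+1%:R^-1 < ratr q /\ ratr q < x 0 i + n.+1%:R^-1.
    by rewrite !qI.
  by exists q; rewrite ltr_distl q1 q2.
exists (\row_i q i, n) => //; rewrite ifT.
  by move=> i /=; rewrite mxE; exact: qx.
apply/asboolP => y /= qy; apply: eU; split => // i j.
rewrite /ball/= (le_lt_trans _ ne)// (ord1 i).
rewrite (le_trans (ler_distD (ratr (q j)) _ _))//.
rewrite mulr_natl mulr2n lerD//; apply: ltW; first by rewrite distrC; exact: qx.
by have := qy j; rewrite mxE.
Qed.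

Lemma measurable_fun_rV d' (T : measurableType d') (D : set T)
    (f : T -> 'rV[R]_d) :
  (forall i, measurable_fun D (fun x => f x 0 i)) -> measurable_fun D f.
Proof.
move=> mf mD; apply: (measurability (@open 'rV[R]_d)) => //.
move=> _ [U oU <-]; rewrite (open_box oU) preimage_bigcup setI_bigcupr.
apply: countable_bigcupT_measurable => //.
move=> q; case: ifP => _; last by rewrite preimage_set0 setI0.
have -> : D `&` f @^-1` box q = D `&` \bigcap_(i in [set: 'I_d])
    (D `&` (fun x => f x 0 i) @^-1`
      [set y | `|ratr (q.1 0 i) - y| < q.2.+1%:R^-1]).
  apply/seteqP; split => [x [Dx qx]|x [Dx qx]]; split => // i.
    by move=> _; split => //; exact: qx.
  by have [] := qx i I.
apply: measurableI => //; apply: fin_bigcap_measurable => // i _.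
apply: mf => //; rewrite (_ : [set _ | _] = ball (ratr (q.1 0 i) : R) q.2.+1%:R^-1)//.
exact: measurable_ball.
Qed.

End borel_rV_coord.

(* Lebesgue measure on R^d, by recursion on d: R^0 carries the unit mass and
   the measure on R^{d+1} is the product measure on R x R^d transported along
   (a, x) |-> (a, x_1, ..., x_d). *)
Section lebesgue_rV.
Context (R : realType).

Definition cons_rV (d : nat) (z : R * 'rV[R]_d) : 'rV[R]_d.+1 :=
  row_mx z.1%:M z.2.

Lemma cons_rV0 d (z : R * 'rV[R]_d) : cons_rV z 0 ord0 = z.1.
Proof.
rewrite /cons_rV; have -> : ord0 = lshift d (ord0 : 'I_1) by exact: val_inj.
by rewrite (row_mxEl z.1%:M) mxE mulr1n.
Qed.

Lemma cons_rVS d (z : R * 'rV[R]_d) i : cons_rV z 0 (lift ord0 i) = z.2 0 i.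
Proof.
rewrite /cons_rV; have -> : lift ord0 i = rshift 1 i by exact: val_inj.
by rewrite (row_mxEr z.1%:M).
Qed.

Lemma measurable_cons_rV d : measurable_fun [set: R * 'rV[R]_d] (@cons_rV d).
Proof.
apply: measurable_fun_rV => i; case: (unliftP ord0 i) => [j ->|->].
  under eq_fun do rewrite cons_rVS.
  exact: (measurableT_comp (measurable_coord_rV j) measurable_snd).
by under eq_fun do rewrite cons_rV0; exact: measurable_fst.
Qed.

Section step.
Context (d : nat) (m : {sigma_finite_measure set 'rV[R]_d -> \bar R}).

Definition lebesgue_rV_step : set 'rV[R]_d.+1 -> \bar R :=
  pushforward (lebesgue_measure \x m)%E (@cons_rV d).

Let step0 : lebesgue_rV_step set0 = 0%E.
Proof. by rewrite /lebesgue_rV_step /pushforward preimage_set0 measure0. Qed.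

Let step_ge0 A : (0 <= lebesgue_rV_step A)%E.
Proof. exact: (measure_ge0 (lebesgue_measure \x m)%E). Qed.

Let mcons (A : set 'rV[R]_d.+1) :
  measurable A -> measurable (@cons_rV d @^-1` A).
Proof. by move=> mA; rewrite -[X in measurable X]setTI; exact: measurable_cons_rV. Qed.

Let step_sigma_additive : semi_sigma_additive lebesgue_rV_step.
Proof.
move=> F mF tF mUF; rewrite /lebesgue_rV_step /pushforward preimage_bigcup.
apply: measure_semi_sigma_additive.
- by move=> n; exact: mcons.
- apply/trivIsetP => /= i j _ _ ij; rewrite -preimage_setI.
  by move/trivIsetP : tF => /(_ _ _ _ _ ij) ->//; rewrite preimage_set0.
- by rewrite -preimage_bigcup; exact: mcons.
Qed.

HB.instance Definition _ := isMeasure.Build _ _ _ lebesgue_rV_step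
  step0 step_ge0 step_sigma_additive.

Let uncons (x : 'rV[R]_d.+1) : R * 'rV[R]_d := (x 0 ord0, \row_i x 0 (lift ord0 i)).

Let unconsK : cancel uncons (@cons_rV d).
Proof.
move=> x; apply/rowP => i; case: (unliftP ord0 i) => [j ->|->].
  by rewrite cons_rVS mxE.
by rewrite cons_rV0.
Qed.

Let consK : cancel (@cons_rV d) uncons.
Proof.
move=> [a v]; rewrite /uncons cons_rV0; congr pair.
by apply/rowP => i; rewrite mxE cons_rVS.
Qed.

Let measurable_uncons : measurable_fun setT uncons.
Proof.
apply: measurable_fun_pair; first exact: measurable_coord_rV.
apply: measurable_fun_rV => i; under eq_fun do rewrite mxE.
exact: measurable_coord_rV.
Qed.

Let step_sigma_finite : sigma_finite setT lebesgue_rV_step.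
Proof.
have /sigma_finiteP[F [TF ndF Foo]] := sigma_finiteT (@lebesgue_measure R).
have /sigma_finiteP[G [TG ndG Goo]] := sigma_finiteT m.
exists (fun n => uncons @^-1` (F n `*` G n)).
  apply/seteqP; split => // x _.
  have [k _ Fk] : (\bigcup_i F i) (x 0 ord0) by rewrite -TF.
  have [l _ Gl] : (\bigcup_i G i) (uncons x).2 by rewrite -TG.
  exists (maxn k l) => //; split.
    exact: (subsetPset _ _ (ndF _ _ (leq_maxl k l))).
  exact: (subsetPset _ _ (ndG _ _ (leq_maxr k l))).
move=> n; have [mF Fn] := Foo n; have [mG Gn] := Goo n; split.
  rewrite -[X in measurable X]setTI; apply: measurable_uncons => //.
  exact: measurableX.
rewrite /lebesgue_rV_step /pushforward -comp_preimage.
rewrite (_ : uncons \o _ = id); last by apply/funext => z; exact: consK.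
rewrite preimage_id [X in (X < _)%E]product_measure1E//.
by rewrite lte_mul_pinfty// ge0_fin_numE.
Qed.

HB.instance Definition _ := Measure_isSigmaFinite.Build _ _ _ lebesgue_rV_step
  step_sigma_finite.

End step.

Fixpoint lebesgue_rV (d : nat) : {sigma_finite_measure set 'rV[R]_d -> \bar R} :=
  if d is d'.+1 then lebesgue_rV_step (lebesgue_rV d')
  else dirac (0 : 'rV[R]_0).

Lemma lebesgue_rV_box (d : nat) (A : 'I_d -> set R) :
  (forall i, measurable (A i)) ->
  lebesgue_rV d [set x | forall i, A i (x 0 i)] =
  (\prod_(i < d) lebesgue_measure (A i))%E.
Proof.
elim: d A => [|d ih] A mA.
  rewrite big_ord0 /= diracE mem_set//= => i; by case: i.
rewrite big_ord_recl -ih; last by move=> i; exact: mA.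
set B := (X in lebesgue_rV d X).
have mB : measurable B.
  rewrite (_ : B = \bigcap_(i in [set: 'I_d])
    ((fun x : 'rV[R]_d => x 0 i) @^-1` A (lift ord0 i))); last first.
    by apply/seteqP; split => [x Bx i _|x Bx i]; [exact: Bx|exact: Bx i I].
  apply: fin_bigcap_measurable => // i _.
  by rewrite -[X in measurable X]setTI; exact: measurable_coord_rV.
rewrite -(@product_measure1E _ _ _ _ R lebesgue_measure (lebesgue_rV d)
  _ _ (mA ord0) mB).
rewrite -[LHS]/((lebesgue_measure \x lebesgue_rV d)%E
  (@cons_rV d @^-1` [set x | forall i, A i (x 0 i)])).
congr ((_ \x _)%E _).
apply/seteqP; split => [z /= Az|z /= [Az1 Az2] i].
  split => /=; first by have := Az ord0; rewrite cons_rV0.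
  by move=> i; have := Az (lift ord0 i); rewrite cons_rVS.
by case: (unliftP ord0 i) => [j ->|->]; rewrite ?cons_rVS ?cons_rV0.
Qed.

End lebesgue_rV.

Section wasserstein.
Context (R : realType) (d : nat).
Implicit Types (q : R) (mu nu : probability 'rV[R]_d R).

(* The Euclidean norm; the library norm on 'rV[R]_d is the sup norm. *)
Definition enorm (x : 'rV[R]_d) : R := Num.sqrt (\sum_(i < d) x 0 i ^+ 2).

Lemma measurable_enorm : measurable_fun [set: 'rV[R]_d] enorm.
Proof.
apply: (measurableT_comp (continuous_measurable_fun (@sqrt_continuous R))) => //.
apply: measurable_sum => i; apply: measurable_funX.
exact: measurable_coord_rV.
Qed.

Definition finite_moment q mu : Prop :=
  (\int[mu]_x (enorm x `^ q)%:E < +oo)%E.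

Definition coupling mu nu : set (probability ('rV[R]_d * 'rV[R]_d)%type R) :=
  [set rho | forall A : set 'rV[R]_d, measurable A ->
     rho (A `*` setT) = mu A /\ rho (setT `*` A) = nu A].

Definition Wass q mu nu : \bar R :=
  ereal_inf [set ((\int[rho]_z (enorm (z.1 - z.2) `^ q)%:E) `^ q^-1)%E
            | rho in coupling mu nu].

Record Pq q := MkPq {
  Pq_prob :> probability 'rV[R]_d R ;
  Pq_moment : finite_moment q Pq_prob }.

Lemma dirac0_moment q : finite_moment q (dirac (0 : 'rV[R]_d)).
Proof.
rewrite /finite_moment integral_dirac//; first by rewrite diracT mul1e ltry.
apply/measurable_EFinP; apply: (measurableT_comp (measurable_powR q)).
exact: measurable_enorm.
Qed.

HB.instance Definition _ q := gen_eqMixin (Pq q).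
HB.instance Definition _ q := gen_choiceMixin (Pq q).
HB.instance Definition _ q := isPointed.Build (Pq q) (MkPq (dirac0_moment q)).

(* P_q(R^d) carries the Borel sigma-algebra of the W_q-topology. *)
Definition Wass_open q : set (set (Pq q)) :=
  [set U | forall mu : Pq q, U mu ->
     exists2 e : R, 0 < e & forall nu : Pq q, (Wass q mu nu < e%:E)%E -> U nu].

HB.instance Definition _ q := @isMeasurable.Build (sigma_display (@Wass_open q))
  (Pq q) <<s @Wass_open q >>
  (@sigma_algebra0 _ setT _) (@sigma_algebraC _ _) (@sigma_algebra_bigcup _ setT _).

End wasserstein.

Section densities.
Context (R : realType) (d : nat).
Implicit Types (f g : 'rV[R]_d -> R) (mu : set 'rV[R]_d -> \bar R).

Definition is_density mu f : Prop :=
  [/\ measurable_fun setT f, forall x, 0 <= f x &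
      forall A, measurable A ->
        (mu A = \int[lebesgue_rV R d]_(x in A) (f x)%:E)%E].

Definition sup_norm f : \bar R := ereal_sup [set `|f x|%:E | x in setT].

Definition holder_seminorm (alpha : R) f : \bar R :=
  ereal_sup [set (`|f z.1 - f z.2| / enorm (z.1 - z.2) `^ alpha)%:E
            | z in [set z : 'rV[R]_d * 'rV[R]_d | z.1 != z.2]].

Definition holder_norm (alpha : R) f : \bar R :=
  (sup_norm f + holder_seminorm alpha f)%E.

Definition weighted_L1 (p : R) f : \bar R :=
  (\int[lebesgue_rV R d]_x ((1 + enorm x `^ p) * `|f x|)%R%:E)%E.

End densities.

Section stochastic_basis.
Context (R : realType) (dO : measure_display) (Omega : measurableType dO).
Context (P : probability Omega R).
Implicit Types F : R -> set (set Omega).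

(* filtrations and processes are indexed by R; only times t >= 0 matter *)
Record usual_filtration F : Prop := UsualFiltration {
  filtration_sigma : forall t : R, 0 <= t -> sigma_algebra setT (F t) ;
  filtration_sub : forall t : R, 0 <= t -> F t `<=` measurable ;
  filtration_mono : forall s t : R, 0 <= s -> s <= t -> F s `<=` F t ;
  filtration_right : forall t : R, 0 <= t -> \bigcap_(s in `]t, +oo[) F s `<=` F t ;
  filtration_complete : P.-negligible `<=` F 0 }.

Definition sub_measurable d (G : set (set Omega)) (X : Omega -> 'rV[R]_d) : Prop :=
  forall A, measurable A -> G (X @^-1` A).

Definition has_law d (X : Omega -> 'rV[R]_d) (mu : set 'rV[R]_d -> \bar R) : Prop :=
  measurable_fun setT X /\ forall A, measurable A -> P (X @^-1` A) = mu A.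

(* density of N(0, v I_d); normal_pdf takes the standard deviation *)
Definition gauss_density d (v : R) (x : 'rV[R]_d) : R :=
  \prod_(i < d) normal_pdf 0 (Num.sqrt v) (x 0 i).

Record brownian_motion F d (B : R -> Omega -> 'rV[R]_d) : Prop := BrownianMotion {
  brownian_adapted : forall t : R, 0 <= t -> sub_measurable (F t) (B t) ;
  brownian_start : {ae P, forall w, B 0 w = 0} ;
  brownian_gauss : forall s t : R, 0 <= s -> s < t ->
    has_law (fun w => B t w - B s w)
      (fun A => \int[lebesgue_rV R d]_(x in A) (gauss_density (t - s) x)%:E)%E ;
  brownian_indep : forall s t : R, 0 <= s -> s < t ->
    forall (E : set Omega) (A : set 'rV[R]_d), F s E -> measurable A ->
    let dB := fun w => B t w - B s w in
    P (E `&` dB @^-1` A) = (P E * P (dB @^-1` A))%E ;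
  brownian_path :
    {ae P, forall w, {within `[0, +oo[, continuous (fun t => B t w)}} }.

End stochastic_basis.

Section euler.
Context (R : realType) (d : nat) (T p : R).
Implicit Types (b : R -> 'rV[R]_d -> R -> Pq d p -> 'rV[R]_d).

(* measurability on [0,T] x R^d x [0,oo) x P_p(R^d); b is irrelevant elsewhere *)
Definition drift_measurable b : Prop :=
  measurable_fun
    [set z : R * 'rV[R]_d * R * Pq d p | 0 <= z.1.1.1 <= T /\ 0 <= z.1.2]
    (fun z => b z.1.1.1 z.1.1.2 z.1.2 z.2).

Record assumption_A (alpha C : R) b (nu : probability 'rV[R]_d R)
    (lnu : 'rV[R]_d -> R) : Prop := AssumptionA {
  drift_bounded : forall (t : R) x (r : R) (rho : Pq d p), 0 <= t <= T -> 0 <= r -> enorm (b t x r rho) <= C ;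
  initial_moment : finite_moment (p + alpha) nu ;
  initial_density : is_density nu lnu ;
  initial_holder : (holder_norm alpha lnu < +oo)%E ;
  drift_lipschitz : forall (t : R) x (r r' : R) (rho rho' : Pq d p), 0 <= t <= T -> 0 <= r -> 0 <= r' ->
    ((enorm (b t x r rho - b t x r' rho'))%:E <=
     C%:E * (`|r - r'|%:E + Wass p rho rho'))%E }.

Definition mesh (n : nat) : R := T / n%:R.

Definition grid (n k : nat) : R := k%:R * mesh n.

(* equal to grid n k on [grid n k, grid n k.+1[ for k < n *)
Definition tau (n : nat) (t : R) : R :=
  \sum_(k < n) grid n k * \1_(`[grid n k, grid n k.+1[) t.

Definition Rintegral_rV (D : set R) (f : R -> 'rV[R]_d) : 'rV[R]_d :=
  \row_i (\int[lebesgue_measure]_(s in D) f s 0 i).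

(* X is the n-th scheme, with marginal laws mu and continuous marginal
   densities ell. *)
Record euler_scheme dO (Omega : measurableType dO) (P : probability Omega R)
    b (X0 : Omega -> 'rV[R]_d) (B : R -> Omega -> 'rV[R]_d) (n : nat)
    (X : R -> Omega -> 'rV[R]_d) (mu : R -> Pq d p) (ell : R -> 'rV[R]_d -> R)
    : Prop := EulerScheme {
  euler_law : forall t : R, 0 <= t <= T -> has_law P (X t) (mu t) ;
  euler_density : forall t : R, 0 <= t <= T -> is_density (mu t) (ell t) ;
  euler_density_continuous : forall t : R, 0 <= t <= T -> continuous (ell t) ;
  euler_eq : forall (t : R) w, 0 <= t <= T ->
    X t w = X0 w
      + Rintegral_rV `[0, t] (fun s =>
          \1_(`]mesh n, T]) s *:
            b s (X (tau n s) w) (ell (tau n s) (X (tau n s) w)) (mu (tau n s)))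
      + Num.sqrt 2 *: B t w }.

End euler.

(* Main.v *)
(* Compare X^n_t with the value at time t of the process which follows the scheme up to
   a time r and a Brownian motion afterwards; call its density f_r, so that f_t = ell_t
   and f_s is the convolution of ell_s with the heat kernel of age t - s. Between
   consecutive grid points the drift is a bounded displacement, and the increments of
   f_r along the grid telescope to a discrete Duhamel formula
     ell_t = heat_(t-s) * ell_s + \sum_j D_j,
   where D_j is a difference of two convolutions with heat_(u_j), u_j = t - t_j,
   whose arguments differ by at most C (t_(j+1) - t_j). Gaussian bounds on first and
   second differences of the kernel give
     |D_j| <= K (t_(j+1) - t_j) u_j^(-1/2) heat_(2 u_j) * ell_(t_j)
   and, for the increments of D_j by h, an additional factor (|h| / sqrt u_j)^alpha.
   Both Riemann sums are bounded uniformly in n. The first bound and a singular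
   Gronwall argument with an exponential weight control the supremum of ell_t; the
   second one gives the Hölder bound, and then the modulus of continuity in time,
   because heat_u * f - f is controlled by the modulus of continuity of f. The
   weighted L^1 estimates follow the same lines, starting from the smoothness of
   heat_s * ell_0 or from the modulus of ell_0 in the weighted L^1 norm. *)

Require Import Defs.
From HB Require Import structures.
From mathcomp Require Import all_boot all_order all_algebra.
From mathcomp Require Import all_classical all_reals all_analysis.
From mathcomp Require Import measurable_realfun.
From mathcomp Require Import ring lra.

Set Implicit Arguments.
Unset Strict Implicit.
Unset Printing Implicit Defensive.

Import Order.TTheory GRing.Theory Num.Theory.
Import numFieldNormedType.Exports.

Local Open Scope classical_set_scope.
Local Open Scope ring_scope.

(** * Lebesgue measure on R^d *)

Section lebesgue_affine.
Context (R : realType).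
Local Notation leb := (@lebesgue_measure R).

(** Within a cell the drift is a function of the value at the left grid point. The displacement from
    c_j to c_(j+1) is therefore known at time c_j, and f at both ends can be written with the kernel
    of the same positive age t - c_j. This keeps the last cell, where t - c_(j+1) = 0, free of any
    singularity. The displacement is at most d C u_j, so its ratio to sqrt u_j stays below d C sqrt
    T; kernel differences are only estimated for such shifts, and passing from age u to 2 u absorbs
    every loss. The sums evaluate u^(-(1+a)/2) at the larger end of each interval, so they lie below
    the integral whatever n is. For the supremum no finiteness is presupposed: with s = 0 the
    formula at time t involves only grid times before t, and an induction along the grid closes. The
    constant in the Hölder estimate is free of nu because the bounds in space are linear in the two
    parts of the Hölder norm of the initial density. The density estimates are proved for an
    arbitrary [euler_system]; drift and Brownian motion only enter its construction and the moment
    bounds. *)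

Lemma ge0_integral_affine (k a : R) (f : R -> \bar R) : 0 < k ->
  measurable_fun setT f -> (forall x, 0 <= f x)%E ->
  (k%:E * \int[leb]_x f ((x - a) * k)%R = \int[leb]_x f x)%E.
Proof.
move=> k0 mf f0.
pose g : measurableTypeR R -> measurableTypeR R := fun x => (x - a) * k.
have mg : measurable_fun setT g.
  by apply: measurable_funM => //; exact: measurable_funB.
have k0' : 0 <= k by exact: ltW.
(* Scaled by k, the image of Lebesgue measure under g agrees with Lebesgue measure on every interval
   ]u, v], which determines it. *)
pose m0 : {measure set _ -> \bar R} := pushforward leb g.
pose m := mscale (NngNum k0') (m0 mg).
transitivity (\int[m]_x f x)%E; last first.
  apply: eq_measure_integral => A mA _; apply/esym.
  apply: lebesgue_measure_unique => // _ [[u v]] _ <-.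
  rewrite -[RHS]/(k%:E * leb (g @^-1` [set` `]u, v]]))%E.
  have -> : g @^-1` [set` `]u, v]] = [set` `]u / k + a, v / k + a]].
    apply/seteqP; split => x /=; rewrite !in_itv/= /g.
      by rewrite -lterBDr ltr_pdivrMr// -lerBlDr ler_pdivlMr.
    by rewrite -lterBDr ltr_pdivrMr// -lerBlDr ler_pdivlMr.
  rewrite !lebesgue_measure_itv/= !lte_fin ltrD2r ltr_pM2r ?invr_gt0//.
  case: ifPn => _; last by rewrite mule0.
  by rewrite -!EFinB -EFinM; congr EFin; field; exact: lt0r_neq0.
by rewrite ge0_integral_mscale//= ge0_integral_pushforward.
Qed.

Lemma ge0_integral_oppr (f : R -> \bar R) :
  measurable_fun setT f -> (forall x, 0 <= f x)%E ->
  (\int[leb]_x f (- x)%R = \int[leb]_x f x)%E.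
Proof.
move=> mf f0.
rewrite [RHS](eq_measure_integral (pushforward leb (-%R : _ -> measurableTypeR R))).
  by rewrite ge0_integral_pushforward.
by move=> A mA _; exact/esym/lebesgue_measureN.
Qed.

Lemma ge0_integral_reflect (a : R) (f : R -> \bar R) :
  measurable_fun setT f -> (forall x, 0 <= f x)%E ->
  (\int[leb]_x f (a - x)%R = \int[leb]_x f x)%E.
Proof.
move=> mf f0.
rewrite -(@ge0_integral_affine 1 (- a) f)// mul1e.
under [RHS]eq_integral do rewrite mulr1 opprK addrC.
rewrite -[RHS]ge0_integral_oppr//.
by apply: measurableT_comp => //; exact: measurable_funD.
Qed.

End lebesgue_affine.

Section lebesgue_rV_theory.
Context (R : realType).
Local Notation leb := (@lebesgue_measure R).

Lemma measurable_cons_rVT d (f : 'rV[R]_d.+1 -> \bar R) :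
  measurable_fun setT f -> measurable_fun setT (f \o @cons_rV R d).
Proof. by move=> mf; apply: measurableT_comp => //; exact: measurable_cons_rV. Qed.

Lemma ge0_integral_rVS d (f : 'rV[R]_d.+1 -> \bar R) :
  measurable_fun setT f -> (forall x, 0 <= f x)%E ->
  (\int[lebesgue_rV R d.+1]_x f x =
   \int[leb]_a \int[lebesgue_rV R d]_v f (cons_rV (a, v)))%E.
Proof.
move=> mf f0.
change (\int[pushforward (leb \x lebesgue_rV R d) (@cons_rV R d)]_x f x =
   \int[leb]_a \int[lebesgue_rV R d]_v f (cons_rV (a, v)))%E.
have /(_ setT f measurableT mf (fun x _ => f0 x)) E :=
  @ge0_integral_pushforward _ _ (measurableTypeR R * 'rV[R]_d)%type 'rV[R]_d.+1
    R _ (@measurable_cons_rV R d) (leb \x lebesgue_rV R d)%E.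
etransitivity; first exact: E.
exact: (@fubini_tonelli1 _ _ (measurableTypeR R) _ R leb (lebesgue_rV R d)
  (f \o @cons_rV R d) (measurable_cons_rVT mf) (fun x => f0 _)).
Qed.

Lemma ge0_integral_rV0 (f : 'rV[R]_0 -> \bar R) : measurable_fun setT f ->
  (\int[lebesgue_rV R 0]_x f x = f 0%R)%E.
Proof. by move=> mf; rewrite integral_dirac// diracT mul1e. Qed.

Lemma measurable_map_rV d (g : 'I_d -> R -> R) :
  (forall i, measurable_fun setT (g i)) ->
  measurable_fun setT (fun x : 'rV[R]_d => \row_i g i (x 0 i)).
Proof.
move=> mg; apply: measurable_fun_rV => i; under eq_fun do rewrite mxE.
by apply: measurableT_comp => //; exact: measurable_coord_rV.
Qed.

Lemma measurable_integral_rV d dT (T : measurableType dT)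
    (f : T -> 'rV[R]_d -> \bar R) :
  measurable_fun setT (fun z : T * 'rV[R]_d => f z.1 z.2) ->
  (forall a v, 0 <= f a v)%E ->
  measurable_fun setT (fun a => \int[lebesgue_rV R d]_v f a v)%E.
Proof.
move=> mf f0.
exact: (@measurable_fun_fubini_tonelli_F _ _ T _ R (lebesgue_rV R d) _ mf (fun z => f0 _ _)).
Qed.

(** Change of variables one coordinate at a time: the one-dimensional rule is a hypothesis on each g
    i, and Tonelli along the recursion of [lebesgue_rV] does the induction. Reflections and
    dilations are both instances. *)
Lemma ge0_integral_map_rV (k : R) d (g : 'I_d -> R -> R) (f : 'rV[R]_d -> \bar R) :
  0 <= k -> (forall i, measurable_fun setT (g i)) ->
  (forall i (h : R -> \bar R), measurable_fun setT h -> (forall x, 0 <= h x)%E ->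
    (k%:E * \int[leb]_x h (g i x) = \int[leb]_x h x)%E) ->
  measurable_fun setT f -> (forall x, 0 <= f x)%E ->
  ((k ^+ d)%:E * \int[lebesgue_rV R d]_x f (\row_i g i (x 0%R i)) =
   \int[lebesgue_rV R d]_x f x)%E.
Proof.
move=> k0; elim: d g f => [|d ih] g f mg gk mf f0.
  have m0 : measurable_fun setT (fun x : 'rV[R]_0 => f (\row_i g i (x 0%R i))).
    by apply: measurableT_comp => //; exact: measurable_map_rV.
  rewrite expr0 mul1e !ge0_integral_rV0//.
  by congr f; apply/rowP => -[].
have mS : measurable_fun setT (fun x : 'rV[R]_d.+1 => f (\row_i g i (x 0%R i))).
  by apply: measurableT_comp => //; exact: measurable_map_rV.
rewrite !ge0_integral_rVS// exprS EFinM -muleA.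
have E a v : \row_i g i (cons_rV (a, v) 0%R i) =
    cons_rV (g ord0 a, \row_i g (lift ord0 i) (v 0%R i)) :> 'rV[R]_d.+1.
  apply/rowP => i; rewrite mxE; case: (unliftP ord0 i) => [j ->|->].
    by rewrite !cons_rVS mxE.
  by rewrite !cons_rV0.
have mfa a : measurable_fun setT (fun v => f (cons_rV (a, v))).
  apply: (measurableT_comp (measurable_cons_rVT mf)).
  exact: measurable_fun_pair.
pose F a := (\int[lebesgue_rV R d]_v f (cons_rV (a, v)))%E.
have F0 a : (0 <= F a)%E by exact: integral_ge0.
have mF : measurable_fun setT F.
  apply: (@measurable_integral_rV d _ R (fun a v => f (cons_rV (a, v)))) => //.
  rewrite [X in measurable_fun _ X](_ : _ = f \o @cons_rV R d).
    exact: measurable_cons_rVT.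
  by apply/funext => -[].
rewrite -[RHS](gk ord0 F)//.
have -> : (fun a => \int[lebesgue_rV R d]_v f (\row_i g i (cons_rV (a, v) 0%R i)))%E =
    (fun a => \int[lebesgue_rV R d]_v f (cons_rV (g ord0 a, \row_i g (lift ord0 i) (v 0%R i))))%E.
  by apply/funext => a; apply: eq_integral => v _; rewrite E.
congr (_ * _)%E; rewrite -ge0_integralZl//.
- apply: eq_integral => a _; rewrite /F.
  by apply: (ih (fun i => g (lift ord0 i)) (fun v => f (cons_rV (g ord0 a, v))))=> // *; exact: gk.
- apply: (@measurableT_comp _ _ _ _ _ _ (fun a => \int[lebesgue_rV R d]_v
    f (cons_rV (a, \row_i g (lift ord0 i) (v 0%R i))))%E) => //.
  apply: (@measurable_integral_rV d _ R
    (fun a v => f (cons_rV (a, \row_i g (lift ord0 i) (v 0%R i))))) => //.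
  apply: (measurableT_comp (measurable_cons_rVT mf)).
  apply: measurable_fun_pair; first exact: measurable_fst.
  have := measurable_map_rV (fun i => mg (lift ord0 i)).
  by move/measurableT_comp; apply; exact: measurable_snd.
- exact: mg.
- by move=> a _; exact: integral_ge0.
- by rewrite lee_fin exprn_ge0.
Qed.

Lemma ge0_integral_reflect_rV d (a : 'rV[R]_d) (f : 'rV[R]_d -> \bar R) :
  measurable_fun setT f -> (forall x, 0 <= f x)%E ->
  (\int[lebesgue_rV R d]_x f (a - x)%R = \int[lebesgue_rV R d]_x f x)%E.
Proof.
move=> mf f0; rewrite -[RHS](@ge0_integral_map_rV 1 _ (fun i x => a 0 i - x))//.
- rewrite expr1n mul1e; apply: eq_integral => x _; congr f.
  by apply/rowP => i; rewrite !mxE.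
- by move=> i; exact: measurable_funB.
- by move=> i h mh h0; rewrite mul1e ge0_integral_reflect.
Qed.

Lemma ge0_integral_affine_rV d (k : R) (a : 'rV[R]_d) (f : 'rV[R]_d -> \bar R) :
  0 < k -> measurable_fun setT f -> (forall x, 0 <= f x)%E ->
  ((k ^+ d)%:E * \int[lebesgue_rV R d]_x f (k *: (x - a))%R =
   \int[lebesgue_rV R d]_x f x)%E.
Proof.
move=> k0 mf f0; rewrite -[RHS](@ge0_integral_map_rV k _ (fun i x => (x - a 0 i) * k))//.
- congr (_ * _)%E; apply: eq_integral => x _; congr f.
  by apply/rowP => i; rewrite !mxE mulrC.
- exact: ltW.
- by move=> i; apply: measurable_funM => //; exact: measurable_funB.
- by move=> i h mh h0; rewrite ge0_integral_affine.
Qed.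

Lemma ge0_integral_shift_rV d (a : 'rV[R]_d) (f : 'rV[R]_d -> \bar R) :
  measurable_fun setT f -> (forall x, 0 <= f x)%E ->
  (\int[lebesgue_rV R d]_x f (x - a)%R = \int[lebesgue_rV R d]_x f x)%E.
Proof.
move=> mf f0; rewrite -[RHS](@ge0_integral_affine_rV _ 1 a)// expr1n mul1e.
by apply: eq_integral => x _; rewrite scale1r.
Qed.

End lebesgue_rV_theory.

(** * The Euclidean norm and the heat kernel *)

Section euclidean_norm.
Context (R : realType) (d : nat).
Implicit Types x y : 'rV[R]_d.

Lemma enorm_ge0 x : 0 <= enorm x.
Proof. exact: sqrtr_ge0. Qed.

Lemma enorm_sqr x : enorm x ^+ 2 = \sum_(i < d) x 0 i ^+ 2.
Proof. by rewrite sqr_sqrtr// sumr_ge0// => i _; exact: sqr_ge0. Qed.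

Lemma enormN x : enorm (- x) = enorm x.
Proof. by congr Num.sqrt; apply: eq_bigr => i _; rewrite mxE sqrrN. Qed.

Lemma enorm0 : enorm (0 : 'rV[R]_d) = 0.
Proof.
apply/eqP; rewrite -sqrf_eq0 enorm_sqr; apply/eqP.
by apply: big1 => i _; rewrite mxE expr0n.
Qed.

Lemma enormZ (c : R) x : 0 <= c -> enorm (c *: x) = c * enorm x.
Proof.
move=> c0; apply/eqP; rewrite -(@eqrXn2 _ 2)// ?mulr_ge0 ?enorm_ge0//.
rewrite exprMn !enorm_sqr mulr_sumr; apply/eqP; apply: eq_bigr => i _.
by rewrite mxE exprMn.
Qed.

Lemma coord_le_enorm x i : `|x 0 i| <= enorm x.
Proof.
rewrite -ler_sqr ?nnegrE ?enorm_ge0// enorm_sqr real_normK ?num_real//.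
by rewrite (bigD1 i)//= lerDl sumr_ge0// => j _; exact: sqr_ge0.
Qed.

Lemma enorm_eq0 x : (enorm x == 0) = (x == 0).
Proof.
apply/idP/idP => [/eqP x0|/eqP ->]; last by rewrite enorm0.
apply/eqP/rowP => i; rewrite mxE; apply/eqP.
by rewrite -normr_le0 -x0 coord_le_enorm.
Qed.

Lemma enorm_le_bound x (c : R) : 0 <= c -> (forall i, `|x 0 i| <= c) ->
  enorm x <= d%:R * c.
Proof.
move=> c0 xc; rewrite -ler_sqr ?nnegrE ?enorm_ge0 ?mulr_ge0// enorm_sqr.
apply: (@le_trans _ _ (\sum_(i < d) c ^+ 2)).
  apply: ler_sum => i _; rewrite -[leLHS]real_normK ?num_real//.
  by rewrite ler_sqr ?nnegrE.
rewrite sumr_const card_ord exprMn -[leLHS]mulr_natl ler_wpM2r ?sqr_ge0//.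
by rewrite -natrX ler_nat; case: (d) => // n; rewrite expnS expn1 leq_pmulr.
Qed.

Lemma enorm_sqrD x y : enorm (x + y) ^+ 2 =
  enorm x ^+ 2 + 2 * (\sum_(i < d) x 0 i * y 0 i) + enorm y ^+ 2.
Proof.
rewrite !enorm_sqr mulr_sumr -!big_split/=; apply: eq_bigr => i _.
by rewrite mxE; ring.
Qed.

(* Cauchy-Schwarz with a non-optimal constant, which is all that is needed. *)
Lemma dot_le_enorm x y :
  `|\sum_(i < d) x 0 i * y 0 i| <= d%:R * (enorm x * enorm y).
Proof.
apply: (le_trans (ler_norm_sum _ _ _)).
apply: (@le_trans _ _ (\sum_(i < d) enorm x * enorm y)).
  by apply: ler_sum => i _; rewrite normrM ler_pM// coord_le_enorm.
by rewrite sumr_const card_ord mulr_natl.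
Qed.

(** Coordinatewise (a + b)^2 <= 2 (a^2 + b^2). The maximum passes through a power by monotonicity
    alone, which gives [powR_enormD] without convexity. *)
Lemma enormD_le_max x y : enorm (x + y) <= 2 * Num.max (enorm x) (enorm y).
Proof.
have m0 : 0 <= Num.max (enorm x) (enorm y) by rewrite le_max enorm_ge0.
rewrite -ler_sqr ?nnegrE ?enorm_ge0 ?mulr_ge0//.
apply: (@le_trans _ _ (2 * (enorm x ^+ 2 + enorm y ^+ 2))).
  rewrite !enorm_sqr -big_split/= mulr_sumr; apply: ler_sum => i _.
  rewrite mxE; have := sqr_ge0 (x 0 i - y 0 i); nra.
have hx : enorm x ^+ 2 <= Num.max (enorm x) (enorm y) ^+ 2.
  by rewrite ler_sqr ?nnegrE ?enorm_ge0// le_max lexx.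
have hy : enorm y ^+ 2 <= Num.max (enorm x) (enorm y) ^+ 2.
  by rewrite ler_sqr ?nnegrE ?enorm_ge0// le_max lexx orbT.
by nra.
Qed.

Lemma powR_enormD p x y : 0 <= p ->
  enorm (x + y) `^ p <= 2 `^ p * (enorm x `^ p + enorm y `^ p).
Proof.
move=> p0; have m0 : 0 <= Num.max (enorm x) (enorm y) by rewrite le_max enorm_ge0.
apply: (@le_trans _ _ ((2 * Num.max (enorm x) (enorm y)) `^ p)).
  by rewrite ge0_ler_powR// ?nnegrE ?enorm_ge0 ?mulr_ge0// enormD_le_max.
rewrite powRM// ler_wpM2l ?powR_ge0//.
by rewrite maxEle; case: ifP => _; [rewrite lerDr|rewrite lerDl]; exact: powR_ge0.
Qed.

End euclidean_norm.

(** * Elementary bounds on the exponential *)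

Section exponential_bounds.
Context (R : realType).
Implicit Types a b c q : R.

Lemma abs_expRB1 a : `|expR a - 1| <= `|a| * expR `|a|.
Proof.
have [a0|a0] := leP 0 a.
  rewrite (ger0_norm a0) ger0_norm ?subr_ge0; last first.
    by rewrite -[leLHS]expR0 ler_expR.
  have := expR_ge1Dx (- a); rewrite expRN => h.
  have := expR_gt0 a => e0.
  have : (1 - a) * expR a <= 1.
    by have := ler_wpM2r (ltW e0) h; rewrite mulVf ?lt0r_neq0.
  by lra.
have e1 : expR a <= 1 by rewrite -[leRHS]expR0 ler_expR ltW.
rewrite (ltr0_norm a0) ler0_norm ?subr_le0// opprB.
have h := expR_ge1Dx a; have h2 := expR_ge1Dx (- a).
apply: (@le_trans _ _ (- a)); first lra.
rewrite ler_peMr//; lra.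
Qed.

Lemma le_expR a : a <= expR a.
Proof. by have := expR_ge1Dx a; lra. Qed.

(** Completing the square: k q <= 2 k^2 + q^2 / 8. The term q^2 / 8 is half of the exponent q^2 / 4
    of the heat kernel, with q = |x| / sqrt u. *)
Lemma expR_absorb (k q : R) :
  expR (k * (1 + q)) <= expR (k + 2 * k ^+ 2) * expR (q ^+ 2 / 8).
Proof.
rewrite -expRD ler_expR.
have := sqr_ge0 (q - 4 * k); nra.
Qed.

Lemma powR_absorb (p q : R) : 0 <= p -> 0 <= q ->
  q `^ p <= expR (2 * p ^+ 2) * expR (q ^+ 2 / 8).
Proof.
move=> p0 q0; apply: (@le_trans _ _ (expR (q * p))).
  by rewrite expRM ge0_ler_powR// ?nnegrE ?expR_ge0// le_expR.
rewrite -expRD ler_expR; have := sqr_ge0 (q - 4 * p); nra.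
Qed.

(** The factor s, later the size of a shift, stays outside. The rest of |a| exp |a| is absorbed
    twice into exp (K (1 + q)): once for k (1 + q), once for exp |a|. *)
Lemma abs_expR_diff a (k s q : R) : `|a| <= s * (k * (1 + q)) -> 0 <= q ->
  0 <= s -> 0 <= k -> forall K, s * k <= K -> k <= K ->
  `|expR a - 1| <= s * expR (2 * K * (1 + q)).
Proof.
move=> ak q0 s0 k0 K sK kK.
have K0 : 0 <= K by lra.
apply: (le_trans (abs_expRB1 a)).
have h1 : k * (1 + q) <= expR (K * (1 + q)).
  by apply: le_trans (le_expR _); rewrite ler_wpM2r//; lra.
have h2 : expR `|a| <= expR (K * (1 + q)).
  by rewrite ler_expR (le_trans ak)// mulrA ler_wpM2r//; lra.
rewrite (_ : 2 * K * (1 + q) = K * (1 + q) + K * (1 + q)); last ring.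
rewrite expRD mulrA ler_pM//.
by rewrite (le_trans ak)// ler_wpM2l.
Qed.

(** When a and b are the exponents of two shifts and c is of the order of their product, each term
    on the right is small in both shifts. *)
Lemma expR_second_diff a b c :
  expR (a + b + c) - expR a - expR b + 1 =
  (expR a - 1) * (expR b - 1) + expR (a + b) * (expR c - 1).
Proof. by rewrite !expRD; ring. Qed.

End exponential_bounds.

Section heat_kernel.
Context (R : realType) (d : nat).
Implicit Types (u v : R) (x y z h : 'rV[R]_d).

Lemma gauss_densityE v x : 0 < v ->
  gauss_density v x =
  normal_peak (Num.sqrt v) ^+ d * expR (- (enorm x ^+ 2 / (2 * v))).
Proof.
move=> v0; rewrite /gauss_density.
under eq_bigr do rewrite (normal_pdfE _ (lt0r_neq0 (_ : 0 < Num.sqrt v))) ?sqrtr_gt0//.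
rewrite big_split/= prodr_const card_ord -expR_sum; congr (_ * expR _).
rewrite enorm_sqr mulr_suml -sumrN; apply: eq_bigr => i _.
by rewrite sqr_sqrtr ?ltW// subr0 mulNr mulr_natl.
Qed.

Lemma gauss_density_ge0 v x : 0 <= gauss_density v x.
Proof. by apply: prodr_ge0 => i _; exact: normal_pdf_ge0. Qed.

Lemma measurable_gauss_density v :
  measurable_fun setT (gauss_density v : 'rV[R]_d -> R).
Proof.
apply: measurable_prod => i _.
apply: (measurableT_comp (measurable_normal_pdf _ _)).
exact: measurable_coord_rV.
Qed.

(* The density of sqrt 2 B_u, i.e. the fundamental solution of the heat
   equation with generator the full Laplacian. *)
Definition heat u x : R := gauss_density (2 * u) x.

Lemma heat_ge0 u x : 0 <= heat u x.
Proof. exact: gauss_density_ge0. Qed.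

Lemma measurable_heat u : measurable_fun setT (heat u).
Proof. exact: measurable_gauss_density. Qed.

Definition heat_peak u : R := normal_peak (Num.sqrt (2 * u)) ^+ d.

Lemma heatE u x : 0 < u ->
  heat u x = heat_peak u * expR (- ((enorm x / Num.sqrt u) ^+ 2 / 4)).
Proof.
move=> u0; rewrite /heat gauss_densityE ?mulr_gt0//; congr (_ * expR (- _)).
rewrite expr_div_n (sqr_sqrtr (ltW u0)); field; exact: lt0r_neq0.
Qed.

Lemma heat_peak_gt0 u : 0 < u -> 0 < heat_peak u.
Proof.
move=> u0; rewrite exprn_gt0// normal_peak_gt0// lt0r_neq0// sqrtr_gt0.
by rewrite mulr_gt0.
Qed.

Lemma heat_le_peak u x : 0 < u -> heat u x <= heat_peak u.
Proof.
move=> u0; rewrite heatE// ler_piMr//; first exact/ltW/heat_peak_gt0.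
by rewrite expR_le1 oppr_le0 divr_ge0// sqr_ge0.
Qed.

Lemma normal_peak_sqrt2 v : 0 <= v ->
  normal_peak (Num.sqrt (2 * v)) = (Num.sqrt 2)^-1 * normal_peak (Num.sqrt v).
Proof.
move=> v0; rewrite /normal_peak !sqr_sqrtr// ?mulr_ge0// -mulrA -mulrnAr.
by rewrite sqrtrM// invfM.
Qed.

(** Half of the Gaussian exponent belongs to the kernel of age 2 u; the other half is left to absorb
    powers and exponentials of |x| / sqrt u. *)
Lemma heat_doubling u x : 0 < u ->
  heat u x = Num.sqrt 2 ^+ d * heat (2 * u) x *
             expR (- ((enorm x / Num.sqrt u) ^+ 2 / 8)).
Proof.
move=> u0; have u20 : 0 <= 2 * u by rewrite mulr_ge0// ltW.
have -> : heat (2 * u) x =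
    heat_peak (2 * u) * expR (- ((enorm x / Num.sqrt u) ^+ 2 / 8)).
  rewrite heatE ?mulr_gt0//; congr (_ * expR (- _)).
  rewrite !expr_div_n (sqr_sqrtr (ltW u0)) (sqr_sqrtr u20).
  by field; exact: lt0r_neq0.
have P : heat_peak u = Num.sqrt 2 ^+ d * heat_peak (2 * u).
  rewrite /heat_peak [in RHS]normal_peak_sqrt2// -exprMn.
  by rewrite mulrA divff ?mul1r// lt0r_neq0// sqrtr_gt0.
rewrite heatE// [LHS](_ : _ = heat_peak u *
  (expR (- ((enorm x / Num.sqrt u) ^+ 2 / 8)) *
   expR (- ((enorm x / Num.sqrt u) ^+ 2 / 8)))).
  by rewrite P; ring.
by rewrite -expRD; congr (_ * expR _); move: (enorm x / _) => q; field.
Qed.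

(** The density of sqrt 2 times a centred Gaussian vector of variance u, with the Jacobian of the
    dilation in front. *)
Lemma heat_scale u x : 0 < u ->
  (Num.sqrt 2)^-1 ^+ d * gauss_density u ((Num.sqrt 2)^-1 *: x) = heat u x.
Proof.
move=> u0; rewrite /heat !gauss_densityE ?mulr_gt0// mulrA -exprMn.
rewrite -normal_peak_sqrt2 ?ltW//; congr (_ * expR (- _)).
rewrite enormZ ?invr_ge0 ?sqrtr_ge0// exprMn exprVn (@sqr_sqrtr _ 2)//.
field; exact: lt0r_neq0.
Qed.

End heat_kernel.

Section gauss_mass.
Context (R : realType).

Lemma gauss_density_cons d (v : R) (a : R) (x : 'rV[R]_d) :
  gauss_density v (cons_rV (a, x)) =
  normal_pdf 0 (Num.sqrt v) a * gauss_density v x.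
Proof.
rewrite /gauss_density big_ord_recl cons_rV0; congr (_ * _).
by apply: eq_bigr => i _; rewrite cons_rVS.
Qed.

Lemma integral_gauss_density d (v : R) :
  (\int[lebesgue_rV R d]_x (gauss_density v x)%:E = 1)%E.
Proof.
elim: d => [|d ih].
  rewrite ge0_integral_rV0; first by rewrite /gauss_density big_ord0.
  by apply/measurable_EFinP; exact: measurable_gauss_density.
rewrite ge0_integral_rVS//; last 2 first.
- by apply/measurable_EFinP; exact: measurable_gauss_density.
- by move=> x; rewrite lee_fin gauss_density_ge0.
under eq_integral => a _.
  under eq_integral do rewrite gauss_density_cons EFinM.
  rewrite ge0_integralZl//; last 3 first.
  - by apply/measurable_EFinP; exact: measurable_gauss_density.
  - by move=> x _; rewrite lee_fin gauss_density_ge0.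
  - by rewrite lee_fin normal_pdf_ge0.
  rewrite ih mule1; over.
exact: integral_normal_pdf.
Qed.

Lemma integral_heat d (u : R) : (\int[lebesgue_rV R d]_x (heat u x)%:E = 1)%E.
Proof. exact: integral_gauss_density. Qed.

End gauss_mass.

(** * First and second differences of the heat kernel *)

Section heat_estimates.
Context (R : realType) (d : nat).
Implicit Types (u v : R) (x y z h b : 'rV[R]_d).

Lemma heat_shift u z h : 0 < u -> heat u (z + h) = heat u z *
  expR (- ((2 * (\sum_(i < d) z 0 i * h 0 i) + enorm h ^+ 2) / (4 * u))).
Proof.
move=> u0; rewrite !heatE// -mulrA -expRD; congr (_ * expR _).
rewrite !expr_div_n (sqr_sqrtr (ltW u0)) enorm_sqrD; field; exact: lt0r_neq0.
Qed.

Lemma heat_absorb k u z : 0 < u ->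
  heat u z * expR (k * (1 + enorm z / Num.sqrt u)) <=
  Num.sqrt 2 ^+ d * expR (k + 2 * k ^+ 2) * heat (2 * u) z.
Proof.
move=> u0; rewrite heat_doubling//; set q := enorm z / _.
have := expR_absorb k q; rewrite -ler_pdivrMr ?expR_gt0// -expRN => H.
set A := Num.sqrt 2 ^+ d; set B := heat _ _.
rewrite [leLHS](_ : _ = A * B * (expR (k * (1 + q)) * expR (- (q ^+ 2 / 8)))); last first.
  by move: (expR (k * _)) (expR (- _)) => a b; ring.
rewrite [leRHS](_ : _ = A * B * expR (k + 2 * k ^+ 2)); last first.
  by move: (expR _) => a; ring.
by rewrite ler_wpM2l// !mulr_ge0 ?exprn_ge0 ?sqrtr_ge0 ?heat_ge0.
Qed.

Lemma heat_le_doubling u z : 0 < u ->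
  heat u z <= Num.sqrt 2 ^+ d * heat (2 * u) z.
Proof.
move=> u0; rewrite heat_doubling// ler_piMr//.
  by rewrite mulr_ge0 ?exprn_ge0 ?sqrtr_ge0// heat_ge0.
by rewrite expR_le1 oppr_le0 divr_ge0// sqr_ge0.
Qed.

Lemma heat_moment p u z : 0 <= p -> 0 < u ->
  enorm z `^ p * heat u z <=
  Num.sqrt 2 ^+ d * expR (2 * p ^+ 2) * Num.sqrt u `^ p * heat (2 * u) z.
Proof.
move=> p0 u0; rewrite heat_doubling//; set q := enorm z / _.
have su0 : 0 < Num.sqrt u by rewrite sqrtr_gt0.
have -> : enorm z = q * Num.sqrt u by rewrite divfK// lt0r_neq0.
have q0 : 0 <= q by rewrite divr_ge0 ?enorm_ge0 ?sqrtr_ge0.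
rewrite powRM ?sqrtr_ge0//.
have := powR_absorb p0 q0; rewrite -ler_pdivrMr ?expR_gt0// -expRN => h.
set A := Num.sqrt 2 ^+ d; set B := Num.sqrt u `^ p; set H := heat _ _.
rewrite [leLHS](_ : _ = A * B * H * (q `^ p * expR (- (q ^+ 2 / 8)))); last first.
  by move: (q `^ p) (expR _) => a b; ring.
rewrite [leRHS](_ : _ = A * B * H * expR (2 * p ^+ 2)); last first.
  by move: (expR _) => a; ring.
by rewrite ler_wpM2l// !mulr_ge0 ?exprn_ge0 ?sqrtr_ge0 ?powR_ge0 ?heat_ge0.
Qed.

Section exponents.
Variables (u : R) (u0 : 0 < u).
Let s := Num.sqrt u.
Let s0 : 0 < s. Proof. by rewrite sqrtr_gt0. Qed.
Let sq : s ^+ 2 = u. Proof. by rewrite sqr_sqrtr// ltW. Qed.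

Lemma dot_scaled z h : `|(\sum_(i < d) z 0 i * h 0 i) / u| <=
  d%:R * (enorm z / s * (enorm h / s)).
Proof.
rewrite normrM [`|u^-1|]gtr0_norm ?invr_gt0// ler_pdivrMr//.
rewrite [leRHS](_ : _ = d%:R * (enorm z * enorm h)); first exact: dot_le_enorm.
rewrite -sq; move: (d%:R) (enorm z) (enorm h) => n a b.
by field; exact: lt0r_neq0.
Qed.

(** The exponent of [heat_shift] has a bilinear and a quadratic part in h. The bound Z on |h| / sqrt
    u makes the quadratic part linear, so one factor |h| / sqrt u can be taken out. *)
Lemma shift_exponent Z z h : enorm h / s <= Z ->
  `|- ((2 * (\sum_(i < d) z 0 i * h 0 i) + enorm h ^+ 2) / (4 * u))| <=
  enorm h / s * ((d%:R + Z) * (1 + enorm z / s)).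
Proof.
move=> hZ; rewrite normrN.
have -> : (2 * (\sum_(i < d) z 0 i * h 0 i) + enorm h ^+ 2) / (4 * u) =
   2^-1 * ((\sum_(i < d) z 0 i * h 0 i) / u) + 4^-1 * (enorm h / s) ^+ 2.
  by rewrite expr_div_n sq; field; exact: lt0r_neq0.
have h1 := dot_scaled z h.
have q0 : 0 <= enorm z / s by rewrite divr_ge0 ?enorm_ge0 ?ltW.
have e0 : 0 <= enorm h / s by rewrite divr_ge0 ?enorm_ge0 ?ltW.
apply: (le_trans (ler_normD _ _)).
rewrite [`|2^-1 * _|]normrM [`|2^-1|]ger0_norm ?invr_ge0//.
rewrite [`|4^-1 * _|]ger0_norm; last by rewrite mulr_ge0 ?invr_ge0 ?sqr_ge0.
have d0 : 0 <= d%:R :> R by [].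
move: h1 hZ q0 e0 d0; move: (d%:R) (enorm z / s) (enorm h / s) => n q e.
move: (`|_|) => D h1 hZ q0 e0 n0.
have h3 : e ^+ 2 <= e * Z by rewrite expr2 ler_wpM2l.
have h4 : 0 <= n * (q * e) by rewrite !mulr_ge0.
have h5 : 0 <= e * n by rewrite mulr_ge0.
have h6 : 0 <= e * Z by rewrite mulr_ge0//; lra.
have h7 : 0 <= e * (Z * q) by rewrite !mulr_ge0//; lra.
nra.
Qed.

End exponents.

(** Bounding |h| / sqrt u allows a right-hand side centred at z alone: the factor exp (c |z| / sqrt
    u) produced by the shift is absorbed by doubling the age. *)
Lemma heat_diff Z : 1 <= Z -> exists2 K, 0 < K & forall u z h, 0 < u ->
  enorm h / Num.sqrt u <= Z ->
  `|heat u (z + h) - heat u z| <= K * (enorm h / Num.sqrt u) * heat (2 * u) z.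
Proof.
move=> Z1; pose k : R := d%:R + Z; pose K := Z * k.
have d0 : 0 <= d%:R :> R by [].
have k0 : 0 <= k by rewrite addr_ge0//; lra.
pose M := Num.sqrt 2 ^+ d * expR (2 * K + 2 * (2 * K) ^+ 2).
exists M; first by rewrite mulr_gt0 ?exprn_gt0 ?sqrtr_gt0 ?expR_gt0.
move=> u z h u0 hZ; rewrite heat_shift// -[X in _ - X]mulr1 -mulrBr normrM.
rewrite (ger0_norm (heat_ge0 _ _)).
have q0 : 0 <= enorm z / Num.sqrt u by rewrite divr_ge0 ?enorm_ge0 ?sqrtr_ge0.
have e0 : 0 <= enorm h / Num.sqrt u by rewrite divr_ge0 ?enorm_ge0 ?sqrtr_ge0.
have kK : k <= K by rewrite /K -[leLHS]mul1r ler_wpM2r.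
have H := abs_expR_diff (shift_exponent u0 z hZ) q0 e0 k0 (ler_wpM2r k0 hZ) kK.
apply: (le_trans (ler_wpM2l (heat_ge0 _ _) H)).
have := heat_absorb (2 * K) z u0; rewrite -/M => H2.
by rewrite mulrCA [M * _]mulrC -[leRHS]mulrA; exact: ler_wpM2l.
Qed.

Lemma heat_diff2_small Z : 1 <= Z -> exists2 K, 0 < K & forall u z h b, 0 < u ->
  enorm b / Num.sqrt u <= Z -> enorm h / Num.sqrt u <= 1 ->
  `|heat u (z + h + b) - heat u (z + h) - (heat u (z + b) - heat u z)| <=
  K * (enorm b / Num.sqrt u * (enorm h / Num.sqrt u)) * heat (2 * u) z.
Proof.
move=> Z1; pose k : R := d%:R + Z; pose K := Z * k.
have d0 : 0 <= d%:R :> R by [].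
have k0 : 0 <= k by rewrite addr_ge0//; lra.
have kK : k <= K by rewrite /K -[leLHS]mul1r ler_wpM2r.
have K0 : 0 <= K by exact: le_trans kK.
(* A generous exponent: each of the two products in [expR_second_diff] needs at most exp (4 K (1 +
   q)). *)
pose M0 := 7 * K; pose M := Num.sqrt 2 ^+ d * expR (M0 + 2 * M0 ^+ 2).
exists (2 * M).
  by rewrite !mulr_gt0 ?exprn_gt0 ?sqrtr_gt0 ?expR_gt0.
move=> u z h b u0 bZ h1.
have s0 : 0 < Num.sqrt u by rewrite sqrtr_gt0.
have q0 : 0 <= enorm z / Num.sqrt u by rewrite divr_ge0 ?enorm_ge0 ?sqrtr_ge0.
have e0 : 0 <= enorm h / Num.sqrt u by rewrite divr_ge0 ?enorm_ge0 ?sqrtr_ge0.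
have f0 : 0 <= enorm b / Num.sqrt u by rewrite divr_ge0 ?enorm_ge0 ?sqrtr_ge0.
have hZ : enorm h / Num.sqrt u <= Z by exact: le_trans Z1.
have Ah := shift_exponent u0 z hZ.
have Ab := shift_exponent u0 z bZ.
have Dh := abs_expR_diff Ah q0 e0 k0 (ler_wpM2r k0 hZ) kK.
have Db := abs_expR_diff Ab q0 f0 k0 (ler_wpM2r k0 bZ) kK.
(* The part of the exponent at z + h + b that is not a sum of the parts for h and b: it is bilinear
   in the shifts. The factor [1 + 0] lets [abs_expR_diff] apply with q = 0. *)
have Ac : `|- (2^-1 * ((\sum_(i < d) h 0 i * b 0 i) / u))| <=
    enorm b / Num.sqrt u * (enorm h / Num.sqrt u) * (k * (1 + 0)).
  rewrite normrN normrM ger0_norm ?invr_ge0// addr0 mulr1.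
  have := dot_scaled u0 h b.
  move: e0 f0; move: (enorm h / _) (enorm b / _) => e f e0 f0 ef.
  have : 0 <= d%:R * (e * f) by rewrite !mulr_ge0.
  have : 0 <= Z * (e * f) by rewrite !mulr_ge0//; lra.
  by rewrite /k; lra.
have ZZ : enorm b / Num.sqrt u * (enorm h / Num.sqrt u) * k <= K.
  by rewrite ler_wpM2r// -[Z]mulr1 ler_pM.
have Dc := abs_expR_diff Ac (lexx 0) (mulr_ge0 f0 e0) k0 ZZ kK.
set A := - _ in Ah Dh; set B := - _ in Ab Db; set C := - _ in Ac Dc.
have -> : heat u (z + h + b) = heat u z * expR (A + B + C).
  rewrite -addrA heat_shift//; congr (_ * expR _); rewrite /A /B /C.
  rewrite enorm_sqrD.
  under eq_bigr do rewrite mxE mulrDr.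
  rewrite big_split/=; field; exact: lt0r_neq0.
rewrite (heat_shift z h u0) (heat_shift z b u0) -/A -/B.
have -> : heat u z * expR (A + B + C) - heat u z * expR A -
    (heat u z * expR B - heat u z) =
    heat u z * (expR (A + B + C) - expR A - expR B + 1) by ring.
rewrite expR_second_diff normrM (ger0_norm (heat_ge0 _ _)).
set q := enorm z / Num.sqrt u in q0 Ah Dh Ab Db *.
set e := enorm h / Num.sqrt u in e0 Ah Dh Ac Dc h1 hZ ZZ *.
set f := enorm b / Num.sqrt u in f0 Ab Db Ac Dc bZ ZZ *.
have bound : `|(expR A - 1) * (expR B - 1) + expR (A + B) * (expR C - 1)| <=
    f * e * (2 * expR (M0 * (1 + q))).
  apply: (le_trans (ler_normD _ _)); rewrite !normrM.
  have E1 : expR (2 * K * (1 + q)) * expR (2 * K * (1 + q)) <= expR (M0 * (1 + q)).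
    rewrite -expRD ler_expR /M0; nra.
  have E2 : expR (A + B) * expR (2 * K * (1 + 0)) <= expR (M0 * (1 + q)).
    rewrite -expRD ler_expR.
    have AK : A <= K * (1 + q).
      apply: (le_trans (ler_norm _)); apply: (le_trans Ah).
      by rewrite mulrA ler_wpM2r//; [lra|exact: ler_wpM2r].
    have BK : B <= K * (1 + q).
      apply: (le_trans (ler_norm _)); apply: (le_trans Ab).
      by rewrite mulrA ler_wpM2r//; [lra|exact: ler_wpM2r].
    rewrite /M0; nra.
  have P1 : `|expR A - 1| * `|expR B - 1| <= e * f * expR (M0 * (1 + q)).
    apply: (le_trans (ler_pM (normr_ge0 _) (normr_ge0 _) Dh Db)).
    by rewrite mulrACA ler_wpM2l// mulr_ge0.
  have P2 : `|expR (A + B)| * `|expR C - 1| <= f * e * expR (M0 * (1 + q)).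
    rewrite (ger0_norm (expR_ge0 _)).
    apply: (le_trans (ler_wpM2l (expR_ge0 _) Dc)).
    by rewrite mulrCA ler_wpM2l// mulr_ge0.
  by rewrite [e * f]mulrC in P1; lra.
apply: (le_trans (ler_wpM2l (heat_ge0 _ _) bound)).
have := heat_absorb M0 z u0; rewrite -/q -/M => H.
rewrite [leLHS](_ : _ = f * e * 2 * (heat u z * expR (M0 * (1 + q)))); last ring.
rewrite [leRHS](_ : _ = f * e * 2 * (M * heat (2 * u) z)); last ring.
have fe0 : 0 <= f * e * 2 by apply: mulr_ge0 => //; exact: mulr_ge0.
exact: ler_wpM2l fe0 _ _ H.
Qed.

(** If |h| <= sqrt u the ratio is below its power of exponent g and the second difference is used.
    Otherwise that power is at least 1, and the first differences in b at z + h and at z are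
    enough. *)
Lemma heat_diff2 Z : 1 <= Z -> exists2 K, 0 < K & forall u z h b g, 0 < u ->
  enorm b / Num.sqrt u <= Z -> 0 <= g <= 1 ->
  `|heat u (z + h + b) - heat u (z + h) - (heat u (z + b) - heat u z)| <=
  K * (enorm b / Num.sqrt u * (enorm h / Num.sqrt u) `^ g) *
  (heat (2 * u) (z + h) + heat (2 * u) z).
Proof.
move=> Z1; have [K1 K10 H1] := heat_diff Z1; have [K2 K20 H2] := heat_diff2_small Z1.
exists (K1 + K2); first exact: addr_gt0.
move=> u z h b g u0 bZ /andP[g0 g1].
have e0 : 0 <= enorm h / Num.sqrt u by rewrite divr_ge0 ?enorm_ge0 ?sqrtr_ge0.
have f0 : 0 <= enorm b / Num.sqrt u by rewrite divr_ge0 ?enorm_ge0 ?sqrtr_ge0.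
have [h1|h1] := leP (enorm h / Num.sqrt u) 1.
  apply: (le_trans (H2 _ z _ _ u0 bZ h1)).
  apply: ler_pM; [|exact: heat_ge0| |by rewrite lerDr heat_ge0].
    by apply: mulr_ge0; [exact: ltW|exact: mulr_ge0].
  apply: ler_pM; [exact: ltW|exact: mulr_ge0|by rewrite lerDr ltW|].
  apply: ler_wpM2l => //.
  move: e0; rewrite le_eqVlt => /predU1P[<-|e0]; first exact: powR_ge0.
  by rewrite ger1_powR// e0.
apply: (le_trans (ler_normB _ _)); rewrite mulrDr.
have e1 : 1 <= (enorm h / Num.sqrt u) `^ g.
  by rewrite -(powRr0 (enorm h / Num.sqrt u)) ler_powR// ltW.
apply: lerD.
  apply: (le_trans (H1 _ _ _ u0 bZ)); apply: ler_wpM2r; first exact: heat_ge0.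
  apply: ler_pM; [exact: ltW|by []|by rewrite lerDl ltW|].
  by rewrite ler_peMr.
apply: (le_trans (H1 _ _ _ u0 bZ)); apply: ler_wpM2r; first exact: heat_ge0.
apply: ler_pM; [exact: ltW|by []|by rewrite lerDl ltW|].
by rewrite ler_peMr.
Qed.

(** The same dichotomy. For large h both kernels are bounded separately, which is why both points
    appear on the right and h is unrestricted. *)
Lemma heat_holder : exists2 K, 0 < K & forall u z h g, 0 < u -> 0 <= g <= 1 ->
  `|heat u (z + h) - heat u z| <=
  K * (enorm h / Num.sqrt u) `^ g * (heat (2 * u) (z + h) + heat (2 * u) z).
Proof.
have [K K0 H] := heat_diff (lexx 1).
have S0 : 0 < Num.sqrt 2 ^+ d :> R by rewrite exprn_gt0 ?sqrtr_gt0.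
exists (K + Num.sqrt 2 ^+ d); first exact: addr_gt0.
move=> u z h g u0 /andP[g0 g1].
have e0 : 0 <= enorm h / Num.sqrt u by rewrite divr_ge0 ?enorm_ge0 ?sqrtr_ge0.
have [h1|h1] := leP (enorm h / Num.sqrt u) 1.
  apply: (le_trans (H _ z _ u0 h1)).
  apply: ler_pM; [|exact: heat_ge0| |by rewrite lerDr heat_ge0].
    by apply: mulr_ge0; [exact: ltW|].
  apply: ler_pM; [exact: ltW|by []|by rewrite lerDl ltW|].
  move: e0; rewrite le_eqVlt => /predU1P[<-|e0]; first exact: powR_ge0.
  by rewrite ger1_powR// e0.
apply: (le_trans (ler_normB _ _)); rewrite !(ger0_norm (heat_ge0 _ _)) mulrDr.
have e1 : 1 <= (enorm h / Num.sqrt u) `^ g.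
  by rewrite -(powRr0 (enorm h / Num.sqrt u)) ler_powR// ltW.
have c1 : Num.sqrt 2 ^+ d <= (K + Num.sqrt 2 ^+ d) * (enorm h / Num.sqrt u) `^ g.
  rewrite -[leLHS]mulr1; apply: ler_pM; [exact: ltW|exact: ler01| |exact: e1].
  by rewrite lerDr ltW.
by apply: lerD; (apply: (le_trans (heat_le_doubling _ u0)));
  rewrite ler_wpM2r ?heat_ge0.
Qed.

End heat_estimates.

(** * Densities of random vectors and Gaussian convolution *)

Section densities_theory.
Context (R : realType) (d : nat).
Local Notation leb := (@lebesgue_measure R).
Local Notation Leb := (lebesgue_rV R d).
Implicit Types (f g k : 'rV[R]_d -> R).

Lemma continuous_measurable_rV f : continuous f -> measurable_fun setT f.
Proof.
move=> /continuousP cf; apply: (measurability _ (RGenOInfty.measurableE R)) => //.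
move=> _ [_ [a ->] <-]; rewrite setTI; apply: open_rV_measurable.
by apply: cf; exact: interval_open.
Qed.

Lemma lebesgue_rV_ball (x : 'rV[R]_d) (e : R) : 0 < e ->
  Leb [set y | forall i, ball (x 0 i) e (y 0 i)] = ((e *+ 2) ^+ d)%:E.
Proof.
move=> e0; rewrite (lebesgue_rV_box (fun i => measurable_ball (x 0 i) e)).
rewrite (eq_bigr (fun=> (e *+ 2)%:E)); last first.
  by move=> i _; rewrite lebesgue_measure_ball// ltW.
by rewrite prodEFin prodr_const card_ord.
Qed.

Lemma measurable_rV_ball (x : 'rV[R]_d) (e : R) :
  measurable [set y : 'rV[R]_d | forall i, ball (x 0 i) e (y 0 i)].
Proof.
rewrite (_ : [set _ | _] = \bigcap_(i in [set: 'I_d])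
    ((fun y : 'rV[R]_d => y 0 i) @^-1` ball (x 0 i) e)); last first.
  by apply/seteqP; split => [y yx i _|y yx i]; [exact: yx|exact: yx].
apply: fin_bigcap_measurable => // i _.
by rewrite -[X in measurable X]setTI; apply: measurable_coord_rV => //;
  exact: measurable_ball.
Qed.

(** If f x < g x, then near x the two functions are separated by a third of the difference, and a
    small cube around x has different masses. *)
Lemma continuous_density_le f g : continuous f -> continuous g ->
  (forall x, 0 <= f x) -> (forall x, 0 <= g x) ->
  (forall A, measurable A ->
    (\int[Leb]_(x in A) (f x)%:E = \int[Leb]_(x in A) (g x)%:E)%E) ->
  forall x, g x <= f x.
Proof.
move=> cf cg f0 g0 fg x; rewrite leNgt; apply/negP => fgx.
pose r := (g x - f x) / 3.
have r0 : 0 < r by rewrite divr_gt0// subr_gt0.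
have nx : \forall y \near x, f y < f x + r /\ g x - r < g y.
  by near=> y; split; near: y; [apply: (cvgr_lt _ (cf x))|apply: (cvgr_gt _ (cg x))];
    rewrite ?ltrDl ?gtrBl.
have /nbhs_ballP[e /= e0 eU] := nx.
pose U := [set y : 'rV[R]_d | forall i, ball (x 0 i) e (y 0 i)].
have mU : measurable U by exact: measurable_rV_ball.
have UE y : U y -> f y <= f x + r /\ g x - r <= g y.
  move=> Uy; have /eU[] : ball x e y by split => // i j; rewrite (ord1 i); exact: Uy.
  by move=> /ltW ? /ltW ?.
have V0 : 0 < (e *+ 2) ^+ d by rewrite exprn_gt0// pmulrn_lgt0.
have mf := continuous_measurable_rV cf.
have mg := continuous_measurable_rV cg.
have h1 : (\int[Leb]_(y in U) (f y)%:E <= (f x + r)%:E * ((e *+ 2) ^+ d)%:E)%E.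
  rewrite -(lebesgue_rV_ball x e0) -integral_cst//.
  apply: ge0_le_integral => //.
  - by move=> y _; rewrite lee_fin.
  - by apply/measurable_EFinP; exact: measurable_funS mf.
  - by move=> y /UE[? _]; rewrite lee_fin.
have h2 : ((g x - r)%:E * ((e *+ 2) ^+ d)%:E <= \int[Leb]_(y in U) (g y)%:E)%E.
  rewrite -(lebesgue_rV_ball x e0) -integral_cst//.
  apply: ge0_le_integral => //.
  - by move=> y _; rewrite lee_fin /r; have := f0 x; have := g0 x; lra.
  - by apply/measurable_EFinP; exact: measurable_funS mg.
  - by move=> y /UE[_ ?]; rewrite lee_fin.
have := le_trans h2; rewrite -(fg _ mU) => /(_ _ h1).
rewrite -!EFinM lee_fin ler_pM2r// /r; lra.
Unshelve. all: by end_near. Qed.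

Lemma continuous_density_unique f g : continuous f -> continuous g ->
  (forall x, 0 <= f x) -> (forall x, 0 <= g x) ->
  (forall A, measurable A ->
    (\int[Leb]_(x in A) (f x)%:E = \int[Leb]_(x in A) (g x)%:E)%E) -> f = g.
Proof.
move=> cf cg f0 g0 fg; apply/funext => x; apply/eqP; rewrite eq_le.
rewrite (continuous_density_le cf cg f0 g0 fg) andbT.
by rewrite (continuous_density_le cg cf g0 f0)// => A mA; rewrite fg.
Qed.

Lemma layer_cake (a : R) : 0 <= a ->
  (\int[leb]_r (\1_(`[0%R, a[%classic) r)%:E = a%:E)%E.
Proof.
move=> a0; rewrite integral_indic//= setIT lebesgue_measure_itv/= lte_fin.
by have [|a0'] := ltP 0 a; [rewrite sube0|congr EFin; apply/eqP; rewrite eq_le a0].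
Qed.

End densities_theory.

Lemma measurable_preimage dX dY (X : measurableType dX) (Y : measurableType dY)
    (g : X -> Y) A :
  measurable_fun setT g -> measurable A -> measurable (g @^-1` A).
Proof. by move=> mg mA; rewrite -[X in measurable X]setTI; exact: mg. Qed.

Section measurable_rV_operations.
Context (R : realType) (d : nat) dT (T : measurableType dT) (D : set T).
Implicit Types f g : T -> 'rV[R]_d.

Lemma measurable_coord_fun f i : measurable_fun D f ->
  measurable_fun D (fun x => f x 0 i).
Proof.
by move=> mf; apply: (measurableT_comp (measurable_coord_rV i)).
Qed.

Lemma measurable_funD_rV f g : measurable_fun D f -> measurable_fun D g ->
  measurable_fun D (fun x => f x + g x).
Proof.
move=> mf mg; apply: measurable_fun_rV => i; under eq_fun do rewrite mxE.
by apply: measurable_funD; exact: measurable_coord_fun.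
Qed.

Lemma measurable_funZ_rV (c : R) f : measurable_fun D f ->
  measurable_fun D (fun x => c *: f x).
Proof.
move=> mf; apply: measurable_fun_rV => i; under eq_fun do rewrite mxE.
by apply: measurable_funM => //; exact: measurable_coord_fun.
Qed.

Lemma measurable_funB_rV f g : measurable_fun D f -> measurable_fun D g ->
  measurable_fun D (fun x => f x - g x).
Proof.
move=> mf mg; under eq_fun do rewrite -scaleN1r.
by apply: measurable_funD_rV => //; exact: measurable_funZ_rV.
Qed.

End measurable_rV_operations.

Section random_vectors.
Context (R : realType) (d : nat) dO (Omega : measurableType dO)
  (P : probability Omega R).
Local Notation leb := (@lebesgue_measure R).
Local Notation Leb := (lebesgue_rV R d).
Implicit Types (X Z W : Omega -> 'rV[R]_d).

Definition rv_density X (f : 'rV[R]_d -> R) : Prop :=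
  [/\ measurable_fun setT X, measurable_fun setT f, forall x, 0 <= f x &
    forall A, measurable A -> (P (X @^-1` A) = \int[Leb]_(x in A) (f x)%:E)%E].

(* Layer cake and Tonelli: only the level sets of k enter. *)
Lemma integral_rv_density X f (k : 'rV[R]_d -> R) : rv_density X f ->
  measurable_fun setT k -> (forall x, 0 <= k x) ->
  (\int[P]_w (k (X w))%:E = \int[Leb]_x (k x * f x)%:E)%E.
Proof.
move=> [mX mf f0 Xf] mk k0.
have mS dT (T : measurableType dT) (h : T -> R) : measurable_fun setT h ->
    measurable ([set z : T * R | 0 <= z.2] `&` [set z : T * R | z.2 < h z.1]).
  move=> mh; apply: measurableI.
    rewrite (_ : [set _ | _] = @snd T R @^-1` `[0%R, +oo[); last first.
      by apply/seteqP; split => z; rewrite /= in_itv/= andbT.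
    by rewrite -[X in measurable X]setTI; exact: measurable_snd.
  have := @measurable_fun_ltr _ _ R setT (@snd T R) (h \o fst) (@measurable_snd _ _ _ _)
    (measurableT_comp mh (@measurable_fst _ _ _ _)).
  move=> /(_ measurableT [set true]); rewrite setTI; apply.
  by [].
have SE T (h : T -> R) x r :
    \1_([set z : T * R | 0 <= z.2] `&` [set z | z.2 < h z.1]) (x, r) =
    \1_(`[0%R, h x[%classic) r :> R.
  rewrite !indicE; congr (nat_of_bool _)%:R.
  apply/idP/idP; rewrite !inE/= in_itv/=; first by case=> -> ->.
  by move=> /andP[].
transitivity (\int[P]_w \int[leb]_r (\1_(`[0%R, k (X w)[%classic) r)%:E)%E.
  by apply: eq_integral => w _; rewrite layer_cake.
have mkX : measurable_fun setT (k \o X) by exact: measurableT_comp.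
pose F1 (z : Omega * R) : \bar R :=
  (\1_([set z : Omega * R | 0 <= z.2] `&` [set z | z.2 < (k \o X) z.1]) z)%:E.
have mF1 : measurable_fun setT F1.
  by apply/measurable_EFinP; apply: measurable_indic; exact: mS.
have F10 z : (0 <= F1 z)%E by rewrite lee_fin.
transitivity (\int[P]_w \int[leb]_r F1 (w, r))%E.
  by apply: eq_integral => w _; apply: eq_integral => r _; rewrite /F1 SE.
rewrite (@fubini_tonelli _ _ Omega (measurableTypeR R) R P leb F1)//.
pose F2 (z : 'rV[R]_d * R) : \bar R :=
  ((\1_([set z : 'rV[R]_d * R | 0 <= z.2] `&` [set z | z.2 < k z.1]) z)%:E * (f z.1)%:E)%E.
have mF2 : measurable_fun setT F2.
  apply: emeasurable_funM.
    by apply/measurable_EFinP; apply: measurable_indic; exact: mS.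
  by apply/measurable_EFinP; apply: measurableT_comp.
have F20 z : (0 <= F2 z)%E by rewrite mule_ge0// lee_fin.
transitivity (\int[Leb]_x \int[leb]_r F2 (x, r))%E; last first.
  apply: eq_integral => x _; rewrite /F2/=.
  under eq_integral do rewrite SE.
  rewrite ge0_integralZr//; first by rewrite layer_cake// EFinM.
  - by apply/measurable_EFinP; exact: measurable_indic.
  - by rewrite lee_fin.
rewrite (@fubini_tonelli _ _ 'rV[R]_d (measurableTypeR R) R Leb leb F2)//.
apply: eq_integral => r _.
pose A := [set x | 0 <= r /\ r < k x].
have mA : measurable A.
  have := mS _ _ k mk.
  move=> /measurable_ysection => /(_ r).
  rewrite (_ : ysection _ _ = A)//; apply/seteqP; split => x.
    by rewrite /ysection/= inE.
  by rewrite /ysection/= inE.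
have AE x : \1_([set z : 'rV[R]_d * R | 0 <= z.2] `&` [set z | z.2 < k z.1]) (x, r) =
    \1_A x :> R.
  by rewrite !indicE; congr (nat_of_bool _)%:R; apply/idP/idP; rewrite !inE.
transitivity (P (X @^-1` A)).
  by rewrite -[X in P X]setIT -integral_indic//; exact: measurable_preimage.
rewrite Xf// integral_mkcond; apply: eq_integral => x _.
rewrite /F2/= AE patchE indicE; case: ifPn => _; first by rewrite mul1e.
by rewrite mul0e.
Qed.

(** Independence on rectangles identifies the joint law of Z and W with the product of their laws;
    Tonelli then conditions on Z, and a second exchange moves the expectation inside. *)
Lemma law_gauss_sum v Z W : 0 < v -> measurable_fun setT Z -> measurable_fun setT W ->
  (forall A, measurable A ->
    P (W @^-1` A) = (\int[Leb]_(x in A) (gauss_density v x)%:E)%E) ->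
  (forall A1 A2, measurable A1 -> measurable A2 ->
    P (Z @^-1` A1 `&` W @^-1` A2) = (P (Z @^-1` A1) * P (W @^-1` A2))%E) ->
  forall A, measurable A -> P ((fun w => Z w + Num.sqrt 2 *: W w) @^-1` A) =
    (\int[Leb]_(y in A) \int[P]_w (heat v (y - Z w))%:E)%E.
Proof.
move=> v0 mZ mW Wg indep A mA.
have mZW : measurable_fun setT (fun w => (Z w, W w)) by exact: measurable_fun_pair.
pose Zm : {mfun Omega >-> 'rV[R]_d} := HB.pack Z (isMeasurableFun.Build _ _ _ _ Z mZ).
pose Wm : {mfun Omega >-> 'rV[R]_d} := HB.pack W (isMeasurableFun.Build _ _ _ _ W mW).
pose ZWm : {mfun Omega >-> ('rV[R]_d * 'rV[R]_d)%type} :=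
  HB.pack (fun w => (Z w, W w)) (isMeasurableFun.Build _ _ _ _ _ mZW).
have prodE := @product_measure_unique _ _ _ _ R (distribution P Zm)
  (distribution P Wm) (distribution P ZWm) indep.
pose sum (z : 'rV[R]_d * 'rV[R]_d) := z.1 + Num.sqrt 2 *: z.2.
have msum : measurable_fun setT sum.
  by apply: measurable_funD_rV => //; exact: measurable_funZ_rV.
have mS : measurable (sum @^-1` A) by exact: measurable_preimage.
rewrite -[LHS]/(distribution P ZWm (sum @^-1` A)) -prodE//.
(* The law of z + sqrt 2 W for a fixed z, by the substitution y = z + sqrt 2 x. *)
have inner z : distribution P Wm (xsection (sum @^-1` A) z) =
    (\int[Leb]_y ((\1_A y)%:E * (heat v (y - z))%:E))%E.
  have mx : measurable (xsection (sum @^-1` A) z) by exact: measurable_xsection.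
  rewrite [LHS]Wg// integral_mkcond.
  have k0 : 0 < (Num.sqrt 2)^-1 :> R by rewrite invr_gt0 sqrtr_gt0.
  have sE x : x \in xsection (sum @^-1` A) z = (z + Num.sqrt 2 *: x \in A).
    by rewrite mem_xsection; apply/idP/idP; rewrite !inE.
  have mg : measurable_fun [set: 'rV[R]_d]
      (fun x : 'rV[R]_d => (\1_A (z + Num.sqrt 2 *: x))%:E * (gauss_density v x)%:E : \bar R)%E.
    apply: emeasurable_funM; apply/measurable_EFinP; last exact: measurable_gauss_density.
    apply: (measurableT_comp (measurable_indic mA)).
    by apply: measurable_funD_rV => //; exact: measurable_funZ_rV.
  transitivity (\int[Leb]_x ((\1_A (z + Num.sqrt 2 *: x))%:E * (gauss_density v x)%:E))%E.
    apply: eq_integral => x _; rewrite patchE sE indicE.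
    by case: ifPn => _; rewrite ?mul1e ?mul0e.
  rewrite -(ge0_integral_affine_rV z k0)//; last first.
    by move=> x; rewrite mule_ge0 ?lee_fin// gauss_density_ge0.
  rewrite -ge0_integralZl//.
  - apply: eq_integral => y _.
    rewrite scalerA divff ?lt0r_neq0 ?sqrtr_gt0// scale1r addrC subrK.
    by rewrite muleCA -EFinM heat_scale.
  - apply: (@measurableT_comp _ _ _ _ _ _ (fun x : 'rV[R]_d =>
      (\1_A (z + Num.sqrt 2 *: x))%:E * (gauss_density v x)%:E : \bar R)%E) => //.
    by apply: measurable_funZ_rV; exact: measurable_funB_rV.
  - by move=> x _; rewrite mule_ge0 ?lee_fin// gauss_density_ge0.
have mker dT (T : measurableType dT) (f : T -> 'rV[R]_d) : measurable_fun setT f ->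
    measurable_fun [set: T * 'rV[R]_d]
      (fun z => (\1_A z.2)%:E * (heat v (z.2 - f z.1))%:E : \bar R)%E.
  move=> mf; apply: emeasurable_funM; apply/measurable_EFinP.
    exact: (measurableT_comp (measurable_indic mA)).
  apply: (measurableT_comp (measurable_heat _)); apply: measurable_funB_rV => //.
  exact: measurableT_comp.
pose H z := (\int[Leb]_y ((\1_A y)%:E * (heat v (y - z))%:E))%E.
have mH : measurable_fun setT H.
  have g0 (z y : 'rV[R]_d) : (0 <= (\1_A y)%:E * (heat v (y - z))%:E)%E.
    by rewrite mule_ge0 ?lee_fin// heat_ge0.
  exact: (@measurable_integral_rV R d _ 'rV[R]_d
    (fun z y => (\1_A y)%:E * (heat v (y - z))%:E)%E (mker _ _ idfun (@measurable_id _ _ _)) g0).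
have H0 z : (0 <= H z)%E.
  by apply: integral_ge0 => y _; rewrite mule_ge0 ?lee_fin// heat_ge0.
rewrite /product_measure1.
transitivity (\int[distribution P Zm]_z H z)%E.
  by apply: eq_integral => z _; rewrite /= inner.
rewrite ge0_integral_pushforward//= -/Z.
pose F (z : Omega * 'rV[R]_d) := ((\1_A z.2)%:E * (heat v (z.2 - Z z.1))%:E)%E.
have F0 z : (0 <= F z)%E by rewrite mule_ge0 ?lee_fin// heat_ge0.
transitivity (\int[P]_w \int[Leb]_y F (w, y))%E; first by [].
rewrite (@fubini_tonelli _ _ _ _ R P Leb F (mker _ _ Z mZ) F0).
rewrite [RHS]integral_mkcond; apply: eq_integral => y _.
rewrite /fubini_G /F/= patchE indicE; case: ifPn => _.
  by apply: eq_integral => w _; rewrite mul1e.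
by rewrite integral0_eq// => w _; rewrite mul0e.
Qed.

End random_vectors.

Lemma holder_continuous_rV (R : realType) d (f : 'rV[R]_d -> R) (L a : R) :
  0 < a -> 0 <= L -> (forall y h, `|f (y + h) - f y| <= L * enorm h `^ a) ->
  continuous f.
Proof.
move=> a0 L0 H x; apply/(@cvgrPdist_lt _ _ _ _ (@nbhs_filter 'rV[R]_d x)) => e e0.
have L1 : 0 < L + 1 by rewrite ltr_wpDl.
pose r := (e / (L + 1)) `^ a^-1 / (d%:R + 1).
have d1 : 0 < d%:R + 1 :> R by rewrite ltr_wpDl.
have r0 : 0 < r by rewrite divr_gt0// powR_gt0// divr_gt0.
apply/(@nbhs_ballP _ 'rV[R]_d); exists r => //= y [_ xy].
have hn : enorm (y - x) <= (e / (L + 1)) `^ a^-1.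
  have /(enorm_le_bound (ltW r0)) : forall i, `|(y - x) 0 i| <= r.
    by move=> i; rewrite !mxE distrC ltW//; exact: xy.
  move=> /le_trans; apply; rewrite /r mulrA ler_pdivrMr// mulrC ler_wpM2l ?powR_ge0//.
  by rewrite lerDl.
have := H x (y - x); rewrite [x + (y - x)]addrC subrK distrC => /le_lt_trans; apply.
apply: (@le_lt_trans _ _ (L * (e / (L + 1)))).
  rewrite ler_wpM2l// (le_trans (ge0_ler_powR (ltW a0) _ _ hn)) ?nnegrE ?enorm_ge0 ?powR_ge0//.
  by rewrite -powRrM mulVf ?lt0r_neq0// powRr1// divr_ge0 ?ltW.
by rewrite mulrCA gtr_pMr// ltr_pdivrMr// mul1r ltrDl.
Qed.

(** The kernel estimates are packaged as predicates on their constant, so that it can be fixed from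
    the dimension and C before any process is introduced. *)
Definition heat_holder_bound (R : realType) (d : nat) (K : R) : Prop :=
  forall (u : R) (z h : 'rV[R]_d) (g : R), 0 < u -> 0 <= g <= 1 ->
  `|heat u (z + h) - heat u z| <=
  K * (enorm h / Num.sqrt u) `^ g * (heat (2 * u) (z + h) + heat (2 * u) z).

Definition heat_shift_bound (R : realType) (d : nat) (C K : R) : Prop :=
  forall (u : R) (z b : 'rV[R]_d), 0 < u -> enorm b / Num.sqrt u <= C ->
  `|heat u (z + b) - heat u z| <= K * (enorm b / Num.sqrt u) * heat (2 * u) z /\
  forall (h : 'rV[R]_d) (g : R), 0 <= g <= 1 ->
    `|heat u (z + h + b) - heat u (z + h) - (heat u (z + b) - heat u z)| <=
    K * (enorm b / Num.sqrt u * (enorm h / Num.sqrt u) `^ g) *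
    (heat (2 * u) (z + h) + heat (2 * u) z).

Lemma heat_shift_bound_exists (R : realType) (d : nat) (C : R) : 1 <= C ->
  exists2 K, 0 < K & @heat_shift_bound R d C K.
Proof.
move=> C1; have [K1 K10 H1] := @heat_diff R d C C1.
have [K2 K20 H2] := @heat_diff2 R d C C1.
exists (K1 + K2); first exact: addr_gt0.
move=> u z b u0 bC.
have b0 : 0 <= enorm b / Num.sqrt u by rewrite divr_ge0 ?enorm_ge0 ?sqrtr_ge0.
split=> [|h g g01].
  apply: (le_trans (H1 _ z _ u0 bC)); apply: ler_wpM2r; first exact: heat_ge0.
  by apply: ler_wpM2r => //; rewrite lerDl ltW.
apply: (le_trans (H2 _ z h _ _ u0 bC g01)); apply: ler_wpM2r.
  by rewrite addr_ge0 ?heat_ge0.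
apply: ler_wpM2r; last by rewrite lerDr ltW.
by rewrite mulr_ge0 ?powR_ge0.
Qed.

(** * Convolution of a law with the heat kernel *)

Section smoothing.
Context (R : realType) (d : nat) dO (Omega : measurableType dO)
  (P : probability Omega R).
Local Notation Leb := (lebesgue_rV R d).
Implicit Types (X Z W b : Omega -> 'rV[R]_d) (y h : 'rV[R]_d) (u v : R).

(** Boundedness implies integrability under P, so the real-valued integral is linear and monotone on
    these functions; kernels of positive age evaluated at random points are of this kind. *)
Definition bounded_rv (f : Omega -> R) : Prop :=
  measurable_fun setT f /\ exists M, forall w, `|f w| <= M.

Lemma bounded_rvD f g : bounded_rv f -> bounded_rv g ->
  bounded_rv (fun w => f w + g w).
Proof.
move=> [mf [M fM]] [mg [N gN]]; split; first exact: measurable_funD.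
by exists (M + N) => w; rewrite (le_trans (ler_normD _ _))// lerD.
Qed.

Lemma bounded_rvZ (c : R) f : bounded_rv f -> bounded_rv (fun w => c * f w).
Proof.
move=> [mf [M fM]]; split; first exact: measurable_funM.
by exists (`|c| * M) => w; rewrite normrM ler_wpM2l.
Qed.

Lemma bounded_rvB f g : bounded_rv f -> bounded_rv g ->
  bounded_rv (fun w => f w - g w).
Proof.
move=> [mf [M fM]] [mg [N gN]]; split; first exact: measurable_funB.
by exists (M + N) => w; rewrite (le_trans (ler_normB _ _))// lerD.
Qed.

Lemma bounded_rv_integrable f : bounded_rv f -> P.-integrable setT (EFin \o f).
Proof.
move=> [mf [M fM]]; apply: measurable_bounded_integrable => //.
  by apply: (@le_lt_trans _ _ 1%E); rewrite ?ltry// probability_le1.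
exists M; split; first exact: num_real.
by move=> x Mx w _ /=; rewrite (le_trans (fM w))// ltW.
Qed.

Lemma bounded_RintegralB f g : bounded_rv f -> bounded_rv g ->
  \int[P]_w f w - \int[P]_w g w = \int[P]_w (f w - g w).
Proof. by move=> bf bg; rewrite RintegralB//; exact: bounded_rv_integrable. Qed.

Lemma bounded_RintegralD f g : bounded_rv f -> bounded_rv g ->
  \int[P]_w f w + \int[P]_w g w = \int[P]_w (f w + g w).
Proof. by move=> bf bg; rewrite RintegralD//; exact: bounded_rv_integrable. Qed.

Lemma bounded_RintegralZ c f : bounded_rv f ->
  c * \int[P]_w f w = \int[P]_w (c * f w).
Proof. by move=> bf; rewrite RintegralZl//; exact: bounded_rv_integrable. Qed.

Lemma le_abs_Rintegral f g : bounded_rv f -> bounded_rv g ->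
  (forall w, `|f w| <= g w) -> `|\int[P]_w f w| <= \int[P]_w g w.
Proof.
move=> bf bg fg; rewrite ler_norml -mulN1r bounded_RintegralZ//; apply/andP; split.
  apply: le_Rintegral => //; try exact: bounded_rv_integrable.
    by apply: bounded_rv_integrable; exact: bounded_rvZ.
  by move=> w _; rewrite mulN1r; have := fg w; rewrite ler_norml => /andP[].
apply: le_Rintegral => //; try exact: bounded_rv_integrable.
by move=> w _; rewrite (le_trans (ler_norm _)).
Qed.

(** The heat kernel convolved with the law of Z. It is written through Z and not through a density,
    so that Z and its displacement Z + b are treated alike and compared for each w. *)
Definition smooth u Z y : R := \int[P]_w heat u (y - Z w).

Lemma measurable_heat_sub u Z y : measurable_fun setT Z ->
  measurable_fun setT (fun w => heat u (y - Z w)).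
Proof.
move=> mZ; apply: (measurableT_comp (measurable_heat _)).
exact: measurable_funB_rV.
Qed.

Lemma bounded_heat_sub u Z y : 0 < u -> measurable_fun setT Z ->
  bounded_rv (fun w => heat u (y - Z w)).
Proof.
move=> u0 mZ; split; first exact: measurable_heat_sub.
by exists (@heat_peak R d u) => w; rewrite ger0_norm ?heat_ge0// heat_le_peak.
Qed.

Lemma smooth_ge0 u Z y : 0 <= smooth u Z y.
Proof. by apply: Rintegral_ge0 => w _; exact: heat_ge0. Qed.

Lemma smoothB u Z Z' y y' : 0 < u -> measurable_fun setT Z -> measurable_fun setT Z' ->
  smooth u Z y - smooth u Z' y' = \int[P]_w (heat u (y - Z w) - heat u (y' - Z' w)).
Proof. by move=> u0 mZ mZ'; apply: bounded_RintegralB; exact: bounded_heat_sub. Qed.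

Lemma smoothDZ c u Z y y' : 0 < u -> measurable_fun setT Z ->
  c * (smooth u Z y + smooth u Z y') =
  \int[P]_w (c * (heat u (y - Z w) + heat u (y' - Z w))).
Proof.
move=> u0 mZ; rewrite -bounded_RintegralZ; last first.
  by apply: bounded_rvD; exact: bounded_heat_sub.
by congr (_ * _); apply: bounded_RintegralD; exact: bounded_heat_sub.
Qed.

Lemma EFin_smooth u Z y : 0 < u -> measurable_fun setT Z ->
  (smooth u Z y)%:E = (\int[P]_w (heat u (y - Z w))%:E)%E.
Proof.
move=> u0 mZ; rewrite /smooth /Rintegral fineK//.
apply: integrable_fin_num => //.
by apply: bounded_rv_integrable; exact: bounded_heat_sub.
Qed.

Lemma smooth_holder K u Z y h g : @heat_holder_bound R d K -> 0 < u ->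
  0 <= g <= 1 -> measurable_fun setT Z ->
  `|smooth u Z (y + h) - smooth u Z y| <=
  K * (enorm h / Num.sqrt u) `^ g * (smooth (2 * u) Z (y + h) + smooth (2 * u) Z y).
Proof.
move=> H u0 g01 mZ.
have u20 : 0 < 2 * u by rewrite mulr_gt0.
have B1 x : bounded_rv (fun w => heat u (x - Z w)) by exact: bounded_heat_sub.
have B2 x : bounded_rv (fun w => heat (2 * u) (x - Z w)) by exact: bounded_heat_sub.
rewrite [X in `|X|](smoothB _ _ u0 mZ mZ) [leRHS](smoothDZ _ _ _ u20 mZ).
apply: le_abs_Rintegral; [exact: bounded_rvB|apply: bounded_rvZ; exact: bounded_rvD|].
by move=> w; have := H u (y - Z w) h g u0 g01; rewrite addrAC.
Qed.

(** The kernel estimate is applied for each w to the shift [- b w] and then integrated, so b may be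
    built from the same randomness as Z, as the drift is. *)
Lemma smooth_shift C K u Z b c : @heat_shift_bound R d C K -> 0 <= K ->
  0 < u -> measurable_fun setT Z -> measurable_fun setT b ->
  (forall w, enorm (b w) <= c) -> c / Num.sqrt u <= C ->
  (forall y, `|smooth u (fun w => Z w + b w) y - smooth u Z y| <=
    K * (c / Num.sqrt u) * smooth (2 * u) Z y) /\
  (forall y h g, 0 <= g <= 1 ->
    `|smooth u (fun w => Z w + b w) (y + h) - smooth u Z (y + h)
      - (smooth u (fun w => Z w + b w) y - smooth u Z y)| <=
    K * (c / Num.sqrt u * (enorm h / Num.sqrt u) `^ g) *
    (smooth (2 * u) Z (y + h) + smooth (2 * u) Z y)).
Proof.
move=> H K0 u0 mZ mb bc cC.
have u20 : 0 < 2 * u by rewrite mulr_gt0.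
have s0 : 0 < Num.sqrt u by rewrite sqrtr_gt0.
have mZb : measurable_fun setT (fun w => Z w + b w) by exact: measurable_funD_rV.
have B1 x : bounded_rv (fun w => heat u (x - Z w)) by exact: bounded_heat_sub.
have B2 x : bounded_rv (fun w => heat (2 * u) (x - Z w)) by exact: bounded_heat_sub.
have B3 x : bounded_rv (fun w => heat u (x - (Z w + b w))) by exact: bounded_heat_sub.
have bc' w : enorm (- b w) / Num.sqrt u <= c / Num.sqrt u.
  by rewrite enormN ler_wpM2r// invr_ge0 ltW.
have bC w : enorm (- b w) / Num.sqrt u <= C by exact: le_trans (bc' w) cC.
split=> [y|y h g g01].
  rewrite [X in `|X|](smoothB _ _ u0 mZb mZ) [leRHS](bounded_RintegralZ _ (B2 y)).
  apply: le_abs_Rintegral; [exact: bounded_rvB|exact: bounded_rvZ|].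
  move=> w; have [+ _] := H u (y - Z w) (- b w) u0 (bC w).
  rewrite opprD addrA => /le_trans; apply; apply: ler_wpM2r; first exact: heat_ge0.
  exact: ler_wpM2l.
rewrite [leRHS](smoothDZ _ _ _ u20 mZ).
rewrite [X in `|X - _|](smoothB _ _ u0 mZb mZ) [X in `|_ - X|](smoothB _ _ u0 mZb mZ).
rewrite [X in `|X|](bounded_RintegralB (bounded_rvB (B3 _) (B1 _)) (bounded_rvB (B3 _) (B1 _))).
apply: le_abs_Rintegral.
- by apply: bounded_rvB; exact: bounded_rvB.
- by apply: bounded_rvZ; exact: bounded_rvD.
move=> w; have [_ /(_ h g g01)] := H u (y - Z w) (- b w) u0 (bC w).
rewrite !opprD !addrA [y - Z w + h]addrAC => /le_trans; apply.
apply: ler_wpM2r; first by rewrite addr_ge0 ?heat_ge0.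
by apply: ler_wpM2l => //; rewrite ler_wpM2r ?powR_ge0.
Qed.

(** Exponent 1 in [heat_holder] gives a Lipschitz bound, since the convolutions of age 2 u on the
    right are at most the peak of the kernel. *)
Lemma continuous_smooth u Z : 0 < u -> measurable_fun setT Z ->
  continuous (smooth u Z).
Proof.
move=> u0 mZ; have [K K0 H] := @heat_holder R d.
have u20 : 0 < 2 * u by rewrite mulr_gt0.
have s0 : 0 < Num.sqrt u by rewrite sqrtr_gt0.
have ub y : smooth (2 * u) Z y <= @heat_peak R d (2 * u).
  have := @le_abs_Rintegral (fun w => heat (2 * u) (y - Z w)) (fun=> @heat_peak R d (2 * u)).
  move=> /(_ (bounded_heat_sub y u20 mZ)); rewrite Rintegral_cst//.
  rewrite [X in fine X](_ : _ = 1%E) ?mulr1; last exact: probability_setT.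
  move=> h; apply: (le_trans (ler_norm _)); apply: h.
    by split => //; exists `|@heat_peak R d (2 * u)| => w.
  by move=> w; rewrite ger0_norm ?heat_ge0// heat_le_peak.
apply: (@holder_continuous_rV _ _ _
  (K / Num.sqrt u * (@heat_peak R d (2 * u) + @heat_peak R d (2 * u))) 1) => //.
  by rewrite mulr_ge0 ?addr_ge0 ?ltW ?heat_peak_gt0// divr_gt0.
move=> y h; have g01 : 0 <= (1 : R) <= 1 by rewrite ler01 lexx.
apply: (le_trans (smooth_holder y h H u0 g01 mZ)).
have e0 : 0 <= enorm h / Num.sqrt u by rewrite divr_ge0 ?enorm_ge0// ltW.
rewrite (powRr1 e0) (powRr1 (enorm_ge0 h)).
rewrite [leRHS](_ : _ = K * (enorm h / Num.sqrt u) *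
    (@heat_peak R d (2 * u) + @heat_peak R d (2 * u))); last first.
  by move: (_ + _) (_^-1) => q c; ring.
by apply: ler_wpM2l; [exact: mulr_ge0 (ltW K0) e0|exact: lerD].
Qed.

Lemma smooth_density v Z W : 0 < v -> measurable_fun setT Z -> measurable_fun setT W ->
  (forall A, measurable A ->
    P (W @^-1` A) = (\int[Leb]_(x in A) (gauss_density v x)%:E)%E) ->
  (forall A1 A2, measurable A1 -> measurable A2 ->
    P (Z @^-1` A1 `&` W @^-1` A2) = (P (Z @^-1` A1) * P (W @^-1` A2))%E) ->
  rv_density P (fun w => Z w + Num.sqrt 2 *: W w) (smooth v Z).
Proof.
move=> v0 mZ mW Wg indep; split.
- by apply: measurable_funD_rV => //; exact: measurable_funZ_rV.
- by apply: continuous_measurable_rV; exact: continuous_smooth.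
- exact: smooth_ge0.
- move=> A mA; rewrite (law_gauss_sum v0 mZ mW Wg indep mA).
  by apply: eq_integral => y _; rewrite EFin_smooth.
Qed.

Lemma rv_density_unique X f g : rv_density P X f -> rv_density P X g ->
  continuous f -> continuous g -> f = g.
Proof.
move=> [_ _ f0 Xf] [_ _ g0 Xg] cf cg; apply: continuous_density_unique => // A mA.
by rewrite -Xf// -Xg.
Qed.

(** After a reflection the convolution is a Gaussian average of translates of f. In this form it
    inherits bounds and moduli of continuity from f. *)
Lemma EFin_smooth_density u X f y : 0 < u -> rv_density P X f ->
  ((smooth u X y)%:E = \int[Leb]_x (heat u x * f (y - x))%:E)%E.
Proof.
move=> u0 Xf; have [mX mf f0 _] := Xf; rewrite EFin_smooth//.
have mh : measurable_fun setT (fun x : 'rV[R]_d => y - x).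
  by apply: measurable_funB_rV.
rewrite (integral_rv_density (k := fun x => heat u (y - x)) Xf).
- rewrite -[LHS](@ge0_integral_reflect_rV R d y (fun x => (heat u (y - x) * f x)%:E)).
  + by apply: eq_integral => x _; rewrite opprB addrC subrK.
  + apply/measurable_EFinP; apply: measurable_funM => //.
    by apply: (measurableT_comp (measurable_heat _)).
  + by move=> x; rewrite lee_fin mulr_ge0// heat_ge0.
- by apply: (measurableT_comp (measurable_heat _)).
- by move=> x; exact: heat_ge0.
Qed.

Lemma smooth_le u X f M y : 0 < u -> rv_density P X f -> (forall x, f x <= M) ->
  smooth u X y <= M.
Proof.
move=> u0 Xf fM; have [mX mf f0 _] := Xf.
rewrite -lee_fin (EFin_smooth_density y u0 Xf).
rewrite -[M%:E]mule1 -(integral_heat d u) -ge0_integralZl//.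
- apply: ge0_le_integral => //.
  + by move=> x _; rewrite lee_fin mulr_ge0// heat_ge0.
  + apply/measurable_EFinP; apply: measurable_funM; first exact: measurable_heat.
    by apply: measurableT_comp => //; exact: measurable_funB_rV.
  + apply/measurable_EFinP; apply: measurable_funM => //; exact: measurable_heat.
  + by move=> x _; rewrite -EFinM lee_fin mulrC ler_wpM2r ?heat_ge0.
- by apply/measurable_EFinP; exact: measurable_heat.
- by move=> x _; rewrite lee_fin heat_ge0.
- by rewrite lee_fin (le_trans (f0 0) (fM 0)).
Qed.

End smoothing.

(** * Uniform estimates *)

Lemma measurable_smooth (R : realType) (d : nat) dO (Omega : measurableType dO)
    (P : probability Omega R) (u : R) (Z : Omega -> 'rV[R]_d) :
  measurable_fun setT Z -> measurable_fun setT (smooth P u Z).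
Proof.
move=> mZ; rewrite /smooth /Rintegral.
apply: measurableT_comp; first exact: fine_measurable.
pose f (z : Omega * 'rV[R]_d) := (heat u (z.2 - Z z.1))%:E.
have mf : measurable_fun setT f.
  apply/measurable_EFinP; apply: (measurableT_comp (measurable_heat _)).
  by apply: measurable_funB_rV => //; exact: measurableT_comp.
have f0 z : (0 <= f z)%E by rewrite lee_fin heat_ge0.
exact: (@measurable_fun_fubini_tonelli_G _ _ _ _ R P f mf f0).
Qed.

Opaque smooth.

(** * Riemann sums of integrable singularities *)

Section singular_sums.
Context (R : realType).
Implicit Types (x a b u v : R).

(** Young's inequality for the product of (1 - x)^b and 1, with conjugate exponents 1 / b and 1 / (1
    - b). *)
Lemma powR_bernoulli x b : 0 <= x <= 1 -> 0 < b <= 1 ->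
  (1 - x) `^ b <= 1 - b * x.
Proof.
move=> /andP[x0 x1] /andP[b0]; rewrite le_eqVlt => /predU1P[->|b1].
  by rewrite powRr1 ?subr_ge0// mul1r.
have := @conjugate_powR R ((1 - x) `^ b) 1 b^-1 (1 - b)^-1.
rewrite !invrK mulr1 powR1/= -powRrM mulfV ?lt0r_neq0// powRr1 ?subr_ge0//.
move=> /(_ (powR_ge0 _ _) ler01); rewrite !invr_gt0 subr_gt0 => /(_ b0 b1).
by rewrite addrC subrK => /(_ erefl); lra.
Qed.

(** The right-hand side is the integral of r^(-a) over [v, u], where the integrand is at least
    u^(-a). Bernoulli's inequality takes the place of the integral. *)
Lemma powR_increment a u v : 0 <= a < 1 -> 0 <= v <= u ->
  (u - v) * u `^ (- a) <= (u `^ (1 - a) - v `^ (1 - a)) / (1 - a).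
Proof.
move=> /andP[a0 a1] /andP[v0 vu]; have a1' : 0 < 1 - a by rewrite subr_gt0.
have [u0|u0] := leP u 0.
  have -> : u = 0 by lra.
  have -> : v = 0 by lra.
  by rewrite !subrr mul0r mul0r.
rewrite ler_pdivlMr// lerBrDl.
have h : (1 - (u - v) / u) `^ (1 - a) <= 1 - (1 - a) * ((u - v) / u).
  apply: powR_bernoulli; last by rewrite a1' gerBl.
  rewrite divr_ge0 ?subr_ge0 ?(ltW u0)//= ler_pdivrMr// mul1r; lra.
have uv : u * (1 - (u - v) / u) = v by field; exact: lt0r_neq0.
have -> : v `^ (1 - a) = u `^ (1 - a) * (1 - (u - v) / u) `^ (1 - a).
  rewrite -powRM ?(ltW u0)// ?uv// subr_ge0 ler_pdivrMr// mul1r; lra.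
have E : u `^ (- a) = u `^ (1 - a) / u.
  by rewrite powRB ?lt0r_neq0 ?implybT// powRr1 ?ltW// mulrAC divff ?lt0r_neq0// mul1r powRN.
apply: (le_trans (lerD (ler_wpM2l (powR_ge0 _ _) h) (lexx _))).
rewrite E; move: (u `^ (1 - a)) => q.
rewrite le_eqVlt; apply/orP; left; apply/eqP; field; exact: lt0r_neq0.
Qed.

Lemma sqrt_powR u g : 0 < u ->
  (Num.sqrt u)^-1 * (Num.sqrt u)^-1 `^ g = u `^ (- ((1 + g) / 2)).
Proof.
move=> u0; have s0 : 0 < Num.sqrt u by rewrite sqrtr_gt0.
have -> : (Num.sqrt u)^-1 = u `^ (- 2^-1).
  by rewrite powRN powR12_sqrt// ltW.
rewrite -powRrM -powRD; last by rewrite lt0r_neq0// implybT.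
by congr (_ `^ _); lra.
Qed.

Lemma telescope_sumr_ord (V : zmodType) (f : nat -> V) n :
  \sum_(j < n) (f j - f j.+1) = f 0%N - f n.
Proof.
rewrite -(big_mkord xpredT (fun j => f j - f j.+1)) -opprB -telescope_sumr// -sumrN.
by apply: eq_bigr => i _; rewrite opprB.
Qed.

(** Each term is the length of an interval times the value of r^(-(1+g)/2) at its larger end. The
    corresponding integrals telescope, and g < 1 makes the exponent integrable at 0. *)
Lemma singular_sum (u : nat -> R) n g : 0 <= g < 1 ->
  (forall j, (j < n)%N -> u j.+1 <= u j) -> 0 <= u n ->
  \sum_(j < n) (u j - u j.+1) / Num.sqrt (u j) * (Num.sqrt (u j))^-1 `^ g <=
  2 / (1 - g) * u 0 `^ ((1 - g) / 2).
Proof.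
move=> /andP[g0 g1] um un.
have u_ge0 j : (j <= n)%N -> 0 <= u j.
  move=> jn; rewrite -(subKn jn); move: (n - j)%N (leq_subr j n) => i.
  elim: i => [|i ih] in_; first by rewrite subn0.
  have lt : (n - i.+1 < n)%N by rewrite ltn_subrL/= (leq_trans _ in_).
  by rewrite (le_trans (ih (ltnW in_)))// -subnSK// um.
pose a := (1 + g) / 2.
have a1 : 0 <= a < 1 by rewrite /a; apply/andP; split; lra.
apply: (@le_trans _ _ (\sum_(j < n) (u j `^ (1 - a) - u j.+1 `^ (1 - a)) / (1 - a))).
  apply: ler_sum => j _.
  have uj := u_ge0 _ (ltnW (ltn_ord j)); have uj1 := u_ge0 _ (ltn_ord j).
  have [u0|u0] := leP (u j) 0.
    have -> : u j = 0 by apply/eqP; rewrite eq_le u0 uj.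
    have -> : u j.+1 = 0.
      by apply/eqP; rewrite eq_le uj1 andbT (le_trans (um _ (ltn_ord j))).
    by rewrite !subrr !mul0r.
  rewrite -mulrA sqrt_powR//; apply: powR_increment => //.
  by rewrite uj1 um.
rewrite -mulr_suml (telescope_sumr_ord (fun j => u j `^ (1 - a))).
have -> : 1 - a = (1 - g) / 2 by rewrite /a; lra.
rewrite invf_div mulrC ler_wpM2l//; first by rewrite divr_ge0//; lra.
by rewrite gerBl powR_ge0.
Qed.

(** For x = lam u the decay of an exponential weight is traded for a small factor lam^(-1/4) and a
    singularity u^(-1/4), which is still integrable next to u^(-1/2). *)
Lemma expRN_le_powR x : 0 < x -> expR (- x) <= x `^ (- 4^-1).
Proof.
move=> x0; rewrite expRN powRN lef_pV2 ?posrE ?expR_gt0 ?powR_gt0//.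
have [x1|x1] := leP x 1.
  apply: (@le_trans _ _ 1); last by rewrite -expR0 ler_expR ltW.
  have := @ge0_ler_powR R 4^-1; rewrite invr_ge0// => /(_ (ler0n _ _) x 1).
  by rewrite powR1; apply; rewrite ?nnegrE// ltW.
by apply: le_trans (le_expR x); apply: ler1_powR; [exact: ltW|lra].
Qed.

End singular_sums.

(** Applied to the whole grid this gives a partition of [s, t] with the original indices j < n;
    cells outside the interval degenerate to points. *)
Definition clamp (R : realType) (s t x : R) : R := Num.max s (Num.min x t).

(** * Gaussian averages and the regularity of smoothed densities *)

Section heat_averages.
Context (R : realType) (d : nat).
Local Notation Leb := (lebesgue_rV R d).
Implicit Types (f k : 'rV[R]_d -> R) (u : R).

Lemma measurable_heat_mul u f : measurable_fun setT f ->
  measurable_fun setT (fun x => (heat u x * f x)%:E).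
Proof.
move=> mf; apply/measurable_EFinP; apply: measurable_funM => //.
exact: measurable_heat.
Qed.

Lemma integral_heat_cst u (c : R) : 0 <= c ->
  (\int[Leb]_x (heat u x * c)%:E = c%:E)%E.
Proof.
move=> c0; under eq_integral do rewrite EFinM.
rewrite ge0_integralZr//; first by rewrite integral_heat mul1e.
- by apply/measurable_EFinP; exact: measurable_heat.
- by move=> x _; rewrite lee_fin heat_ge0.
Qed.

Lemma integral_heat_moment u (q : R) : 0 <= q -> 0 < u ->
  (\int[Leb]_x (heat u x * enorm x `^ q)%:E <=
   (Num.sqrt 2 ^+ d * expR (2 * q ^+ 2) * Num.sqrt u `^ q)%:E)%E.
Proof.
move=> q0 u0; set c := (X in (_ <= X%:E)%E).
have c0 : 0 <= c.
  by rewrite !mulr_ge0 ?exprn_ge0 ?sqrtr_ge0 ?expR_ge0 ?powR_ge0.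
rewrite -[leRHS](@integral_heat_cst (2 * u))//; apply: ge0_le_integral => //.
- by move=> x _; rewrite lee_fin mulr_ge0 ?heat_ge0 ?powR_ge0.
- apply: measurable_heat_mul; apply: (measurableT_comp (measurable_powR q)).
  exact: measurable_enorm.
- by apply: measurable_heat_mul.
- by move=> x _; rewrite lee_fin [leLHS]mulrC [leRHS]mulrC heat_moment.
Qed.

(** The comparison is additive, so that no integrals that may be infinite are subtracted. *)
Lemma le_heat_average u f1 f2 k (c : \bar R) : measurable_fun setT f1 ->
  measurable_fun setT f2 -> measurable_fun setT k ->
  (forall x, 0 <= f1 x) -> (forall x, 0 <= f2 x) -> (forall x, 0 <= k x) ->
  (forall x, f1 x <= f2 x + k x) ->
  (\int[Leb]_x (heat u x * k x)%:E <= c)%E ->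
  (\int[Leb]_x (heat u x * f1 x)%:E <=
   \int[Leb]_x (heat u x * f2 x)%:E + c)%E.
Proof.
move=> mf1 mf2 mk f10 f20 k0 H kc.
apply: (@le_trans _ _ (\int[Leb]_x ((heat u x * f2 x)%:E + (heat u x * k x)%:E))%E).
  apply: ge0_le_integral => //.
  - by move=> x _; rewrite lee_fin mulr_ge0 ?heat_ge0.
  - exact: measurable_heat_mul.
  - by apply: emeasurable_funD; exact: measurable_heat_mul.
  - by move=> x _; rewrite -EFinD lee_fin -mulrDr ler_wpM2l ?heat_ge0.
rewrite ge0_integralD//; first exact: leeD2l.
- by move=> x _; rewrite lee_fin mulr_ge0 ?heat_ge0.
- exact: measurable_heat_mul.
- by move=> x _; rewrite lee_fin mulr_ge0 ?heat_ge0.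
- exact: measurable_heat_mul.
Qed.

End heat_averages.

Section smooth_regularity.
Context (R : realType) (d : nat) dO (Omega : measurableType dO)
  (P : probability Omega R).
Local Notation Leb := (lebesgue_rV R d).
Variables (X : Omega -> 'rV[R]_d) (f : 'rV[R]_d -> R) (Xf : rv_density P X f).
Variables (L a : R) (L0 : 0 <= L) (a0 : 0 <= a).
Hypothesis fL : forall y h, `|f (y + h) - f y| <= L * enorm h `^ a.

Let mf : measurable_fun setT f. Proof. by case: Xf. Qed.
Let f0 x : 0 <= f x. Proof. by case: Xf. Qed.
Let mfs (y : 'rV[R]_d) : measurable_fun [set: 'rV[R]_d] (fun x => f (y - x)).
Proof. by apply: (measurableT_comp mf); exact: measurable_funB_rV. Qed.

Lemma smooth_holder_density u y h : 0 < u ->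
  `|smooth P u X (y + h) - smooth P u X y| <= L * enorm h `^ a.
Proof.
move=> u0.
suff S z z' : smooth P u X z <= smooth P u X z' + L * enorm (z - z') `^ a.
  rewrite ler_distl; have := S (y + h) y; have := S y (y + h).
  have -> : y - (y + h) = - h by rewrite opprD addrA subrr add0r.
  have -> : y + h - y = h by rewrite addrAC subrr add0r.
  by rewrite (enormN h) => h1 h2; apply/andP; split; [rewrite lerBlDr; exact: h1|exact: h2].
have c0 : 0 <= L * enorm (z - z') `^ a by rewrite mulr_ge0 ?powR_ge0.
rewrite -lee_fin EFinD [leLHS](EFin_smooth_density z u0 Xf).
rewrite [X in (_ <= X + _)%E](EFin_smooth_density z' u0 Xf).
apply: (@le_heat_average _ _ _ _ _ (fun=> L * enorm (z - z') `^ a)) => //.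
  move=> x; have := fL (z' - x) (z - z').
  have -> : z' - x + (z - z') = z - x by rewrite addrC addrA subrK.
  by rewrite ler_distl => /andP[_]; rewrite addrC.
by rewrite integral_heat_cst.
Qed.

(** The modulus L |x|^a is averaged against the kernel, whose moment of order a is of order (sqrt
    u)^a. *)
Lemma smooth_approx u y : 0 < u ->
  `|smooth P u X y - f y| <=
  L * (Num.sqrt 2 ^+ d * expR (2 * a ^+ 2)) * Num.sqrt u `^ a.
Proof.
move=> u0; set c := (X in _ <= X).
have mk : measurable_fun setT (fun x : 'rV[R]_d => L * enorm x `^ a).
  apply: measurable_funM => //; apply: (measurableT_comp (measurable_powR a)).
  exact: measurable_enorm.
have kc : (\int[Leb]_x (heat u x * (L * enorm x `^ a))%:E <= c%:E)%E.
  under eq_integral do rewrite mulrCA EFinM.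
  rewrite ge0_integralZl//.
  - rewrite /c -mulrA EFinM; apply: lee_wpmul2l => //.
    exact: integral_heat_moment.
  - apply: measurable_heat_mul; apply: (measurableT_comp (measurable_powR a)).
    exact: measurable_enorm.
  - by move=> x _; rewrite lee_fin mulr_ge0 ?heat_ge0 ?powR_ge0.
have k0 (x : 'rV[R]_d) : 0 <= L * enorm x `^ a by rewrite mulr_ge0 ?powR_ge0.
rewrite ler_distl lerBlDr -!lee_fin !EFinD (EFin_smooth_density _ u0 Xf).
rewrite -[(f y)%:E](@integral_heat_cst R d u)//.
have fx x : `|f (y - x) - f y| <= L * enorm x `^ a by rewrite -(enormN x).
apply/andP; split; apply: (@le_heat_average _ _ _ _ _ (fun x => L * enorm x `^ a)) => //.
  by move=> x; have := fx x; rewrite ler_distl => /andP[]; lra.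
by move=> x; have := fx x; rewrite ler_distl => /andP[]; lra.
Qed.

End smooth_regularity.

(** The kernel age u_j, measured from the left end of the j-th clamped cell. Consecutive gaps differ
    by the length of the cell. *)
Definition gap (R : realType) (g : nat -> R) (s t : R) (j : nat) : R :=
  t - clamp s t (g j).

(* All that the estimates use of the Euler scheme: its discrete Duhamel formula,
   where D j is the effect of the drift on the j-th cell, as seen at time t. *)
Record euler_system (R : realType) (d : nat) dO (Omega : measurableType dO)
    (P : probability Omega R) (T K : R) (n : nat) (g : nat -> R)
    (X : R -> Omega -> 'rV[R]_d) (ell : R -> 'rV[R]_d -> R) : Prop := EulerSystem {
  es_grid0 : g 0%N = 0 ;
  es_gridn : g n = T ;
  es_grid : forall j, (j < n)%N -> g j <= g j.+1 ;
  es_density : forall t, 0 <= t <= T -> rv_density P (X t) (ell t) ;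
  es_continuous : forall t, 0 <= t <= T -> continuous (ell t) ;
  es_duhamel : forall s t, 0 <= s -> s < t -> t <= T ->
    exists D : nat -> 'rV[R]_d -> R,
    [/\ forall y, ell t y = smooth P (t - s) (X s) y + \sum_(j < n) D j y,
        forall j, (j < n)%N -> forall y, `|D j y| <=
          K * ((gap g s t j - gap g s t j.+1) / Num.sqrt (gap g s t j)) *
          smooth P (2 * gap g s t j) (X (clamp s t (g j))) y &
        forall j, (j < n)%N -> forall y h a, 0 <= a <= 1 ->
          `|D j (y + h) - D j y| <=
          K * ((gap g s t j - gap g s t j.+1) / Num.sqrt (gap g s t j) *
               (enorm h / Num.sqrt (gap g s t j)) `^ a) *
          (smooth P (2 * gap g s t j) (X (clamp s t (g j))) (y + h) +
           smooth P (2 * gap g s t j) (X (clamp s t (g j))) y)] }.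

(** * The supremum of the density *)

Section density_estimates.
Context (R : realType) (d : nat) dO (Omega : measurableType dO)
  (P : probability Omega R) (T K : R) (n : nat) (g : nat -> R)
  (X : R -> Omega -> 'rV[R]_d) (ell : R -> 'rV[R]_d -> R).
Hypothesis T0 : 0 < T.
Hypothesis K0 : 0 < K.
Hypothesis E : euler_system P T K n g X ell.
Implicit Types (s t a x : R) (y h : 'rV[R]_d).

Lemma grid_le i j : (i <= j)%N -> (j <= n)%N -> g i <= g j.
Proof.
move=> /subnK <-; elim: (j - i)%N => [//|k ih] kn.
by rewrite addSn (le_trans (ih (ltnW kn)))// (es_grid E).
Qed.

Lemma clamp_bounds s t x : s <= t -> s <= clamp s t x <= t.
Proof. by move=> st; rewrite /clamp le_max lexx/= ge_max st ge_min lexx orbT. Qed.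

Lemma gap_ge0 s t j : s <= t -> 0 <= gap g s t j.
Proof. by move=> /(clamp_bounds (g j))/andP[_]; rewrite /gap subr_ge0. Qed.

Lemma gap_noninc s t j : (j < n)%N -> gap g s t j.+1 <= gap g s t j.
Proof.
by move=> jn; rewrite lerD2l lerN2 le_max2// le_min2// (es_grid E).
Qed.

Lemma gap0 s t : 0 <= s -> s <= t -> gap g s t 0 = t - s.
Proof.
move=> s0 st; rewrite /gap /clamp (es_grid0 E); congr (_ - _).
by apply/max_idPl; rewrite ge_min s0.
Qed.

Lemma gap_sum s t a : 0 <= s -> s <= t -> 0 <= a < 1 ->
  \sum_(j < n) (gap g s t j - gap g s t j.+1) / Num.sqrt (gap g s t j) *
    (Num.sqrt (gap g s t j))^-1 `^ a <= 2 / (1 - a) * (t - s) `^ ((1 - a) / 2).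
Proof.
move=> s0 st a01; rewrite -(gap0 s0 st); apply: (singular_sum a01).
  by move=> j jn; exact: gap_noninc.
exact: gap_ge0.
Qed.

(* This rate makes the sum of the singular coefficients, weighted by the
   exponentials of the induction hypothesis, at most one half. *)
Definition sup_rate : R := (8 * K * T `^ 4^-1) ^+ 4.

(** Gronwall's argument as an induction on the number of cells reached. The factor 2 leaves A for
    the smoothed initial density and A exp (sup_rate t) for the drift sum. *)
Lemma density_sup_exp (A : R) : 0 <= A -> (forall z, ell 0 z <= A) ->
  forall t, 0 <= t <= T -> forall y, ell t y <= 2 * A * expR (sup_rate * t).
Proof.
move=> A0 ellA.
have q0 : 0 < 8 * K * T `^ 4^-1 by rewrite !mulr_gt0 ?powR_gt0.
have lam0 : 0 < sup_rate by rewrite exprn_gt0.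
suff H k : (k <= n)%N -> forall t, 0 <= t <= T -> t <= g k -> forall y,
    ell t y <= 2 * A * expR (sup_rate * t).
  by move=> t t0T; apply: (H n) => //; rewrite (es_gridn E); case/andP: t0T.
elim: k => [_ t /andP[t0 _]|k ih kn t /andP[t0 tT] tk y].
  rewrite (es_grid0 E) => t0' y; have -> : t = 0 by apply/eqP; rewrite eq_le t0 t0'.
  by rewrite mulr0 expR0 mulr1 (le_trans (ellA _))//; lra.
have [t0'|t0'] := leP t 0.
  have -> : t = 0 by apply/eqP; rewrite eq_le t0 t0'.
  by rewrite mulr0 expR0 mulr1 (le_trans (ellA _))//; lra.
have [D [-> DK _]] := es_duhamel E (lexx 0) t0' tT.
have e1 : 1 <= expR (sup_rate * t) by rewrite -expR0 ler_expR mulr_ge0 ?ltW.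
have S1 : smooth P (t - 0) (X 0) y <= A.
  by apply: (smooth_le _ _ (es_density E _) ellA); rewrite ?subr0// lexx ltW.
pose B := 2 * A * expR (sup_rate * t).
have B0 : 0 <= B by rewrite !mulr_ge0 ?expR_ge0.
(* The bound at time g j is B exp (- sup_rate u_j), at most B (sup_rate u_j)^(-1/4), and u_j^(-1/4)
   = (sqrt u_j)^(-1/2). So [gap_sum] applies with a = 1/2 and yields 4 T^(1/4); with sup_rate^(1/4)
   = 8 K T^(1/4) the total is at most B / 2. *)
have S2 : \sum_(j < n) D j y <= A * expR (sup_rate * t).
  apply: (@le_trans _ _ (\sum_(j < n) (K * B / (8 * K * T `^ 4^-1)) *
    ((gap g 0 t j - gap g 0 t j.+1) / Num.sqrt (gap g 0 t j) *
    (Num.sqrt (gap g 0 t j))^-1 `^ 2^-1))).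
    apply: ler_sum => j _; apply: (le_trans (ler_norm _)).
    apply: (le_trans (DK _ (ltn_ord j) y)).
    have := gap_noninc 0 t (ltn_ord j); rewrite -subr_ge0.
    have := gap_ge0 j (ltW t0').
    rewrite le_eqVlt => /predU1P[<-|u0].
      by rewrite sqrtr0 invr0 !(mulr0, mul0r).
    rewrite le_eqVlt => /predU1P[<-|du0]; first by rewrite !(mulr0, mul0r).
    have s0 : 0 < Num.sqrt (gap g 0 t j) by rewrite sqrtr_gt0.
    have gj : clamp 0 t (g j) = g j /\ g j < t.
      have gj0 : 0 <= g j by rewrite -(es_grid0 E) grid_le// ltnW.
      have : clamp 0 t (g j) < t by rewrite -subr_gt0.
      rewrite /clamp gt_max t0' gt_min ltxx orbF => /andP[_ gt].
      by rewrite min_l ?(ltW gt)// max_r.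
    case: gj => gjE gjt.
    (* A contributing cell begins strictly before t <= g k.+1, so its grid point is covered by the
       induction hypothesis. *)
    have jk : (j <= k)%N.
      rewrite leqNgt; apply/negP => kj.
      by have := lt_le_trans gjt tk; rewrite ltNge grid_le// ltnW.
    have gj0 : 0 <= g j by rewrite -(es_grid0 E) grid_le// ltnW.
    have gjT : 0 <= g j <= T by rewrite gj0 (le_trans (ltW gjt)).
    have M : smooth P (2 * gap g 0 t j) (X (clamp 0 t (g j))) y <=
        2 * A * expR (sup_rate * g j).
      rewrite gjE; apply: (smooth_le _ _ (es_density E gjT)).
        by rewrite mulr_gt0.
      by apply: ih; rewrite ?(ltnW kn)// grid_le// ltnW.
    have M2 : 2 * A * expR (sup_rate * g j) <=
        B / (8 * K * T `^ 4^-1) * (Num.sqrt (gap g 0 t j))^-1 `^ 2^-1.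
      have -> : sup_rate * g j = sup_rate * t + - (sup_rate * gap g 0 t j).
        by rewrite /gap gjE; ring.
      rewrite expRD [leLHS]mulrA -[leRHS]mulrA; apply: ler_wpM2l => //.
      apply: (le_trans (expRN_le_powR (mulr_gt0 lam0 u0))).
      have R1 : sup_rate `^ (- 4^-1) = (8 * K * T `^ 4^-1)^-1.
        rewrite /sup_rate -(powR_mulrn _ (ltW q0)) -powRrM.
        rewrite (_ : 4%:R * - 4^-1 = - 1 :> R); last by field.
        by rewrite powR_inv1// ltW.
      have R2 : (Num.sqrt (gap g 0 t j))^-1 `^ 2^-1 = gap g 0 t j `^ (- 4^-1).
        rewrite -(powR12_sqrt (ltW u0)) -powRN -powRrM; congr (_ `^ _).
        by field.
      by rewrite (powRM _ (ltW lam0) (ltW u0)) R1 R2.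
    rewrite [leRHS](_ : _ = K * ((gap g 0 t j - gap g 0 t j.+1) /
      Num.sqrt (gap g 0 t j)) * (B / (8 * K * T `^ 4^-1) *
      (Num.sqrt (gap g 0 t j))^-1 `^ 2^-1)); last by ring.
    apply: ler_wpM2l; last exact: le_trans M2.
    by rewrite mulr_ge0 ?divr_ge0 ?ltW.
  rewrite -mulr_sumr.
  have a01 : 0 <= (2^-1 : R) < 1 by apply/andP; split; lra.
  have := gap_sum (lexx 0) t0 a01; rewrite subr0 => h.
  have KB0 : 0 <= K * B / (8 * K * T `^ 4^-1).
    by apply: divr_ge0; [exact: mulr_ge0 (ltW K0) B0|exact: ltW].
  apply: (le_trans (ler_wpM2l KB0 h)).
  have -> : 2 / (1 - 2^-1) = 4 :> R by field.
  have -> : (1 - 2^-1) / 2 = 4^-1 :> R by field.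
  have tT' : t `^ 4^-1 <= T `^ 4^-1.
    by apply: ge0_ler_powR; rewrite ?nnegrE ?(ltW T0).
  have P0 : 0 < T `^ 4^-1 by rewrite powR_gt0.
  apply: (@le_trans _ _ (K * B / (8 * K * T `^ 4^-1) * (4 * T `^ 4^-1))).
    by apply: ler_wpM2l => //; exact: ler_wpM2l.
  rewrite le_eqVlt; apply/orP; left; apply/eqP; rewrite /B.
  by field; rewrite !lt0r_neq0.
have AE : A <= A * expR (sup_rate * t) by rewrite ler_peMr.
by lra.
Qed.

End density_estimates.

(** * Hölder continuity in space and the modulus in time *)

Section uniform_estimates.
Context (R : realType) (d : nat) dO (Omega : measurableType dO)
  (P : probability Omega R) (T K : R) (n : nat) (g : nat -> R)
  (X : R -> Omega -> 'rV[R]_d) (ell : R -> 'rV[R]_d -> R).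
Hypothesis T0 : 0 < T.
Hypothesis K0 : 0 < K.
Hypothesis E : euler_system P T K n g X ell.
Variables (M a L : R).
Hypothesis M0 : 0 <= M.
Hypothesis ellM : forall t, 0 <= t <= T -> forall y, ell t y <= M.
Hypothesis a01 : 0 < a < 1.
Hypothesis L0 : 0 <= L.
Hypothesis ellL : forall y h, `|ell 0 (y + h) - ell 0 y| <= L * enorm h `^ a.
Implicit Types (s t : R) (y h : 'rV[R]_d).

Lemma coef_ge0 s t j : s <= t -> (j < n)%N ->
  0 <= (gap g s t j - gap g s t j.+1) / Num.sqrt (gap g s t j).
Proof.
move=> st jn; rewrite divr_ge0 ?sqrtr_ge0// subr_ge0.
exact: (gap_noninc E).
Qed.

Lemma clamp_in s t x : 0 <= s -> s <= t -> t <= T -> 0 <= clamp s t x <= T.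
Proof.
move=> s0 st tT; have /andP[c1 c2] := clamp_bounds x st.
by rewrite (le_trans s0 c1) (le_trans c2 tT).
Qed.

(* At gap 0 the coefficient is 0 / 0 = 0, so that the junk value heat 0 is harmless. *)
Lemma coef_mul_le s t j (b c : R) : s <= t ->
  (0 < gap g s t j -> b <= c) ->
  0 <= (gap g s t j - gap g s t j.+1) / Num.sqrt (gap g s t j) ->
  (gap g s t j - gap g s t j.+1) / Num.sqrt (gap g s t j) * b <=
  (gap g s t j - gap g s t j.+1) / Num.sqrt (gap g s t j) * c.
Proof.
move=> st bc c0; have := gap_ge0 g j st.
rewrite le_eqVlt => /predU1P[u0|u0]; last by rewrite ler_wpM2l// bc.
by rewrite -u0 sqrtr0 invr0 !mulr0 !mul0r.
Qed.

Lemma powR_div_sqrt h u c : (enorm h / Num.sqrt u) `^ c =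
  enorm h `^ c * (Num.sqrt u)^-1 `^ c.
Proof. by rewrite powRM ?enorm_ge0// invr_ge0 sqrtr_ge0. Qed.

Lemma smooth_sup s t j y : 0 <= s -> s <= t -> t <= T -> 0 < gap g s t j ->
  smooth P (2 * gap g s t j) (X (clamp s t (g j))) y <= M.
Proof.
move=> s0 st tT u0; have cT := clamp_in (g j) s0 st tT.
apply: (smooth_le _ _ (es_density E cT) (ellM cT)).
by rewrite mulr_gt0.
Qed.

(** The smoothed initial density keeps the constant L. In the drift part, 4 K M / (1 - a) is K times
    2 M, for the kernels at y + h and y, times the 2 / (1 - a) of [gap_sum]. *)
Lemma density_holder t y h : 0 <= t <= T ->
  `|ell t (y + h) - ell t y| <=
  (L + 4 * K * M / (1 - a) * T `^ ((1 - a) / 2)) * enorm h `^ a.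
Proof.
have /andP[a0 a1] := a01; have a1' : 0 < 1 - a by rewrite subr_gt0.
have c0 : 0 <= 4 * K * M / (1 - a) * T `^ ((1 - a) / 2).
  rewrite mulr_ge0 ?powR_ge0// divr_ge0 ?(ltW a1')// mulr_ge0// mulr_ge0//.
  exact: ltW.
move=> /andP[t0 tT]; move: (t0); rewrite le_eqVlt => /predU1P[<-|t0'].
  apply: (le_trans (ellL _ _)); apply: ler_wpM2r; first exact: powR_ge0.
  by rewrite lerDl.
have [D [ellE _ D2]] := es_duhamel E (lexx 0) t0' tT.
rewrite !ellE opprD addrACA -sumrB.
apply: (le_trans (ler_normD _ _)); rewrite mulrDl; apply: lerD.
  have X0 := es_density E (t := 0); rewrite lexx (ltW T0) in X0.
  apply: (smooth_holder_density (X0 erefl) L0 ellL).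
  by rewrite subr0.
apply: (le_trans (ler_norm_sum _ _ _)).
apply: (@le_trans _ _ (\sum_(j < n) (2 * K * M * enorm h `^ a) *
   ((gap g 0 t j - gap g 0 t j.+1) / Num.sqrt (gap g 0 t j) *
    (Num.sqrt (gap g 0 t j))^-1 `^ a))).
  apply: ler_sum => j _.
  have a01' : 0 <= a <= 1 by rewrite !ltW.
  apply: (le_trans (D2 _ (ltn_ord j) y h a a01')).
  have cj := coef_ge0 t0 (ltn_ord j).
  rewrite powR_div_sqrt; set c := _ / Num.sqrt _ in cj *.
  set S := smooth _ _ _ _ + _; set q := _^-1 `^ a; set e := enorm h `^ a.
  rewrite [leLHS](_ : _ = K * e * q * (c * S)); last by ring.
  rewrite [leRHS](_ : _ = K * e * q * (c * (M + M))); last by ring.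
  apply: ler_wpM2l; first by rewrite !mulr_ge0 ?powR_ge0// ltW.
  by apply: coef_mul_le => // u0; apply: lerD; exact: smooth_sup.
rewrite -mulr_sumr.
have a01' : 0 <= a < 1 by rewrite ltW.
have e0 : 0 <= 2 * K * M * enorm h `^ a.
  by rewrite mulr_ge0 ?powR_ge0// mulr_ge0// mulr_ge0// ltW.
apply: (le_trans (ler_wpM2l e0 (gap_sum E (lexx 0) t0 a01'))); rewrite subr0.
rewrite [leRHS](_ : _ = 2 * K * M * enorm h `^ a * (2 / (1 - a) * T `^ ((1 - a) / 2))).
  apply: ler_wpM2l => //; apply: ler_wpM2l; first by rewrite divr_ge0// ltW.
  by apply: ge0_ler_powR; rewrite ?nnegrE ?divr_ge0 ?(ltW T0) ?(ltW a1').
by ring.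
Qed.

(** The spatial modulus of [ell s] controls its smoothing over time t - s. The drift sum is of order
    (t - s)^(1/2), and the surplus power is bounded by a power of T. *)
Lemma density_time s t y : 0 <= s -> s < t -> t <= T ->
  `|ell t y - ell s y| <=
  ((L + 4 * K * M / (1 - a) * T `^ ((1 - a) / 2)) *
     (Num.sqrt 2 ^+ d * expR (2 * a ^+ 2)) + 2 * K * M * T `^ ((1 - a) / 2)) *
  (t - s) `^ (a / 2).
Proof.
have /andP[a0 a1] := a01; have a1' : 0 < 1 - a by rewrite subr_gt0.
set L' := L + _; move=> s0 st tT; have ts0 : 0 < t - s by rewrite subr_gt0.
have sT : 0 <= s <= T by rewrite s0 (le_trans (ltW st) tT).
have L'0 : 0 <= L'.
  rewrite addr_ge0// mulr_ge0 ?powR_ge0// divr_ge0 ?(ltW a1')// mulr_ge0// mulr_ge0//.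
  exact: ltW.
have [D [-> D1 _]] := es_duhamel E s0 st tT.
rewrite addrAC mulrDl; apply: (le_trans (ler_normD _ _)); apply: lerD.
  apply: (le_trans (smooth_approx (es_density E sT) L'0 (ltW a0) _ y ts0)).
    by move=> z h; exact: density_holder.
  by rewrite -(powR12_sqrt (ltW ts0)) -powRrM [2^-1 * a]mulrC.
apply: (le_trans (ler_norm_sum _ _ _)).
apply: (@le_trans _ _ (\sum_(j < n) K * M *
   ((gap g s t j - gap g s t j.+1) / Num.sqrt (gap g s t j) *
    (Num.sqrt (gap g s t j))^-1 `^ 0))).
  apply: ler_sum => j _; apply: (le_trans (D1 _ (ltn_ord j) y)).
  rewrite powRr0 mulr1 -[leLHS]mulrA -[leRHS]mulrA ler_wpM2l ?(ltW K0)//.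
  rewrite [leRHS]mulrC; apply: coef_mul_le; first exact: ltW.
    by move=> u0; apply: smooth_sup => //; exact: ltW.
  by apply: coef_ge0 => //; exact: ltW.
rewrite -mulr_sumr.
have KM : 0 <= K * M by rewrite mulr_ge0// ltW.
have z01 : 0 <= (0 : R) < 1 by rewrite lexx ltr01.
apply: (le_trans (ler_wpM2l KM (gap_sum E s0 (ltW st) z01))).
rewrite subr0 divr1 [leRHS](_ : _ = K * M *
  (2 * (T `^ ((1 - a) / 2) * (t - s) `^ (a / 2)))); last by ring.
rewrite ler_wpM2l// ler_wpM2l//.
rewrite (_ : 1 / 2 = (1 - a) / 2 + a / 2); last by field.
rewrite powRD; last by rewrite (lt0r_neq0 ts0) implybT.
rewrite ler_wpM2r ?powR_ge0//.
apply: ge0_ler_powR; rewrite ?nnegrE ?divr_ge0 ?(ltW T0) ?(ltW a1') ?(ltW ts0)//.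
by rewrite lerBlDr (le_trans tT)// lerDl.
Qed.

End uniform_estimates.

(** * Weighted estimates *)

Section weights.
Context (R : realType) (d : nat) (p : R).
Hypothesis p0 : 0 < p.
Local Notation Leb := (lebesgue_rV R d).
Implicit Types (x y h : 'rV[R]_d) (f a : 'rV[R]_d -> R) (u : R).

Definition weight x : R := 1 + enorm x `^ p.

Lemma weight_ge1 x : 1 <= weight x.
Proof. by rewrite lerDl powR_ge0. Qed.

Lemma weight_ge0 x : 0 <= weight x.
Proof. exact: le_trans ler01 (weight_ge1 x). Qed.

Lemma weightN x : weight (- x) = weight x.
Proof. by rewrite /weight (enormN x). Qed.

Lemma measurable_weight : measurable_fun setT weight.
Proof.
apply: measurable_funD => //; apply: (measurableT_comp (measurable_powR p)).
exact: measurable_enorm.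
Qed.

Lemma powR2_ge1 : 1 <= 2 `^ p :> R.
Proof. by rewrite -[leLHS](powRr0 2); apply: ler_powR (ltW p0); rewrite ler1n. Qed.

(** Up to a constant the weight is submultiplicative, so under a translation it splits into one
    factor for the point and one for the shift. *)
Lemma weightD x y : weight (x + y) <= 2 `^ p * (weight x * weight y).
Proof.
have h := powR_enormD x y (ltW p0); rewrite /weight.
have a0 := powR_ge0 (enorm x) p; have b0 := powR_ge0 (enorm y) p.
have c1 := powR2_ge1.
have ab : 0 <= 2 `^ p * (enorm x `^ p * enorm y `^ p).
  by rewrite mulr_ge0 ?powR_ge0// mulr_ge0.
have E : 2 `^ p * ((1 + enorm x `^ p) * (1 + enorm y `^ p)) =
  2 `^ p + 2 `^ p * (enorm x `^ p + enorm y `^ p) + 2 `^ p * (enorm x `^ p * enorm y `^ p).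
  by ring.
rewrite E; apply: (@le_trans _ _ (1 + 2 `^ p * (enorm x `^ p + enorm y `^ p))).
  by rewrite lerD2l.
by rewrite -[leRHS]addrA; apply: lerD => //; rewrite lerDl.
Qed.

Lemma weighted_L1E f : weighted_L1 p f = (\int[Leb]_x (weight x * `|f x|)%:E)%E.
Proof. by []. Qed.

Lemma measurable_weight_mul f : measurable_fun setT f ->
  measurable_fun setT (fun x => (weight x * `|f x|)%:E).
Proof.
move=> mf; apply/measurable_EFinP; apply: measurable_funM; first exact: measurable_weight.
exact: measurableT_comp.
Qed.

Lemma weighted_L1_ge0 f : (0 <= weighted_L1 p f)%E.
Proof. by apply: integral_ge0 => x _; rewrite lee_fin mulr_ge0 ?weight_ge0. Qed.

Lemma weighted_L1_le f a : measurable_fun setT f -> measurable_fun setT a ->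
  (forall x, `|f x| <= `|a x|) -> (weighted_L1 p f <= weighted_L1 p a)%E.
Proof.
move=> mf ma fa; apply: ge0_le_integral => //.
- by move=> x _; rewrite lee_fin mulr_ge0 ?weight_ge0.
- exact: measurable_weight_mul.
- exact: measurable_weight_mul.
- by move=> x _; rewrite lee_fin ler_wpM2l ?weight_ge0.
Qed.

Lemma weighted_L1Z (c : R) f : 0 <= c -> measurable_fun setT f ->
  weighted_L1 p (fun x => c * f x) = (c%:E * weighted_L1 p f)%E.
Proof.
move=> c0 mf; rewrite [in RHS]weighted_L1E -ge0_integralZl//.
- apply: eq_integral => x _; rewrite normrM (ger0_norm c0) -EFinM.
  by congr EFin; rewrite /weight; ring.
- exact: measurable_weight_mul.
- by move=> x _; rewrite lee_fin mulr_ge0 ?weight_ge0.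
Qed.

Lemma weighted_L1_sum n f a (b : nat -> 'rV[R]_d -> R) (A : R) (B : nat -> R) :
  measurable_fun setT f -> measurable_fun setT a ->
  (forall j, measurable_fun setT (b j)) ->
  (forall x, `|f x| <= `|a x| + \sum_(j < n) `|b j x|) ->
  (weighted_L1 p a <= A%:E)%E ->
  (forall j, (j < n)%N -> (weighted_L1 p (b j) <= (B j)%:E)%E) ->
  (weighted_L1 p f <= (A + \sum_(j < n) B j)%:E)%E.
Proof.
move=> mf ma mb fab aA bB.
apply: (@le_trans _ _ (\int[Leb]_x ((weight x * `|a x|)%:E +
    \sum_(j < n) (weight x * `|b j x|)%:E))%E).
  apply: ge0_le_integral => //.
  - by move=> x _; rewrite lee_fin mulr_ge0 ?weight_ge0.
  - exact: measurable_weight_mul.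
  - apply: emeasurable_funD; first exact: measurable_weight_mul.
    by apply: emeasurable_sum => j; exact: measurable_weight_mul.
  - move=> x _; rewrite sumEFin -EFinD lee_fin -mulr_sumr -mulrDr.
    by rewrite ler_wpM2l ?weight_ge0.
rewrite ge0_integralD//; last 4 first.
- by move=> x _; rewrite lee_fin mulr_ge0 ?weight_ge0.
- exact: measurable_weight_mul.
- by move=> x _; apply: sume_ge0 => j _; rewrite lee_fin mulr_ge0 ?weight_ge0.
- by apply: emeasurable_sum => j; exact: measurable_weight_mul.
rewrite EFinD leeD// ge0_integral_sum//; last 2 first.
- by move=> j; exact: measurable_weight_mul.
- by move=> j x _; rewrite lee_fin mulr_ge0 ?weight_ge0.
by rewrite -sumEFin; apply: lee_sum => j _; exact: bB.
Qed.

Lemma weighted_L1_shift f h : measurable_fun setT f ->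
  (weighted_L1 p (fun y => f (y + h)%R) <=
   (2 `^ p * weight h)%:E * weighted_L1 p f)%E.
Proof.
move=> mf; have c0 : 0 <= 2 `^ p * weight h by rewrite mulr_ge0 ?powR_ge0 ?weight_ge0.
have mfh : measurable_fun [set: 'rV[R]_d] (fun y : 'rV[R]_d => f (y + h)).
  by apply: (measurableT_comp mf); exact: measurable_funD_rV.
rewrite weighted_L1E -(@ge0_integral_shift_rV R d h); last 2 first.
- exact: measurable_weight_mul.
- by move=> x; rewrite lee_fin mulr_ge0 ?weight_ge0.
rewrite [in leRHS]weighted_L1E -ge0_integralZl//; last 2 first.
- exact: measurable_weight_mul.
- by move=> x _; rewrite lee_fin mulr_ge0 ?weight_ge0.
apply: ge0_le_integral => //.
- by move=> x _; rewrite lee_fin mulr_ge0 ?weight_ge0.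
- apply: (@measurableT_comp _ _ _ _ _ _ (fun x => (weight x * `|f (x + h)%R|)%:E)).
    exact: measurable_weight_mul.
  exact: measurable_funB_rV.
- by apply: measurable_funeM; exact: measurable_weight_mul.
- move=> x _; have W := weightD x (- h); rewrite (weightN h) in W.
  rewrite (subrK h x) -EFinM lee_fin [leRHS]mulrA; apply: ler_wpM2r => //.
  by rewrite -[leRHS]mulrA [weight h * _]mulrC.
Qed.

(** Times (sqrt u)^q, this bounds the q-th absolute moment of [heat u], by
    [integral_heat_moment]. *)
Definition moment_const (q : R) : R := Num.sqrt 2 ^+ d * expR (2 * q ^+ 2).

Lemma moment_const_ge0 q : 0 <= moment_const q.
Proof. by rewrite mulr_ge0 ?exprn_ge0 ?sqrtr_ge0 ?expR_ge0. Qed.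

Definition weight_const (U c : R) : R :=
  moment_const c + moment_const (c + p) * Num.sqrt U `^ p.

Lemma weight_const_ge0 U c : 0 <= weight_const U c.
Proof.
by rewrite addr_ge0 ?moment_const_ge0// mulr_ge0 ?moment_const_ge0 ?powR_ge0.
Qed.

Lemma integral_heat_weight u U c : 0 <= c -> 0 < u <= U ->
  (\int[Leb]_x (heat u x * (enorm x `^ c * weight x))%:E <=
   (weight_const U c * Num.sqrt u `^ c)%:E)%E.
Proof.
move=> c0 /andP[u0 uU]; have su0 : 0 < Num.sqrt u by rewrite sqrtr_gt0.
have mp q : measurable_fun [set: 'rV[R]_d] (fun x : 'rV[R]_d => enorm x `^ q).
  by apply: (measurableT_comp (measurable_powR q)); exact: measurable_enorm.
rewrite (eq_integral (fun x => (heat u x * enorm x `^ c)%:E +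
    (heat u x * enorm x `^ (c + p))%:E)%E); last first.
  move=> x _; rewrite -EFinD (@powRD _ _ c p); last by rewrite (gt_eqF (ltr_wpDl c0 p0)).
  by congr EFin; rewrite /weight; ring.
rewrite ge0_integralD//; last 4 first.
- by move=> x _; rewrite lee_fin mulr_ge0 ?heat_ge0 ?powR_ge0.
- exact: measurable_heat_mul.
- by move=> x _; rewrite lee_fin mulr_ge0 ?heat_ge0 ?powR_ge0.
- exact: measurable_heat_mul.
have cp : 0 <= c + p by rewrite addr_ge0// ltW.
rewrite /weight_const mulrDl EFinD; apply: leeD; first exact: integral_heat_moment.
apply: (le_trans (integral_heat_moment d cp u0)).
rewrite lee_fin -/(moment_const _) -mulrA ler_wpM2l ?moment_const_ge0//.
rewrite powRD; last by rewrite (gt_eqF (ltr_wpDl c0 p0)).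
rewrite [leLHS]mulrC ler_wpM2r ?powR_ge0//.
by apply: ge0_ler_powR; rewrite ?nnegrE ?sqrtr_ge0 ?(ltW p0)// ler_wsqrtr.
Qed.

Lemma integral_heat_weight0 u U : 0 < u <= U ->
  (\int[Leb]_x (weight x * heat u x)%:E <= (weight_const U 0)%:E)%E.
Proof.
move=> uU; have := integral_heat_weight (lexx 0) uU.
rewrite powRr0 mulr1; apply: le_trans.
rewrite le_eqVlt; apply/orP; left; apply/eqP.
by apply: eq_integral => x _; rewrite powRr0 mul1r mulrC.
Qed.

(** Minkowski's integral inequality, which for a weighted L^1 norm is Tonelli's theorem. *)
Lemma weighted_L1_average u f (phi : 'rV[R]_d -> 'rV[R]_d -> R) :
  measurable_fun setT f ->
  measurable_fun setT (fun z : 'rV[R]_d * 'rV[R]_d => phi z.1 z.2) ->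
  (forall y, (`|f y|%:E <= \int[Leb]_x (heat u x * `|phi x y|)%:E)%E) ->
  (weighted_L1 p f <= \int[Leb]_x ((heat u x)%:E * weighted_L1 p (phi x)))%E.
Proof.
move=> mf mphi H.
pose F (z : 'rV[R]_d * 'rV[R]_d) := (heat u z.1 * (weight z.2 * `|phi z.1 z.2|))%:E.
have mF : measurable_fun setT F.
  apply/measurable_EFinP; apply: measurable_funM.
    exact: (measurableT_comp (measurable_heat u)).
  apply: measurable_funM; first exact: (measurableT_comp measurable_weight).
  exact: (measurableT_comp (@normr_measurable R setT)).
have F0 z : (0 <= F z)%E by rewrite lee_fin !mulr_ge0 ?heat_ge0 ?weight_ge0.
have mphi1 x : measurable_fun setT (phi x).
  exact: (measurableT_comp mphi (measurable_fun_pair (measurable_cst x) (@measurable_id _ _ _))).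
have mphi2 y : measurable_fun setT (phi ^~ y).
  exact: (measurableT_comp mphi (measurable_fun_pair (@measurable_id _ _ _) (measurable_cst y))).
apply: (@le_trans _ _ (\int[Leb]_y \int[Leb]_x F (x, y))%E).
  apply: ge0_le_integral => //.
  - by move=> y _; rewrite lee_fin mulr_ge0 ?weight_ge0.
  - exact: measurable_weight_mul.
  - exact: (@measurable_fun_fubini_tonelli_G _ _ _ _ R Leb F mF F0).
  - move=> y _; rewrite /F/= EFinM.
    rewrite (eq_integral (fun x => (weight y)%:E * (heat u x * `|phi x y|)%:E)%E).
      rewrite ge0_integralZl//; first by apply: lee_wpmul2l => //; rewrite lee_fin weight_ge0.
      + by apply: measurable_heat_mul; exact: measurableT_comp.
      + by move=> x _; rewrite lee_fin mulr_ge0 ?heat_ge0.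
      + by rewrite lee_fin weight_ge0.
    by move=> x _; rewrite -EFinM mulrCA.
rewrite -(@fubini_tonelli _ _ _ _ R Leb Leb F mF F0).
rewrite le_eqVlt; apply/orP; left; apply/eqP; apply: eq_integral => x _.
rewrite /fubini_F /F/= weighted_L1E -ge0_integralZl//.
- exact: measurable_weight_mul.
- by move=> y _; rewrite lee_fin mulr_ge0 ?weight_ge0.
- by rewrite lee_fin heat_ge0.
Qed.

End weights.

(** * Smoothing in the weighted L^1 norm *)

Section smooth_weighted.
Context (R : realType) (d : nat) (p : R) dO (Omega : measurableType dO)
  (P : probability Omega R).
Hypothesis p0 : 0 < p.
Local Notation Leb := (lebesgue_rV R d).
Local Notation w := (@weight R d p).
Implicit Types (x y h : 'rV[R]_d) (u U m c : R) (Z X : Omega -> 'rV[R]_d).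

(** A and B are real so that they can be subtracted, while the average on the right may be infinite,
    a case in which there is nothing to prove. *)
Lemma abs_heat_average u (f1 f2 : 'rV[R]_d -> R) (A B : R) :
  measurable_fun setT f1 -> measurable_fun setT f2 ->
  (forall x, 0 <= f1 x) -> (forall x, 0 <= f2 x) ->
  A%:E = (\int[Leb]_x (heat u x * f1 x)%:E)%E ->
  B%:E = (\int[Leb]_x (heat u x * f2 x)%:E)%E ->
  (`|A - B|%:E <= \int[Leb]_x (heat u x * `|f1 x - f2 x|)%:E)%E.
Proof.
move=> m1 m2 f10 f20 AE BE; set c := (X in (_ <= X)%E).
have mk : measurable_fun setT (fun x => `|f1 x - f2 x|).
  by apply: measurableT_comp => //; exact: measurable_funB.
have h1 : (A%:E <= B%:E + c)%E.
  rewrite AE BE; apply: (@le_heat_average _ _ _ _ _ (fun x => `|f1 x - f2 x|)) => //.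
  by move=> x; have := ler_norm (f1 x - f2 x); lra.
have h2 : (B%:E <= A%:E + c)%E.
  rewrite AE BE; apply: (@le_heat_average _ _ _ _ _ (fun x => `|f1 x - f2 x|)) => //.
  by move=> x; have := ler_norm (f2 x - f1 x); rewrite distrC; lra.
have c0 : (0 <= c)%E by apply: integral_ge0 => x _; rewrite lee_fin mulr_ge0 ?heat_ge0.
move: c0 h1 h2; case: c => [r| |]; [|by move=> _ _ _; exact: leey|by []].
rewrite -!EFinD !lee_fin => _ h1 h2; rewrite ler_norml; apply/andP; split; lra.
Qed.

(** By [weightD] the double integral is bounded by a product: one factor integrates the weight
    against the law of Z, the other against the kernel. *)
Lemma smooth_weight u U W Z : 0 < u <= U -> measurable_fun setT Z ->
  (\int[P]_v (w (Z v))%:E <= W%:E)%E ->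
  (weighted_L1 p (smooth P u Z) <= (2 `^ p * W * weight_const d p U 0)%:E)%E.
Proof.
move=> uU mZ ZW; have /andP[u0 _] := uU.
pose F (z : Omega * 'rV[R]_d) := (w z.2 * heat u (z.2 - Z z.1))%:E.
have mF : measurable_fun setT F.
  apply/measurable_EFinP; apply: measurable_funM.
    exact: (measurableT_comp (measurable_weight _)).
  apply: (measurableT_comp (measurable_heat _)).
  by apply: measurable_funB_rV => //; exact: measurableT_comp.
have F0 z : (0 <= F z)%E by rewrite lee_fin mulr_ge0 ?weight_ge0 ?heat_ge0.
have -> : weighted_L1 p (smooth P u Z) = (\int[Leb]_y \int[P]_v F (v, y))%E.
  apply: eq_integral => y _; rewrite (ger0_norm (smooth_ge0 _ _ _ _)) EFinM.
  rewrite (EFin_smooth _ _ u0 mZ) -ge0_integralZl//.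
  - by apply/measurable_EFinP; exact: measurable_heat_sub.
  - by move=> v _; rewrite lee_fin heat_ge0.
  - by rewrite lee_fin (weight_ge0 p y).
rewrite -(@fubini_tonelli _ _ _ _ R P Leb F mF F0).
have Om := integral_heat_weight0 d p0 uU; set k := weight_const _ _ _ _ in Om *.
have k0 : 0 <= k by exact: weight_const_ge0.
have mwZ : measurable_fun setT (fun v => (w (Z v))%:E).
  by apply/measurable_EFinP; exact: (measurableT_comp (measurable_weight _)).
apply: (@le_trans _ _ (\int[P]_v ((2 `^ p * k)%:E * (w (Z v))%:E))%E).
  apply: ge0_le_integral => //.
  - by move=> v _; apply: integral_ge0.
  - exact: (@measurable_fun_fubini_tonelli_F _ _ _ _ R Leb F mF F0).
  - exact: measurable_funeM.
  - move=> v _; rewrite /fubini_F /F/=; move: (Z v) => z.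
    have mwh : measurable_fun [set: 'rV[R]_d] (fun x : 'rV[R]_d => (w (x + z) * heat u x)%:E).
      apply/measurable_EFinP; apply: measurable_funM; last exact: measurable_heat.
      by apply: (measurableT_comp (measurable_weight _)); exact: measurable_funD_rV.
    have wh0 x : (0 <= (w (x + z) * heat u x)%:E)%E.
      by rewrite lee_fin mulr_ge0 ?weight_ge0 ?heat_ge0.
    have := ge0_integral_shift_rV z mwh wh0.
    under eq_integral do rewrite subrK.
    move=> ->.
    apply: (@le_trans _ _ (\int[Leb]_x ((2 `^ p * w z)%:E * (w x * heat u x)%:E))%E).
      apply: ge0_le_integral => //.
      + apply: measurable_funeM; apply/measurable_EFinP; apply: measurable_funM.
          exact: measurable_weight.
        exact: measurable_heat.
      + move=> x _; rewrite -EFinM lee_fin mulrA ler_wpM2r ?heat_ge0//.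
        by rewrite (le_trans (weightD p0 x z))// -mulrA [w z * _]mulrC.
    rewrite ge0_integralZl//.
    + rewrite -EFinM -mulrA [k * _]mulrC mulrA EFinM; apply: lee_wpmul2l => //.
      by rewrite lee_fin mulr_ge0 ?powR_ge0 ?weight_ge0.
    + apply/measurable_EFinP; apply: measurable_funM; first exact: measurable_weight.
      exact: measurable_heat.
    + by move=> x _; rewrite lee_fin mulr_ge0 ?weight_ge0 ?heat_ge0.
    + by rewrite lee_fin mulr_ge0 ?powR_ge0 ?weight_ge0.
rewrite ge0_integralZl//.
- rewrite [X in (_ <= X%:E)%E]mulrAC [leRHS]EFinM; apply: lee_wpmul2l => //.
  by rewrite lee_fin mulr_ge0 ?powR_ge0.
- by move=> v _; rewrite lee_fin weight_ge0.
- by rewrite lee_fin mulr_ge0 ?powR_ge0.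
Qed.

Section density.
Variables (X : Omega -> 'rV[R]_d) (f : 'rV[R]_d -> R) (Xf : rv_density P X f).

Let mf : measurable_fun setT f. Proof. by case: Xf. Qed.
Let f0 x : 0 <= f x. Proof. by case: Xf. Qed.
Let mX : measurable_fun setT X. Proof. by case: Xf. Qed.
Let mfs y : measurable_fun [set: 'rV[R]_d] (fun x : 'rV[R]_d => f (y - x)).
Proof. by apply: (measurableT_comp mf); exact: measurable_funB_rV. Qed.

Lemma measurable_increment (k : 'rV[R]_d -> R) h : measurable_fun setT k ->
  measurable_fun [set: 'rV[R]_d] (fun y : 'rV[R]_d => k (y + h) - k y).
Proof.
move=> mk; apply: measurable_funB => //; apply: (measurableT_comp mk).
exact: measurable_funD_rV.
Qed.

(** The increment of the convolution averages translates of the increment of f. A translation by x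
    costs 2^p w x, which the kernel integrates. *)
Lemma smooth_modulus u U h m : 0 < u <= U -> 0 <= m ->
  (weighted_L1 p (fun y => f (y + h) - f y)%R <= m%:E)%E ->
  (weighted_L1 p (fun y => smooth P u X (y + h) - smooth P u X y)%R <=
   (2 `^ p * weight_const d p U 0 * m)%:E)%E.
Proof.
move=> uU m0 fm; have /andP[u0 _] := uU.
pose phi x y := f (y - x + h) - f (y - x).
apply: (@le_trans _ _ (\int[Leb]_x ((heat u x)%:E * weighted_L1 p (phi x)))%E).
  apply: weighted_L1_average.
  - by apply: measurable_increment; exact: measurable_smooth.
  - apply: measurable_funB.
      by apply: (measurableT_comp mf); apply: measurable_funD_rV => //;
        exact: measurable_funB_rV.
    by apply: (measurableT_comp mf); exact: measurable_funB_rV.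
  - move=> y; apply: (le_trans (abs_heat_average (mfs (y + h)) (mfs y)
      (fun x => f0 _) (fun x => f0 _) (EFin_smooth_density (y + h) u0 Xf)
      (EFin_smooth_density y u0 Xf))).
    rewrite le_eqVlt; apply/orP; left; apply/eqP; apply: eq_integral => x _.
    by rewrite /phi addrAC.
have m2 : 0 <= 2 `^ p * m by rewrite mulr_ge0 ?powR_ge0.
apply: (@le_trans _ _ (\int[Leb]_x ((2 `^ p * m)%:E * (w x * heat u x)%:E))%E).
  apply: ge0_le_integral => //.
  - by move=> x _; rewrite mule_ge0 ?weighted_L1_ge0// lee_fin heat_ge0.
  - apply: emeasurable_funM; first by apply/measurable_EFinP; exact: measurable_heat.
    pose G (z : 'rV[R]_d * 'rV[R]_d) := (w z.2 * `|phi z.1 z.2|)%:E.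
    have mG : measurable_fun setT G.
      apply/measurable_EFinP; apply: measurable_funM.
        exact: (measurableT_comp (measurable_weight _)).
      apply: (measurableT_comp (@normr_measurable R setT)).
      apply: measurable_funB.
        by apply: (measurableT_comp mf); apply: measurable_funD_rV => //;
          exact: measurable_funB_rV.
      by apply: (measurableT_comp mf); exact: measurable_funB_rV.
    have G0 z : (0 <= G z)%E by rewrite lee_fin mulr_ge0 ?weight_ge0.
    exact: (@measurable_fun_fubini_tonelli_F _ _ _ _ R Leb G mG G0).
  - apply: measurable_funeM; apply/measurable_EFinP; apply: measurable_funM.
      exact: measurable_weight.
    exact: measurable_heat.
  - move=> x _.
    have := weighted_L1_shift p0 (- x) (measurable_increment h mf).
    have hu0 : (0 <= (heat u x)%:E)%E by rewrite lee_fin heat_ge0.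
    rewrite weightN => /(lee_wpmul2l hu0)/le_trans; apply.
    apply: (@le_trans _ _ ((heat u x)%:E * ((2 `^ p * w x)%:E * m%:E))%E).
      apply: lee_wpmul2l; first by rewrite lee_fin heat_ge0.
      by apply: lee_wpmul2l => //; rewrite lee_fin mulr_ge0 ?powR_ge0 ?weight_ge0.
    by rewrite -!EFinM lee_fin le_eqVlt; apply/orP; left; apply/eqP; ring.
rewrite ge0_integralZl//.
- rewrite [X in (_ <= X%:E)%E]mulrAC [leRHS]EFinM; apply: lee_wpmul2l; first by rewrite lee_fin.
  exact: integral_heat_weight0.
- apply/measurable_EFinP; apply: measurable_funM; first exact: measurable_weight.
  exact: measurable_heat.
- by move=> x _; rewrite lee_fin mulr_ge0 ?weight_ge0 ?heat_ge0.
Qed.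

(** Translations are not isometries of the weighted norm, hence the factor w h in the modulus.
    Against the kernel, |x|^c w x integrates to the order (sqrt u)^c. *)
Lemma smooth_approx_L1 u U m c : 0 < u <= U -> 0 <= m -> 0 <= c ->
  (forall h, weighted_L1 p (fun y => f (y + h) - f y)%R <=
     (m * (enorm h `^ c * w h))%:E)%E ->
  (weighted_L1 p (fun y => smooth P u X y - f y)%R <=
   (m * (weight_const d p U c * Num.sqrt u `^ c))%:E)%E.
Proof.
move=> uU m0 c0 fm; have /andP[u0 _] := uU.
pose phi x y := f (y - x) - f y.
have mphi : measurable_fun [set: 'rV[R]_d * 'rV[R]_d] (fun z => phi z.1 z.2).
  apply: measurable_funB; last exact: (measurableT_comp mf).
  by apply: (measurableT_comp mf); exact: measurable_funB_rV.
apply: (@le_trans _ _ (\int[Leb]_x ((heat u x)%:E * weighted_L1 p (phi x)))%E).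
  apply: weighted_L1_average => //.
  - by apply: measurable_funB => //; exact: measurable_smooth.
  - move=> y; apply: (abs_heat_average (mfs y) (measurable_cst (f y)) (fun x => f0 _)
      (fun x => f0 y) (EFin_smooth_density y u0 Xf)).
    by rewrite integral_heat_cst.
have mp q : measurable_fun [set: 'rV[R]_d] (fun x : 'rV[R]_d => enorm x `^ q).
  by apply: (measurableT_comp (measurable_powR q)); exact: measurable_enorm.
apply: (@le_trans _ _ (\int[Leb]_x (m%:E * (heat u x * (enorm x `^ c * w x))%:E))%E).
  apply: ge0_le_integral => //.
  - by move=> x _; rewrite mule_ge0 ?weighted_L1_ge0// lee_fin heat_ge0.
  - apply: emeasurable_funM; first by apply/measurable_EFinP; exact: measurable_heat.
    pose G (z : 'rV[R]_d * 'rV[R]_d) := (w z.2 * `|phi z.1 z.2|)%:E.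
    have mG : measurable_fun setT G.
      apply/measurable_EFinP; apply: measurable_funM.
        exact: (measurableT_comp (measurable_weight _)).
      exact: (measurableT_comp (@normr_measurable R setT)).
    have G0 z : (0 <= G z)%E by rewrite lee_fin mulr_ge0 ?weight_ge0.
    exact: (@measurable_fun_fubini_tonelli_F _ _ _ _ R Leb G mG G0).
  - apply: measurable_funeM; apply: measurable_heat_mul; apply: measurable_funM => //.
    exact: measurable_weight.
  - move=> x _; have := fm (- x); rewrite weightN enormN.
    have hu0 : (0 <= (heat u x)%:E)%E by rewrite lee_fin heat_ge0.
    move=> /(lee_wpmul2l hu0)/le_trans; apply.
    by rewrite -!EFinM lee_fin mulrCA.
rewrite ge0_integralZl//.
- rewrite [leRHS]EFinM; apply: lee_wpmul2l; first by rewrite lee_fin.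
  exact: integral_heat_weight.
- apply: measurable_heat_mul; apply: measurable_funM => //.
  exact: measurable_weight.
- by move=> x _; rewrite lee_fin mulr_ge0 ?heat_ge0// mulr_ge0 ?powR_ge0 ?weight_ge0.
Qed.

End density.

End smooth_weighted.

(** * Weighted moduli of continuity of the densities *)

Section weighted_estimates.
Context (R : realType) (d : nat) (p : R) dO (Omega : measurableType dO)
  (P : probability Omega R) (T K : R) (n : nat) (g : nat -> R)
  (X : R -> Omega -> 'rV[R]_d) (ell : R -> 'rV[R]_d -> R).
Hypothesis p0 : 0 < p.
Hypothesis T0 : 0 < T.
Hypothesis K0 : 0 < K.
Hypothesis E : euler_system P T K n g X ell.
Variable W : R.
Hypothesis W0 : 0 <= W.
Hypothesis XW : forall t, 0 <= t <= T ->
  (\int[P]_v (weight p (X t v))%:E <= W%:E)%E.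
Local Notation w := (@weight R d p).
Implicit Types (s t c m : R) (y h : 'rV[R]_d).

(** A common bound for the weighted mass of the smoothed laws. The age goes up to 2 T because the
    kernel estimates double a gap of at most T. *)
Definition smooth_mass : R := 2 `^ p * W * weight_const d p (2 * T) 0.
Local Notation q := smooth_mass.

Lemma smooth_mass_ge0 : 0 <= q.
Proof. by rewrite !mulr_ge0 ?powR_ge0// weight_const_ge0. Qed.

Lemma smooth_mass_le u t : 0 < u -> u <= 2 * T -> 0 <= t <= T ->
  (weighted_L1 p (smooth P u (X t)) <= q%:E)%E.
Proof.
move=> u0 uT tT; have [mX _ _ _] := es_density E tT.
by apply: smooth_weight (XW tT) => //; rewrite u0.
Qed.

Lemma measurable_smooth_X u t : 0 <= t <= T -> measurable_fun setT (smooth P u (X t)).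
Proof. by move=> tT; have [mX _ _ _] := es_density E tT; exact: measurable_smooth. Qed.

Lemma gap_le s t j : 0 <= s -> s <= t -> t <= T -> 2 * gap g s t j <= 2 * T.
Proof.
move=> s0 st tT; rewrite ler_wpM2l// /gap lerBlDr (le_trans tT)// lerDl.
by have /andP[+ _] := clamp_bounds (g j) st; exact: le_trans.
Qed.

Lemma weighted_L1_0 : weighted_L1 p (fun _ : 'rV[R]_d => 0) = 0%E.
Proof. by rewrite /weighted_L1; apply: integral0_eq => x _; rewrite normr0 mulr0. Qed.

Definition smooth_pair h u t y : R := smooth P u (X t) (y + h) + smooth P u (X t) y.

Lemma measurable_shift_rV (k : 'rV[R]_d -> R) h : measurable_fun setT k ->
  measurable_fun [set: 'rV[R]_d] (fun y : 'rV[R]_d => k (y + h)).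
Proof. by move=> mk; apply: (measurableT_comp mk); exact: measurable_funD_rV. Qed.

Lemma measurable_smooth_pair h u t : 0 <= t <= T ->
  measurable_fun setT (smooth_pair h u t).
Proof.
move=> tT; have mX := measurable_smooth_X u tT.
by apply: measurable_funD; [exact: (measurable_shift_rV h mX)|exact: mX].
Qed.

Lemma smooth_pair_le h u t : 0 < u -> u <= 2 * T -> 0 <= t <= T ->
  (weighted_L1 p (smooth_pair h u t) <= (2 * 2 `^ p * q * w h)%:E)%E.
Proof.
move=> u0 uT tT; have mX := measurable_smooth_X u tT.
have H := smooth_mass_le u0 uT tT.
have c1 : 1 <= 2 `^ p * w h.
  by rewrite -[leLHS]mulr1; apply: ler_pM => //; [exact: powR2_ge1|exact: weight_ge1].
have Hh : (weighted_L1 p (fun y => smooth P u (X t) (y + h)%R) <=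
    (2 `^ p * w h * q)%:E)%E.
  apply: (le_trans (weighted_L1_shift p0 h mX)); rewrite [leRHS]EFinM.
  by apply: lee_wpmul2l => //; rewrite lee_fin (le_trans ler01).
have := @weighted_L1_sum R d p 1 (smooth_pair h u t)
  (fun y => smooth P u (X t) (y + h)) (fun _ => smooth P u (X t))
  (2 `^ p * w h * q) (fun=> q).
move=> /(_ (measurable_smooth_pair h u tT) (measurable_shift_rV h mX) (fun=> mX)).
rewrite big_ord1 => /(_ _ Hh (fun _ _ => H)) HH.
apply: (le_trans (HH _)).
  move=> x; rewrite big_ord1 /smooth_pair; exact: ler_normD.
rewrite lee_fin.
have : q <= 2 `^ p * w h * q by rewrite ler_peMl ?smooth_mass_ge0.
have -> : 2 * 2 `^ p * q * w h = 2 `^ p * w h * q + 2 `^ p * w h * q by ring.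
by rewrite lerD2l.
Qed.

(* At s = 0 the kernel is a junk value, and the density itself is used. *)
Definition initial_profile s : 'rV[R]_d -> R :=
  if 0 < s then smooth P s (X 0) else ell s.

(** The discrete Duhamel formula from 0 to s: the hypothesis covers the smoothed initial law, and
    the drift adds a modulus of any order c < 1. The added constant is K times the mass 2 2^p q of a
    pair of kernels times 2 / (1 - c). *)
Lemma weighted_modulus s c m h : 0 <= s <= T -> 0 <= c < 1 -> 0 <= m ->
  (weighted_L1 p (fun y => initial_profile s (y + h) - initial_profile s y)%R <=
    (m * (enorm h `^ c * w h))%:E)%E ->
  (weighted_L1 p (fun y => ell s (y + h) - ell s y)%R <=
    ((m + 4 * K * 2 `^ p * q / (1 - c) * T `^ ((1 - c) / 2)) *
     (enorm h `^ c * w h))%:E)%E.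
Proof.
move=> sT c01 m0; have /andP[s0 sT'] := sT; have /andP[c0 c1] := c01.
have c1' : 0 < 1 - c by rewrite subr_gt0.
have hw0 : 0 <= enorm h `^ c * w h by rewrite mulr_ge0 ?powR_ge0 ?weight_ge0.
have q0 := smooth_mass_ge0.
rewrite /initial_profile; case: ifPn => [s0'|_]; last first.
  move/le_trans; apply; rewrite lee_fin ler_wpM2r// lerDl.
  rewrite mulr_ge0 ?powR_ge0// divr_ge0 ?(ltW c1')// mulr_ge0// mulr_ge0 ?powR_ge0//.
  by rewrite mulr_ge0// ltW.
move=> H; have zT : 0 <= (0 : R) <= T by rewrite lexx (ltW T0).
have [D [ellE _ D2]] := es_duhamel E (lexx 0) s0' sT'.
rewrite subr0 in ellE.
pose cj j := (gap g 0 s j - gap g 0 s j.+1) / Num.sqrt (gap g 0 s j).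
pose qj j := (Num.sqrt (gap g 0 s j))^-1 `^ c.
pose bj j y := K * (cj j * qj j) * enorm h `^ c *
  smooth_pair h (2 * gap g 0 s j) (clamp 0 s (g j)) y.
pose Bj j := K * (2 * 2 `^ p * q) * (enorm h `^ c * w h) * (cj j * qj j).
have [_ mell _ _] := es_density E sT.
have cl j : 0 <= clamp 0 s (g j) <= T by exact: clamp_in.
have cj0 j : (j < n)%N -> 0 <= cj j * qj j.
  by move=> jn; apply: mulr_ge0 (powR_ge0 _ _); exact: (coef_ge0 E s0 jn).
have kk0 : 0 <= K * (2 * 2 `^ p * q) * (enorm h `^ c * w h).
  apply: mulr_ge0 hw0; apply: mulr_ge0 (ltW K0) _; apply: mulr_ge0 q0.
  by rewrite mulr_ge0 ?powR_ge0.
have mbj j : measurable_fun setT (bj j).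
  by apply: measurable_funM => //; exact: measurable_smooth_pair.
have c01' : 0 <= c <= 1 by rewrite c0 ltW.
apply: (le_trans (@weighted_L1_sum R d p n (fun y => ell s (y + h) - ell s y)
  (fun y => smooth P s (X 0) (y + h) - smooth P s (X 0) y) bj _ Bj
  (measurable_increment h mell) (measurable_increment h (measurable_smooth_X s zT))
  mbj _ H _)).
- move=> y; rewrite !ellE opprD addrACA -sumrB.
  apply: (le_trans (ler_normD _ _)); rewrite lerD2l.
  apply: (le_trans (ler_norm_sum _ _ _)); apply: ler_sum => j _.
  apply: (le_trans (D2 _ (ltn_ord j) y h c c01')).
  rewrite powR_div_sqrt -/(cj j) -/(qj j).
  rewrite (le_trans _ (ler_norm _))// le_eqVlt; apply/orP; left; apply/eqP.
  by rewrite /bj /smooth_pair; move: (smooth P _ _ (y + h) + _) (enorm h `^ c) => S e; ring.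
- move=> j jn; have := gap_ge0 g j s0; rewrite le_eqVlt => /predU1P[u0|u0].
    have -> : bj j = fun=> 0.
      by apply/funext => y; rewrite /bj /cj -u0 sqrtr0 invr0 !(mulr0, mul0r).
    by rewrite weighted_L1_0 lee_fin; exact: mulr_ge0 kk0 (cj0 _ jn).
  have k0 : 0 <= K * (cj j * qj j) * enorm h `^ c.
    by apply: mulr_ge0 (powR_ge0 _ _); apply: mulr_ge0 (ltW K0) (cj0 _ jn).
  have -> : weighted_L1 p (bj j) = ((K * (cj j * qj j) * enorm h `^ c)%:E *
      weighted_L1 p (smooth_pair h (2 * gap g 0 s j) (clamp 0 s (g j))))%E.
    exact: (weighted_L1Z p k0 (measurable_smooth_pair h _ (cl j))).
  have u2 : 0 < 2 * gap g 0 s j by rewrite mulr_gt0.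
  have S := smooth_pair_le h u2 (gap_le j (lexx 0) s0 sT') (cl j).
  apply: (le_trans (lee_wpmul2l _ S)); first by rewrite lee_fin.
  by rewrite -EFinM lee_fin le_eqVlt; apply/orP; left; apply/eqP; rewrite /Bj; ring.
rewrite lee_fin mulrDl lerD2l -mulr_sumr.
apply: (le_trans (ler_wpM2l kk0 (gap_sum E (lexx 0) s0 c01))); rewrite subr0.
have Tc : s `^ ((1 - c) / 2) <= T `^ ((1 - c) / 2).
  by apply: ge0_ler_powR; rewrite ?nnegrE ?divr_ge0 ?(ltW T0) ?(ltW c1').
have k1 : 0 <= 2 / (1 - c) by rewrite divr_ge0 ?ltW.
apply: (le_trans (ler_wpM2l kk0 (ler_wpM2l k1 Tc))).
by rewrite le_eqVlt; apply/orP; left; apply/eqP; ring.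
Qed.

(** The weighted counterpart of [density_time]; a spatial modulus of order c at the earlier time
    gives the power c / 2 of t - s. *)
Lemma weighted_time s t c m : 0 <= s -> s < t -> t <= T -> 0 <= c -> 0 <= m ->
  (forall h, weighted_L1 p (fun y => ell s (y + h) - ell s y)%R <=
    (m * (enorm h `^ c * w h))%:E)%E ->
  (weighted_L1 p (ell t \- ell s)%R <=
   (m * (weight_const d p T c * (t - s) `^ (c / 2)) +
    2 * K * q * (t - s) `^ 2^-1)%:E)%E.
Proof.
move=> s0 st tT c0 m0 H; have ts0 : 0 < t - s by rewrite subr_gt0.
have sT : 0 <= s <= T by rewrite s0 (le_trans (ltW st) tT).
have tT' : 0 <= t <= T by rewrite (le_trans s0 (ltW st)).
have q0 := smooth_mass_ge0.
have [D [ellE D1 _]] := es_duhamel E s0 st tT.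
pose cj j := (gap g s t j - gap g s t j.+1) / Num.sqrt (gap g s t j).
pose bj j y := K * cj j * smooth P (2 * gap g s t j) (X (clamp s t (g j))) y.
pose Bj j := K * q * (cj j * (Num.sqrt (gap g s t j))^-1 `^ 0).
have [_ mell _ _] := es_density E sT.
have [_ mellt _ _] := es_density E tT'.
have cl j : 0 <= clamp s t (g j) <= T by apply: clamp_in => //; exact: ltW.
have cj0 j : (j < n)%N -> 0 <= cj j by move=> jn; apply: (coef_ge0 E) => //; exact: ltW.
have mbj j : measurable_fun setT (bj j).
  by apply: measurable_funM => //; exact: measurable_smooth_X.
have uT : 0 < t - s <= T.
  by rewrite ts0 lerBlDr (le_trans tT)// lerDl.
have A := smooth_approx_L1 p0 (es_density E sT) uT m0 c0 H.
rewrite -(powR12_sqrt (ltW ts0)) -powRrM [2^-1 * c]mulrC in A.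
apply: (le_trans (@weighted_L1_sum R d p n (ell t \- ell s)
  (fun y => smooth P (t - s) (X s) y - ell s y) bj _ Bj
  (measurable_funB mellt mell) (measurable_funB (measurable_smooth_X _ sT) mell)
  mbj _ A _)).
- move=> y /=; rewrite ellE addrAC.
  apply: (le_trans (ler_normD _ _)); rewrite lerD2l.
  apply: (le_trans (ler_norm_sum _ _ _)); apply: ler_sum => j _.
  apply: (le_trans (D1 _ (ltn_ord j) y)).
  by rewrite (le_trans _ (ler_norm _)).
- move=> j jn; have := gap_ge0 g j (ltW st); rewrite le_eqVlt => /predU1P[u0|u0].
    have -> : bj j = fun=> 0.
      by apply/funext => y; rewrite /bj /cj -u0 sqrtr0 invr0 !(mulr0, mul0r).
    rewrite weighted_L1_0 lee_fin; apply: mulr_ge0; first exact: mulr_ge0 (ltW K0) q0.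
    exact: mulr_ge0 (cj0 _ jn) (powR_ge0 _ _).
  have k0 : 0 <= K * cj j by rewrite mulr_ge0 ?cj0// ltW.
  have -> : weighted_L1 p (bj j) = ((K * cj j)%:E *
      weighted_L1 p (smooth P (2 * gap g s t j) (X (clamp s t (g j)))))%E.
    exact: (weighted_L1Z p k0 (measurable_smooth_X _ (cl j))).
  have S : (weighted_L1 p (smooth P (2 * gap g s t j) (X (clamp s t (g j)))) <= q%:E)%E.
    by apply: smooth_mass_le => //; [rewrite mulr_gt0|apply: gap_le => //; exact: ltW].
  apply: (le_trans (lee_wpmul2l _ S)); first by rewrite lee_fin.
  rewrite -EFinM lee_fin /Bj powRr0 mulr1.
  by rewrite le_eqVlt; apply/orP; left; apply/eqP; ring.
rewrite lee_fin lerD2l -mulr_sumr.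
have k0 : 0 <= K * q by rewrite mulr_ge0// ltW.
have z01 : 0 <= (0 : R) < 1 by rewrite lexx ltr01.
apply: (le_trans (ler_wpM2l k0 (gap_sum E s0 (ltW st) z01))).
rewrite subr0 divr1 div1r.
by rewrite le_eqVlt; apply/orP; left; apply/eqP; ring.
Qed.

End weighted_estimates.

(** * The Euler-Maruyama scheme *)

Section filtration.
Context (R : realType) dO (Omega : measurableType dO) (P : probability Omega R)
  (F : R -> set (set Omega)) (d : nat).
Hypothesis UF : usual_filtration P F.
Implicit Types (s t : R) (Y Z : Omega -> 'rV[R]_d).

(** Reads adaptedness as ordinary measurability on Omega equipped with F t, so that the closure
    properties of measurable functions apply. *)
Lemma sub_measurableP t Y : 0 <= t ->
  sub_measurable (F t) Y <->
  measurable_fun setT (Y : g_sigma_algebraType (F t) -> 'rV[R]_d).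
Proof.
move=> t0; split => [FY _ A mA|mY A mA].
  by rewrite setTI; apply: sub_sigma_algebra; exact: FY.
have := mY measurableT _ mA; rewrite setTI /measurable/=.
by rewrite /= (sigma_algebra_id (filtration_sigma UF t0)).
Qed.

Lemma sub_measurable_mono s t Y : 0 <= s -> s <= t ->
  sub_measurable (F s) Y -> sub_measurable (F t) Y.
Proof. by move=> s0 st FY A mA; apply: (filtration_mono UF s0 st); exact: FY. Qed.

Lemma sub_measurableD t Y Z : 0 <= t -> sub_measurable (F t) Y ->
  sub_measurable (F t) Z -> sub_measurable (F t) (fun w => Y w + Z w).
Proof.
move=> t0 /(sub_measurableP _ t0) mY /(sub_measurableP _ t0) mZ.
by apply/(sub_measurableP _ t0); exact: measurable_funD_rV.
Qed.

Lemma sub_measurableZ t c Y : 0 <= t -> sub_measurable (F t) Y ->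
  sub_measurable (F t) (fun w => c *: Y w).
Proof.
move=> t0 /(sub_measurableP _ t0) mY.
by apply/(sub_measurableP _ t0); exact: measurable_funZ_rV.
Qed.

Lemma sub_measurable_comp t (h : 'rV[R]_d -> 'rV[R]_d) Y :
  measurable_fun setT h -> sub_measurable (F t) Y ->
  sub_measurable (F t) (fun w => h (Y w)).
Proof.
move=> mh FY A mA; apply: (FY (h @^-1` A)).
exact: measurable_preimage.
Qed.

Lemma sub_measurable_measurable t Y : 0 <= t -> sub_measurable (F t) Y ->
  measurable_fun setT Y.
Proof.
move=> t0 FY _ A mA; rewrite setTI; apply: (filtration_sub UF t0); exact: FY.
Qed.

End filtration.

(** * Integrals over time intervals *)

Section integral_lemmas.
Context (R : realType).
Local Notation leb := (@lebesgue_measure R).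

Lemma integrable_itv_co (f : R -> R) (M s t : R) : measurable_fun setT f ->
  (forall r, `|f r| <= M) -> leb.-integrable `[s, t[ (EFin \o f).
Proof.
move=> mf fM; apply: measurable_bounded_integrable => //.
- by rewrite /= lebesgue_measure_itv/=; case: ifP => _; rewrite ?ltry// -EFinB ltry.
- exact: measurable_funS mf.
- exists M; split; first exact: num_real.
  by move=> x Mx r _ /=; rewrite (le_trans (fM r))// ltW.
Qed.

(** Agreement is only asked before t, since [tau] jumps at grid points and is 0 at T; a single point
    does not affect the integral. Measurability and boundedness come from psi. *)
Lemma Rintegral_increment (f psi : R -> R) (M s t : R) : 0 <= s -> s <= t ->
  measurable_fun setT psi -> (forall r, `|psi r| <= M) ->
  (forall r, 0 <= r < t -> f r = psi r) ->
  \int[leb]_(r in `[0, t]) f r - \int[leb]_(r in `[0, s]) f r =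
  \int[leb]_(r in `[s, t[) psi r.
Proof.
move=> s0 st mpsi psiM fpsi.
have H u : u <= t -> \int[leb]_(r in `[0, u]) f r = \int[leb]_(r in `[0, u[) psi r.
  move=> ut; have fE : {in `[0, u[%classic, psi =1 f}.
    move=> r; rewrite inE/= in_itv/= => /andP[r0 ru]; apply/esym/fpsi.
    by rewrite r0 (lt_le_trans ru).
  have mf : measurable_fun `[0, u[ (EFin \o f).
    apply/measurable_EFinP; apply: (eq_measurable_fun psi fE).
    exact: measurable_funS mpsi.
  rewrite /Rintegral -(integral_itv_bndo_bndc mf); congr fine.
  by apply: eq_integral => r rI; rewrite /= fE.
rewrite H// H//.
have U : `[0, t[%classic = `[0, s[%classic `|` `[s, t[%classic :> set R.
  by rewrite -itv_bndbnd_setU// bnd_simp.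
rewrite U Rintegral_setU//.
- by rewrite addrAC subrr add0r.
- by rewrite -U; exact: (integrable_itv_co _ _ mpsi psiM).
- apply/disj_setPS => r [] /=; rewrite !in_itv/= => /andP[_ rs] /andP[sr _].
  by have := lt_le_trans rs sr; rewrite ltxx.
Qed.

Lemma abs_Rintegral_itv (f : R -> R) (M s t : R) : s <= t ->
  measurable_fun setT f -> (forall r, `|f r| <= M) ->
  `|\int[leb]_(r in `[s, t[) f r| <= M * (t - s).
Proof.
move=> st mf fM; have intf := integrable_itv_co s t mf fM.
apply: (le_trans (le_normr_Rintegral _ intf)) => //.
have -> : M * (t - s) = \int[leb]_(r in `[s, t[) M.
  rewrite Rintegral_cst//= lebesgue_measure_itv/= lte_fin.
  case: ltP => [_|ts] /=; first by [].
  have -> : t = s by apply/eqP; rewrite eq_le ts st.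
  by rewrite subrr.
apply: le_Rintegral => //.
- apply: (@integrable_itv_co _ M); first exact: measurableT_comp.
  by move=> r; rewrite normr_id.
- by apply: (@integrable_itv_co _ `|M|) => //.
Qed.

Lemma measurable_Rintegral_itv d (f : R -> 'rV[R]_d -> R) (M s t : R) :
  measurable_fun setT (fun z : R * 'rV[R]_d => f z.1 z.2) ->
  (forall r x, `|f r x| <= M) -> s <= t ->
  measurable_fun setT (fun x => \int[leb]_(r in `[s, t[) f r x).
Proof.
move=> mf fM st.
have mfx x : measurable_fun setT (f ^~ x).
  exact: (measurableT_comp mf (measurable_fun_pair (@measurable_id _ _ _) (measurable_cst x))).
(* Adding M makes the integrand nonnegative, and Tonelli gives measurability in the parameter. *)
have -> : (fun x => \int[leb]_(r in `[s, t[) f r x) =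
    (fun x => \int[leb]_(r in `[s, t[) (f r x + M) - M * (t - s)).
  apply/funext => x; rewrite RintegralD//.
  - rewrite Rintegral_cst//= lebesgue_measure_itv/= lte_fin.
    case: ltP => [_|ts]; first by rewrite -EFinB/= addrK.
    have -> : t = s by apply/eqP; rewrite eq_le ts st.
    by rewrite subrr/= mulr0 addrK.
  - exact: (integrable_itv_co _ _ (mfx x) (fM ^~ x)).
  - by apply: (@integrable_itv_co _ `|M|) => //.
apply: measurable_funB => //.
pose G (z : R * 'rV[R]_d) := ((\1_(`[s, t[%classic) z.1)%:E * (f z.1 z.2 + M)%:E)%E.
have mG : measurable_fun setT G.
  apply: emeasurable_funM; apply/measurable_EFinP.
    by apply: (measurableT_comp (measurable_indic _)).
  exact: measurable_funD.
have G0 z : (0 <= G z)%E.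
  rewrite mule_ge0 ?lee_fin//.
  by have := fM z.1 z.2; rewrite ler_norml => /andP[]; lra.
have mI : measurable_fun setT (fun x => \int[leb]_r G (r, x))%E.
  exact: (@measurable_fun_fubini_tonelli_G _ _ (measurableTypeR R) _ R leb G mG G0).
rewrite (_ : (fun x => _) = fine \o (fun x => \int[leb]_r G (r, x))%E).
  by apply: measurableT_comp mI; exact: fine_measurable.
apply/funext => x; rewrite /Rintegral/=; congr fine.
rewrite integral_mkcond; apply: eq_integral => r _.
by rewrite patchE /G/= indicE; case: ifP => _; rewrite ?mul1e ?mul0e.
Qed.

End integral_lemmas.

Section grid_theory.
Context (R : realType) (T : R) (n : nat).
Hypothesis T0 : 0 < T.
Hypothesis n0 : (0 < n)%N.
Local Notation g := (grid T n).

Lemma mesh_gt0 : 0 < mesh T n.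
Proof. by rewrite divr_gt0// ltr0n. Qed.

Lemma grid0 : g 0 = 0.
Proof. by rewrite /grid mul0r. Qed.

Lemma gridn : g n = T.
Proof. by rewrite /grid /mesh mulrCA divff ?mulr1// pnatr_eq0 -lt0n. Qed.

Lemma le_grid i j : (i <= j)%N -> g i <= g j.
Proof. by move=> ij; rewrite ler_wpM2r ?ler_nat// ltW// mesh_gt0. Qed.

Lemma grid_ge0 k : 0 <= g k.
Proof. by rewrite -grid0 le_grid. Qed.

Lemma grid_leT k : (k <= n)%N -> g k <= T.
Proof. by move=> kn; rewrite -[leRHS]gridn le_grid. Qed.

Lemma cell_unique i j (r : R) : g i <= r < g i.+1 -> g j <= r < g j.+1 -> i = j.
Proof.
move=> /andP[ir ri] /andP[jr rj]; apply/eqP; rewrite eqn_leq.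
by apply/andP; split; rewrite leqNgt; apply/negP => /le_grid h;
  [have := le_lt_trans (le_trans h ir) rj|have := le_lt_trans (le_trans h jr) ri];
  rewrite ltxx.
Qed.

Lemma cell_exists (r : R) : 0 <= r < T -> exists2 k, (k < n)%N & g k <= r < g k.+1.
Proof.
move=> /andP[r0 rT].
suff H m : r < g m -> exists2 k, (k < m)%N & g k <= r < g k.+1.
  by apply: H; rewrite gridn.
elim: m => [|m ih]; first by rewrite grid0 ltNge r0.
move=> rm; have [mr|mr] := leP (g m) r; first by exists m; rewrite ?mr.
by have [k km kr] := ih mr; exists k => //; exact: ltnW.
Qed.

Lemma sum_cells (h : nat -> R) k (r : R) : (k < n)%N -> g k <= r < g k.+1 ->
  \sum_(j < n) h j * \1_(`[g j, g j.+1[%classic) r = h k.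
Proof.
move=> kn kr; rewrite (bigD1 (Ordinal kn))//= big1 ?addr0.
  by rewrite indicE mem_set ?mulr1//= in_itv.
move=> j jk; rewrite indicE memNset ?mulr0//= in_itv/= => jr.
by move: jk; rewrite -val_eqE/= (cell_unique jr kr) eqxx.
Qed.

Lemma tau_cell k (r : R) : (k < n)%N -> g k <= r < g k.+1 -> tau T n r = g k.
Proof. exact: sum_cells. Qed.

End grid_theory.

(** * The scheme cell by cell and its discrete Duhamel formula *)

Section scheme.
Context (R : realType) (d : nat) (T alpha p C : R)
  (nu : probability 'rV[R]_d R) (lnu : 'rV[R]_d -> R)
  (b : R -> 'rV[R]_d -> R -> Pq d p -> 'rV[R]_d)
  (dO : measure_display) (Omega : measurableType dO) (P : probability Omega R)
  (F : R -> set (set Omega)) (B : R -> Omega -> 'rV[R]_d)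
  (X0 : Omega -> 'rV[R]_d) (n : nat)
  (X : R -> Omega -> 'rV[R]_d) (mu : R -> Pq d p) (ell : R -> 'rV[R]_d -> R).
Hypothesis T0 : 0 < T.
Hypothesis C0 : 0 < C.
Hypothesis n0 : (0 < n)%N.
Hypothesis mb : drift_measurable T b.
Hypothesis bA : assumption_A T alpha C b nu lnu.
Hypothesis UF : usual_filtration P F.
Hypothesis BM : brownian_motion P F B.
Hypothesis FX0 : sub_measurable (F 0) X0.
Hypothesis ES : euler_scheme T P b X0 B n X mu ell.
Local Notation leb := (@lebesgue_measure R).
Local Notation g := (grid T n).
Implicit Types (s t r : R) (k : nat) (i : 'I_d).

Definition cell_drift i k r x : R :=
  \1_(`]mesh T n, T]%classic) r * b r x (ell (g k) x) (mu (g k)) 0 i.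

Lemma cell_drift_le i k r x : (k <= n)%N -> `|cell_drift i k r x| <= C.
Proof.
move=> kn; rewrite /cell_drift indicE; case: (boolP (r \in _)); last first.
  by rewrite mul0r normr0 ltW.
rewrite inE/= in_itv/= => /andP[mr rT]; rewrite mul1r.
have gk : 0 <= g k <= T by rewrite grid_ge0// grid_leT.
have [_ ell0 _] := euler_density ES gk.
apply: (le_trans (coord_le_enorm _ _)); apply: (drift_bounded bA) => //.
by rewrite rT andbT (le_trans (ltW (mesh_gt0 T0 n0)) (ltW mr)).
Qed.

Lemma measurable_cell_drift i k : (k <= n)%N ->
  measurable_fun setT (fun z : R * 'rV[R]_d => cell_drift i k z.1 z.2).
Proof.
move=> kn; have gk : 0 <= g k <= T by rewrite grid_ge0// grid_leT.
have [mell ell0 _] := euler_density ES gk.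
pose D := [set z : R * 'rV[R]_d | 0 <= z.1 <= T].
have mD : measurable D.
  rewrite (_ : D = @fst R 'rV[R]_d @^-1` `[0, T]); last first.
    by apply/seteqP; split => z; rewrite /D/= in_itv.
  by rewrite -[X in measurable X]setTI; exact: measurable_fst.
pose f (z : R * 'rV[R]_d) := b z.1 z.2 (ell (g k) z.2) (mu (g k)) 0 i.
pose E := [set z : R * 'rV[R]_d * R * Pq d p | 0 <= z.1.1.1 <= T /\ 0 <= z.1.2].
have mE : measurable E.
  pose e1 (z : R * 'rV[R]_d * R * Pq d p) : R := z.1.1.1.
  pose e2 (z : R * 'rV[R]_d * R * Pq d p) : R := z.1.2.
  rewrite (_ : E = e1 @^-1` `[0, T] `&` e2 @^-1` `[0, +oo[); last first.
    by apply/seteqP; split => z; rewrite /E/= !in_itv/= andbT.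
  apply: measurableI; apply: measurable_preimage => //.
    apply: (measurableT_comp measurable_fst).
    by apply: (measurableT_comp measurable_fst); exact: measurable_fst.
  by apply: (measurableT_comp measurable_snd); exact: measurable_fst.
have mf : measurable_fun D f.
  pose h (z : R * 'rV[R]_d) : R * 'rV[R]_d * R * Pq d p :=
    (z.1, z.2, ell (g k) z.2, mu (g k)).
  apply: measurable_coord_fun; apply: (measurable_comp mE _ mb (g := h)).
    by move=> _ [z Dz <-]; rewrite /E /h/=.
  apply: measurable_funTS; apply: measurable_fun_pair => //.
  apply: measurable_fun_pair; first exact: measurable_fun_pair.
  exact: (measurableT_comp mell).
have mfD : measurable_fun setT (f \_ D) := iffLR (measurable_restrictT f mD) mf.
rewrite (_ : (fun z => _) =
    (fun z : R * 'rV[R]_d => \1_(`]mesh T n, T]%classic) z.1 * (f \_ D) z)).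
  apply: measurable_funM => //.
  exact: (measurableT_comp (measurable_indic _)).
apply/funext => z; rewrite /cell_drift patchE indicE.
case: (boolP (z.1 \in _)); last by rewrite !mul0r.
rewrite inE/= in_itv/= => /andP[mr rT].
by rewrite ifT// inE /D/= rT andbT (le_trans (ltW (mesh_gt0 T0 n0)) (ltW mr)).
Qed.

(* The drift accumulated over the part [s, t[ of the k-th cell, as a function of
   the value of the scheme at the left end of the cell. *)
Definition cell_shift k s t x : 'rV[R]_d :=
  \row_i \int[leb]_(r in `[s, t[) cell_drift i k r x.

Lemma measurable_cell_shift k s t : (k <= n)%N -> s <= t ->
  measurable_fun setT (cell_shift k s t).
Proof.
move=> kn st; apply: measurable_fun_rV => i; under eq_fun do rewrite mxE.
apply: (measurable_Rintegral_itv (measurable_cell_drift i kn) _ st).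
by move=> r x; exact: cell_drift_le.
Qed.

(** Agrees with the integrand of the scheme on [0, T[, and is bounded and measurable in r on the
    whole line. *)
Definition path_drift i w r : R :=
  \sum_(j < n) cell_drift i j r (X (g j) w) * \1_(`[g j, g j.+1[%classic) r.

Lemma measurable_path_drift i w : measurable_fun setT (path_drift i w).
Proof.
apply: measurable_sum => j; apply: measurable_funM; last exact: measurable_indic.
exact: (measurableT_comp (measurable_cell_drift i (ltnW (ltn_ord j)))
  (measurable_fun_pair (@measurable_id _ _ _) (measurable_cst (X (g j) w)))).
Qed.

Lemma path_drift_le i w r : `|path_drift i w r| <= C.
Proof.
have [[k kn kr]|nk] := pselect (exists2 k, (k < n)%N & g k <= r < g k.+1).
  rewrite /path_drift (sum_cells T0 n0 (fun j => cell_drift i j r (X (g j) w)) kn kr).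
  by apply: cell_drift_le; exact: ltnW.
rewrite /path_drift big1 ?normr0 ?ltW// => j _; rewrite indicE memNset ?mulr0//=.
by rewrite in_itv/= => jr; apply: nk; exists j.
Qed.

Lemma scheme_increment s t w : 0 <= s -> s <= t -> t <= T ->
  X t w = X s w + (\row_i \int[leb]_(r in `[s, t[) path_drift i w r)
    + Num.sqrt 2 *: (B t w - B s w).
Proof.
move=> s0 st tT.
rewrite (euler_eq ES w (t := t)) ?(le_trans s0 st)//.
rewrite (euler_eq ES w (t := s)) ?s0 ?(le_trans st)//.
apply/rowP => i; rewrite /Rintegral_rV !mxE.
pose phi r := (\1_(`]mesh T n, T]%classic) r *:
  b r (X (tau T n r) w) (ell (tau T n r) (X (tau T n r) w)) (mu (tau T n r))) 0 i.
have phiE r : 0 <= r < t -> phi r = path_drift i w r.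
  move=> /andP[r0 rt]; have [|k kn kr] := @cell_exists R T n n0 r.
    by rewrite r0 (lt_le_trans rt).
  rewrite /phi (tau_cell T0 n0 kn kr) !mxE /path_drift.
  by rewrite (sum_cells T0 n0 (fun j => cell_drift i j r (X (g j) w)) kn kr).
rewrite -(Rintegral_increment s0 st (measurable_path_drift i w) (path_drift_le i w) phiE).
rewrite /phi; ring.
Qed.

Lemma cell_increment k s t w : (k < n)%N -> g k <= s -> s <= t -> t <= g k.+1 ->
  X t w = X s w + cell_shift k s t (X (g k) w) + Num.sqrt 2 *: (B t w - B s w).
Proof.
move=> kn ks st tk.
rewrite (scheme_increment w _ st) ?(le_trans (grid_ge0 T0 n0 k) ks)//; last first.
  by rewrite (le_trans tk)// grid_leT.
congr (_ + _ + _); apply/rowP => i; rewrite !mxE; apply: eq_Rintegral => r.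
rewrite inE/= in_itv/= => /andP[sr rt].
apply: (sum_cells T0 n0 (fun j => cell_drift i j r (X (g j) w)) kn).
by rewrite (le_trans ks sr) (lt_le_trans rt).
Qed.

Lemma cell_shift_le k s t x : (k <= n)%N -> s <= t ->
  enorm (cell_shift k s t x) <= d%:R * C * (t - s).
Proof.
move=> kn st; rewrite -mulrA; apply: enorm_le_bound.
  by rewrite mulr_ge0 ?subr_ge0// ltW.
move=> i; rewrite mxE; apply: abs_Rintegral_itv => //.
  exact: (measurableT_comp (measurable_cell_drift i kn)
    (measurable_fun_pair (@measurable_id _ _ _) (measurable_cst x))).
by move=> r; exact: cell_drift_le.
Qed.

(** The term with B 0 remains because it vanishes only almost surely. *)
Lemma scheme0 : X 0 = (fun w => X0 w + Num.sqrt 2 *: B 0 w).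
Proof.
apply/funext => w; rewrite (euler_eq ES) ?lexx ?ltW//; congr (_ + _).
rewrite [X in _ + X](_ : _ = 0) ?addr0//; apply/rowP => i; rewrite !mxE.
by rewrite set_itv1 /Rintegral integral_set1.
Qed.

(** Induction over the cells: within a cell, X r is a measurable function of X (g k), B (g k) and B
    r. *)
Lemma scheme_adapted t : 0 <= t <= T -> sub_measurable (F t) (X t).
Proof.
suff H k : (k <= n)%N -> forall r, 0 <= r <= g k -> sub_measurable (F r) (X r).
  by move=> tT; apply: (H n) => //; rewrite gridn.
elim: k => [_ r|k ih kn r /andP[r0 rk]].
  rewrite grid0 -eq_le => /eqP <-; rewrite scheme0.
  apply: (sub_measurableD UF) => //; apply: (sub_measurableZ UF) => //.
  exact: (brownian_adapted BM).
have [rgk|gkr] := leP r (g k); first by apply: ih; rewrite ?r0// ltnW.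
have gk0 := grid_ge0 T0 n0 k.
have -> : X r = (fun w => (X (g k) w + cell_shift k (g k) r (X (g k) w)) +
    Num.sqrt 2 *: (B r w - B (g k) w)).
  by apply/funext => w; apply: cell_increment => //; exact: ltW.
have Xk : sub_measurable (F r) (X (g k)).
  apply: (sub_measurable_mono UF gk0 (ltW gkr)).
  by apply: ih; [exact: ltnW|rewrite gk0 lexx].
have Br : sub_measurable (F r) (B r) by exact: (brownian_adapted BM).
have Bk : sub_measurable (F r) (B (g k)).
  by apply: (sub_measurable_mono UF gk0 (ltW gkr)); exact: (brownian_adapted BM).
apply: (sub_measurableD UF) => //.
  apply: (sub_measurableD UF) => //; apply: sub_measurable_comp => //.
  by apply: measurable_cell_shift; [exact: ltnW|exact: ltW].
apply: (sub_measurableZ UF) => //.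
have -> : (fun w => B r w - B (g k) w) = (fun w => B r w + (-1) *: B (g k) w).
  by apply/funext => w; rewrite scaleN1r.
by apply: (sub_measurableD UF) => //; apply: (sub_measurableZ UF).
Qed.

(** The increment of B after s is Gaussian and independent of F s, so adding it to an F s-measurable
    vector convolves the law with the kernel of age t - s. *)
Lemma smooth_step s t (Z : Omega -> 'rV[R]_d) : 0 <= s -> s < t ->
  sub_measurable (F s) Z ->
  rv_density P (fun w => Z w + Num.sqrt 2 *: (B t w - B s w)) (smooth P (t - s) Z).
Proof.
move=> s0 st FZ; have [mB lawB] := brownian_gauss BM s0 st.
apply: smooth_density; first by rewrite subr_gt0.
- exact: (sub_measurable_measurable UF s0 FZ).
- exact: mB.
- exact: lawB.
- move=> A1 A2 mA1 mA2; apply: (brownian_indep BM s0 st) => //.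
  exact: FZ.
Qed.

Lemma scheme_density t : 0 <= t <= T -> rv_density P (X t) (ell t).
Proof.
move=> tT; have [mX lawX] := euler_law ES tT.
by have [mell ell0 muE] := euler_density ES tT; split => // A mA; rewrite lawX// muE.
Qed.

(* The density at time t of the process driven by the scheme up to time r and by
   the Brownian motion alone afterwards. *)
Definition frozen t r : 'rV[R]_d -> R :=
  if r < t then smooth P (t - r) (X r) else ell t.

(** Up to r the path is X s plus the drift shift plus noise, and the noise before and after r adds
    up to the increment from s to t. The same vector is thus also smoothed with age t - s, which
    stays positive for r = t; the two continuous densities coincide pointwise. *)
Lemma frozen_step k s r t : (k < n)%N -> g k <= s -> s <= r -> r <= t ->
  r <= g k.+1 -> s < t -> t <= T ->
  frozen t r = smooth P (t - s) (fun w => X s w + cell_shift k s r (X (g k) w)).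
Proof.
move=> kn ks sr rt rk st tT; have gk0 := grid_ge0 T0 n0 k.
have s0 : 0 <= s by exact: le_trans ks.
have t0 : 0 <= t by exact: le_trans (ltW st).
have r0 : 0 <= r by exact: le_trans sr.
have sT : 0 <= s <= T by rewrite s0 (le_trans (ltW st)).
have rT : 0 <= r <= T by rewrite r0 (le_trans rt).
have FZ : sub_measurable (F s) (fun w => X s w + cell_shift k s r (X (g k) w)).
  apply: (sub_measurableD UF) => //; first exact: scheme_adapted.
  apply: sub_measurable_comp; first by apply: measurable_cell_shift => //; exact: ltnW.
  apply: (sub_measurable_mono UF gk0 ks); apply: scheme_adapted.
  by rewrite gk0 grid_leT// ltnW.
have D1 := smooth_step s0 st FZ.
have C1 : continuous (smooth P (t - s)
    (fun w => X s w + cell_shift k s r (X (g k) w))).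
  apply: continuous_smooth; first by rewrite subr_gt0.
  exact: (sub_measurable_measurable UF s0 FZ).
rewrite /frozen; case: ifPn => [rt'|]; last first.
  (* At r = t the comparison is with [ell t] itself, the continuous density of X t. *)
  rewrite -leNgt => tr; have E : r = t by apply/eqP; rewrite eq_le rt tr.
  have D2 := scheme_density rT; rewrite E in D2.
  have XE : X t = (fun w => X s w + cell_shift k s r (X (g k) w) +
      Num.sqrt 2 *: (B t w - B s w)).
    by apply/funext => w; have := cell_increment w kn ks sr rk; rewrite E.
  rewrite -XE in D1; apply: (rv_density_unique D2 D1 _ C1).
  by apply: (euler_density_continuous ES); rewrite t0.
have D2 := smooth_step r0 rt' (scheme_adapted rT).
have XE : (fun w => X r w + Num.sqrt 2 *: (B t w - B r w)) =
    (fun w => X s w + cell_shift k s r (X (g k) w) + Num.sqrt 2 *: (B t w - B s w)).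
  apply/funext => w; rewrite (cell_increment w kn ks sr rk) -addrA -scalerDr.
  by congr (_ + _ *: _); rewrite addrC addrA subrK.
rewrite XE in D2; apply: (rv_density_unique D2 D1 _ C1).
apply: continuous_smooth; first by rewrite subr_gt0.
by have [] := scheme_density rT.
Qed.

(** D j is the increment of [frozen t] across the j-th clamped cell. By [frozen_step] it compares
    two convolutions of age [gap], with and without the drift shift of that cell. *)
Lemma scheme_system K : 0 <= K ->
  @heat_shift_bound R d (1 + d%:R * C * Num.sqrt T) K ->
  euler_system P T (K * (d%:R * C)) n g X ell.
Proof.
move=> K0 HK; split.
- exact: grid0.
- exact: gridn.
- by move=> j _; exact: le_grid.
- exact: scheme_density.
- exact: (euler_density_continuous ES).
move=> s t s0 st tT.
have dC0 : 0 <= d%:R * C by rewrite mulr_ge0// ltW.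
pose c j := clamp s t (g j).
have cE j : gap g s t j - gap g s t j.+1 = c j.+1 - c j by rewrite /gap -/(c _) -/(c _); ring.
have cb j : s <= c j <= t by apply: clamp_bounds; exact: ltW.
exists (fun j y => frozen t (c j.+1) y - frozen t (c j) y).
(* A cell that does not meet ]s, t[ collapses under clamping and contributes 0; otherwise the
   clamped cell is part of one grid cell and begins before t. *)
have cc j : (j < n)%N -> c j.+1 = c j \/
    [/\ g j <= c j, c j <= c j.+1, c j.+1 <= g j.+1 & c j < t].
  move=> jn; have gj := le_grid T0 n0 (leqnSn j).
  have : c j <= c j.+1 by rewrite /c /clamp le_max2// le_min2.
  rewrite le_eqVlt => /predU1P[->|lt]; first by left.
  right; have ct : c j < t by apply: (lt_le_trans lt); have /andP[] := cb j.+1.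
  have gjt : g j < t.
    by move: ct; rewrite /c /clamp gt_max gt_min ltxx orbF => /andP[].
  have sc : s < c j.+1 by apply: le_lt_trans lt; have /andP[] := cb j.
  split; [|by rewrite lt orbT| |exact: ct].
    by rewrite /c /clamp le_max le_min lexx (ltW gjt) orbT.
  move: sc; rewrite /c /clamp lt_max ltxx/= => sm.
  by rewrite max_r ?ge_min ?lexx// ltW.
have key j : (j < n)%N -> c j.+1 = c j \/
   [/\ 0 < gap g s t j,
    forall y, `|frozen t (c j.+1) y - frozen t (c j) y| <=
      K * (d%:R * C * (c j.+1 - c j) / Num.sqrt (gap g s t j)) *
      smooth P (2 * gap g s t j) (X (c j)) y &
    forall y h a, 0 <= a <= 1 ->
      `|frozen t (c j.+1) (y + h) - frozen t (c j) (y + h) -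
        (frozen t (c j.+1) y - frozen t (c j) y)| <=
      K * (d%:R * C * (c j.+1 - c j) / Num.sqrt (gap g s t j) *
        (enorm h / Num.sqrt (gap g s t j)) `^ a) *
      (smooth P (2 * gap g s t j) (X (c j)) (y + h) +
       smooth P (2 * gap g s t j) (X (c j)) y)].
  move=> jn; have [->|[gc cc' cg ct]] := cc j jn; [by left|right].
  have u0 : 0 < gap g s t j by rewrite subr_gt0.
  have c0 : 0 <= c j by apply: (le_trans s0); have /andP[] := cb j.
  have cT : 0 <= c j <= T by rewrite c0 (le_trans (ltW ct)).
  have c1t : c j.+1 <= t by have /andP[] := cb j.+1.
  rewrite (frozen_step jn gc cc' c1t cg ct tT).
  have -> : frozen t (c j) = smooth P (t - c j) (X (c j)) by rewrite /frozen ct.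
  have [mX _ _ _] := scheme_density cT.
  have gkT : 0 <= g j <= T by rewrite grid_ge0// grid_leT// ltnW.
  have [mXg _ _ _] := scheme_density gkT.
  have mb' : measurable_fun setT (fun w => cell_shift j (c j) (c j.+1) (X (g j) w)).
    by apply: measurableT_comp => //; apply: measurable_cell_shift => //; exact: ltnW.
  have su0 : 0 < Num.sqrt (gap g s t j) by rewrite sqrtr_gt0.
  (* The clamped cell is no longer than the gap, so the ratio is at most d C sqrt (gap), and the gap
     is at most T. *)
  have bC : d%:R * C * (c j.+1 - c j) / Num.sqrt (gap g s t j) <=
      1 + d%:R * C * Num.sqrt T.
    apply: (@le_trans _ _ (d%:R * C * Num.sqrt T)); last by rewrite lerDr.
    rewrite -mulrA ler_wpM2l// ler_pdivrMr//.
    apply: (@le_trans _ _ (gap g s t j)); first by rewrite lerD2r.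
    rewrite -[leLHS](sqr_sqrtr (ltW u0)) expr2 ler_wpM2r ?(ltW su0)//.
    rewrite ler_wsqrtr// /gap lerBlDr (le_trans tT)// lerDl//.
  have [S1 S2] := smooth_shift P HK K0 u0 mX mb'
    (fun w => cell_shift_le (X (g j) w) (ltnW jn) cc') bC.
  by split.
split.
- move=> y.
  have -> : \sum_(j < n) (frozen t (c j.+1) y - frozen t (c j) y) =
      frozen t (c n) y - frozen t (c 0%N) y.
    rewrite -(big_mkord xpredT (fun j => frozen t (c j.+1) y - frozen t (c j) y)).
    exact: (telescope_sumr (fun j => frozen t (c j) y)).
  have -> : c n = t.
    rewrite /c gridn// /clamp min_r// max_r//; exact: ltW.
  have -> : c 0%N = s.
    by rewrite /c grid0 /clamp max_l// ge_min s0.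
  by rewrite /frozen ltxx st addrC subrK.
- move=> j jn y; rewrite cE; have [->|[u0 H _]] := key j jn.
    by rewrite !subrr normr0 mul0r mulr0 mul0r.
  by rewrite (le_trans (H y))// le_eqVlt; apply/orP; left; apply/eqP; rewrite -/(c j); ring.
- move=> j jn y h a a01; rewrite cE; have [->|[u0 _ H]] := key j jn.
    by rewrite !subrr normr0 mul0r mul0r mulr0 mul0r.
  rewrite (le_trans (H y h a a01))// le_eqVlt; apply/orP; left; apply/eqP.
  by rewrite -/(c j); move: (smooth _ _ _ _ + _) (_ `^ a) => S e; ring.
Qed.

End scheme.

(** * Moments of the scheme and of its increments *)

Section scheme_moments.
Context (R : realType) (d : nat) (T alpha p C : R)
  (nu : probability 'rV[R]_d R) (lnu : 'rV[R]_d -> R)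
  (b : R -> 'rV[R]_d -> R -> Pq d p -> 'rV[R]_d)
  (dO : measure_display) (Omega : measurableType dO) (P : probability Omega R)
  (F : R -> set (set Omega)) (B : R -> Omega -> 'rV[R]_d)
  (X0 : Omega -> 'rV[R]_d) (n : nat)
  (X : R -> Omega -> 'rV[R]_d) (mu : R -> Pq d p) (ell : R -> 'rV[R]_d -> R).
Hypothesis T0 : 0 < T.
Hypothesis C0 : 0 < C.
Hypothesis n0 : (0 < n)%N.
Hypothesis p1 : 1 <= p.
Hypothesis mb : drift_measurable T b.
Hypothesis bA : assumption_A T alpha C b nu lnu.
Hypothesis UF : usual_filtration P F.
Hypothesis BM : brownian_motion P F B.
Hypothesis X0nu : has_law P X0 nu.
Hypothesis ES : euler_scheme T P b X0 B n X mu ell.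
Implicit Types (s t : R).

Let p0 : 0 < p. Proof. exact: lt_le_trans p1. Qed.

Lemma measurable_enorm_powR q (Y : Omega -> 'rV[R]_d) : measurable_fun setT Y ->
  measurable_fun setT (fun w => (enorm (Y w) `^ q)%:E).
Proof.
move=> mY; apply/measurable_EFinP; apply: (measurableT_comp (measurable_powR q)).
exact: (measurableT_comp (@measurable_enorm R d)).
Qed.

(** [smooth_step] for the zero vector shows that the scaled increment has density [heat (t - s)],
    whose moments are known. *)
Lemma brownian_moment s t : 0 <= s -> s < t ->
  (\int[P]_w (enorm (Num.sqrt 2 *: (B t w - B s w)) `^ p)%:E <=
   (moment_const d p * Num.sqrt (t - s) `^ p)%:E)%E.
Proof.
move=> s0 st; have ts0 : 0 < t - s by rewrite subr_gt0.
have FZ : sub_measurable (F s) (fun _ : Omega => 0 : 'rV[R]_d).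
  by apply/(sub_measurableP UF _ s0); exact: measurable_cst.
have [mY mf f0 YE] := smooth_step UF BM s0 st FZ.
have D : rv_density P (fun w => Num.sqrt 2 *: (B t w - B s w)) (heat (t - s)).
  have XE : (fun w => Num.sqrt 2 *: (B t w - B s w)) =
      (fun w => 0 + Num.sqrt 2 *: (B t w - B s w)).
    by apply/funext => w; rewrite add0r.
  have HE : smooth P (t - s) (fun=> 0) = heat (t - s) :> ('rV[R]_d -> R).
    apply/funext => y; apply: EFin_inj; rewrite EFin_smooth// subr0 integral_cst//.
    by rewrite [X in (_ * X)%E](_ : _ = 1%E) ?mule1//; exact: probability_setT.
  by rewrite XE -HE; split.
rewrite (integral_rv_density (k := fun x => enorm x `^ p) D).
- apply: le_trans (integral_heat_moment d (ltW p0) ts0).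
  by rewrite le_eqVlt; apply/orP; left; apply/eqP; apply: eq_integral => x _; rewrite mulrC.
- by apply: (measurableT_comp (measurable_powR p)); exact: measurable_enorm.
- by move=> x; exact: powR_ge0.
Qed.

(** The drift contributes at most d C (t - s), hence at most d C sqrt T sqrt (t - s), so that both
    parts of an increment scale like sqrt (t - s). *)
Definition increment_const : R :=
  2 `^ p * ((d%:R * C * Num.sqrt T) `^ p + moment_const d p).

Lemma increment_const_ge0 : 0 <= increment_const.
Proof. by rewrite mulr_ge0 ?powR_ge0// addr_ge0 ?powR_ge0// moment_const_ge0. Qed.

Lemma scheme_measurable t : 0 <= t <= T -> measurable_fun setT (X t).
Proof. by move=> tT; have [] := euler_law ES tT. Qed.

Lemma increment_moment s t : 0 <= s -> s < t -> t <= T ->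
  (\int[P]_w (enorm (X t w - X s w) `^ p)%:E <=
   (increment_const * Num.sqrt (t - s) `^ p)%:E)%E.
Proof.
move=> s0 st tT; have ts0 : 0 < t - s by rewrite subr_gt0.
have mX1 : measurable_fun setT (X t).
  by apply: scheme_measurable; rewrite (le_trans s0 (ltW st)).
have mX2 : measurable_fun setT (X s).
  by apply: scheme_measurable; rewrite s0 (le_trans (ltW st)).
have [mB _] := brownian_gauss BM s0 st.
have mB2 : measurable_fun setT (fun w => Num.sqrt 2 *: (B t w - B s w)).
  exact: measurable_funZ_rV.
set k := (d%:R * C * Num.sqrt T) `^ p * Num.sqrt (t - s) `^ p.
have k0 : 0 <= k by rewrite mulr_ge0 ?powR_ge0.
have bound w : enorm (X t w - X s w) `^ p <=
    2 `^ p * (k + enorm (Num.sqrt 2 *: (B t w - B s w)) `^ p).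
  rewrite (scheme_increment T0 C0 n0 mb bA ES w s0 (ltW st) tT).
  set D := (\row_i _); set N := _ *: _.
  have -> : X s w + D + N - X s w = D + N by rewrite -(addrA (X s w) D N) [X s w + _]addrC addrK.
  apply: (le_trans (powR_enormD _ _ (ltW p0))).
  rewrite ler_wpM2l ?powR_ge0// lerD2r /k -powRM ?sqrtr_ge0//; last first.
    by rewrite mulr_ge0 ?sqrtr_ge0// mulr_ge0// ltW.
  apply: ge0_ler_powR; rewrite ?nnegrE ?enorm_ge0 ?(ltW p0)//.
    by rewrite mulr_ge0 ?sqrtr_ge0// mulr_ge0 ?sqrtr_ge0// mulr_ge0// ltW.
  apply: (@le_trans _ _ (d%:R * (C * (t - s)))).
    apply: enorm_le_bound; first by rewrite mulr_ge0// ltW.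
    move=> i; rewrite mxE; apply: abs_Rintegral_itv; first exact: ltW.
      exact: (measurable_path_drift T0 n0 mb ES).
    by move=> r; exact: (path_drift_le T0 C0 n0 bA ES).
  rewrite [leLHS]mulrA -[leRHS]mulrA; apply: ler_wpM2l; first by rewrite mulr_ge0// ltW.
  rewrite -[leLHS](sqr_sqrtr (ltW ts0)) expr2 ler_wpM2r ?sqrtr_ge0//.
  by rewrite ler_wsqrtr// lerBlDr (le_trans tT)// lerDl.
apply: (@le_trans _ _ (\int[P]_w ((2 `^ p)%:E *
    (k%:E + (enorm (Num.sqrt 2 *: (B t w - B s w)) `^ p)%:E)))%E).
  apply: ge0_le_integral => //.
  - by move=> w _; rewrite lee_fin powR_ge0.
  - by apply: measurable_enorm_powR; exact: measurable_funB_rV.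
  - apply: measurable_funeM; apply: emeasurable_funD => //.
    exact: measurable_enorm_powR.
  - by move=> w _; rewrite -EFinD -EFinM lee_fin.
rewrite ge0_integralZl//; last 2 first.
- by apply: emeasurable_funD => //; exact: measurable_enorm_powR.
- by move=> w _; rewrite -EFinD lee_fin addr_ge0 ?powR_ge0.
rewrite ge0_integralD//; last 2 first.
- by move=> w _; rewrite lee_fin powR_ge0.
- exact: measurable_enorm_powR.
rewrite /increment_const -mulrA [leRHS]EFinM; apply: lee_wpmul2l.
  by rewrite lee_fin powR_ge0.
rewrite mulrDl EFinD; apply: leeD; last exact: brownian_moment.
rewrite integral_cst// [X in (_ * X)%E](_ : _ = 1%E) ?mule1//.
exact: probability_setT.
Qed.

(** The joint law of X t and X s is a coupling, and its cost is the p-th moment of the increment. *)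
Lemma scheme_Wass s t : 0 <= s -> s < t -> t <= T ->
  (Wass p (mu t) (mu s) <= (increment_const `^ p^-1 * (t - s) `^ (1 / 2))%:E)%E.
Proof.
move=> s0 st tT; have ts0 : 0 < t - s by rewrite subr_gt0.
have tT' : 0 <= t <= T by rewrite (le_trans s0 (ltW st)).
have sT : 0 <= s <= T by rewrite s0 (le_trans (ltW st)).
have [mXt lawt] := euler_law ES tT'.
have [mXs laws] := euler_law ES sT.
have mXX : measurable_fun setT (fun w => (X t w, X s w)) by exact: measurable_fun_pair.
pose XX : {mfun Omega >-> ('rV[R]_d * 'rV[R]_d)%type} :=
  HB.pack (fun w => (X t w, X s w)) (isMeasurableFun.Build _ _ _ _ _ mXX).
pose rho : probability _ R := distribution P XX.
apply: (@le_trans _ _ ((\int[rho]_z (enorm (z.1 - z.2)%R `^ p)%:E) `^ p^-1)%E).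
  apply: ereal_inf_lbound; exists rho => // A mA; split.
    rewrite -lawt// /rho/= /distribution /pushforward; congr (P _).
    by apply/seteqP; split => w /=; [case|].
  rewrite -laws// /rho/= /distribution /pushforward; congr (P _).
  by apply/seteqP; split => w /=; [case|].
have mz : measurable_fun [set: 'rV[R]_d * 'rV[R]_d] (fun z => (enorm (z.1 - z.2) `^ p)%:E).
  apply/measurable_EFinP; apply: (measurableT_comp (measurable_powR p)).
  apply: (measurableT_comp (@measurable_enorm R d)).
  exact: measurable_funB_rV.
rewrite /rho ge0_integral_pushforward//=; last first.
  by move=> z _; rewrite lee_fin powR_ge0.
have h := increment_moment s0 st tT.
have i0 : (0 <= \int[P]_w (enorm (X t w - X s w)%R `^ p)%:E)%E.
  by apply: integral_ge0 => w _; rewrite lee_fin powR_ge0.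
have pV0 : 0 <= p^-1 by rewrite invr_ge0 ltW.
have c0 : 0 <= increment_const * Num.sqrt (t - s) `^ p.
  by rewrite mulr_ge0 ?powR_ge0// increment_const_ge0.
apply: (le_trans (gt0_ler_poweR pV0 _ _ h)).
- by rewrite in_itv/= i0 leey.
- by rewrite in_itv/= lee_fin c0 leey.
rewrite poweR_EFin lee_fin powRM ?powR_ge0 ?increment_const_ge0//.
rewrite -powRrM divff ?lt0r_neq0// powRr1 ?sqrtr_ge0//.
by rewrite div1r powR12_sqrt// ltW.
Qed.

Definition moment_bound (m : R) : R :=
  1 + 2 `^ p * (m + increment_const * Num.sqrt T `^ p).

Lemma scheme_weight (m : R) : (\int[P]_w (enorm (X 0 w) `^ p)%:E <= m%:E)%E ->
  forall t, 0 <= t <= T ->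
  (\int[P]_w (weight p (X t w))%:E <= (moment_bound m)%:E)%E.
Proof.
move=> Xm t /andP[t0 tT].
have ic0 := increment_const_ge0.
have zT : 0 <= (0 : R) <= T by rewrite lexx ltW.
have mX1 : measurable_fun setT (X t) by apply: scheme_measurable; rewrite t0.
have mX2 : measurable_fun setT (X 0) by exact: scheme_measurable.
have inc : (\int[P]_w (enorm (X t w - X 0 w) `^ p)%:E <=
    (increment_const * Num.sqrt T `^ p)%:E)%E.
  move: t0; rewrite le_eqVlt => /predU1P[<-|t0].
    rewrite integral0_eq; first by rewrite lee_fin; exact: mulr_ge0 ic0 (powR_ge0 _ _).
    by move=> w _; rewrite subrr enorm0 powR0// lt0r_neq0.
  apply: (le_trans (increment_moment (lexx 0) t0 tT)); rewrite lee_fin ler_wpM2l//.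
  apply: ge0_ler_powR; rewrite ?nnegrE ?sqrtr_ge0 ?(ltW p0)//.
  by rewrite subr0 ler_wsqrtr.
apply: (@le_trans _ _ (\int[P]_w (1%:E + (2 `^ p)%:E *
    ((enorm (X 0 w) `^ p)%:E + (enorm (X t w - X 0 w)%R `^ p)%:E)))%E).
  apply: ge0_le_integral => //.
  - by move=> w _; rewrite lee_fin weight_ge0.
  - by apply/measurable_EFinP; exact: (measurableT_comp (measurable_weight _)).
  - apply: emeasurable_funD => //; apply: measurable_funeM; apply: emeasurable_funD.
      exact: measurable_enorm_powR.
    by apply: measurable_enorm_powR; exact: measurable_funB_rV.
  - move=> w _; rewrite -!EFinD lee_fin /weight lerD2l.
    have := powR_enormD (X 0 w) (X t w - X 0 w) (ltW p0).
    by rewrite [X 0 w + _]addrC subrK.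
have mm : measurable_fun setT (fun w => (enorm (X 0 w) `^ p)%:E +
    (enorm (X t w - X 0 w)%R `^ p)%:E)%E.
  apply: emeasurable_funD; first exact: measurable_enorm_powR.
  by apply: measurable_enorm_powR; exact: measurable_funB_rV.
have m0' w : (0 <= (enorm (X 0 w) `^ p)%:E + (enorm (X t w - X 0 w)%R `^ p)%:E)%E.
  by rewrite adde_ge0 ?lee_fin ?powR_ge0.
rewrite ge0_integralD//; last 2 first.
- by move=> w _; apply: mule_ge0; [rewrite lee_fin powR_ge0|exact: m0'].
- exact: measurable_funeM.
rewrite integral_cst// [X in (_ * X)%E](_ : _ = 1%E) ?mule1; last exact: probability_setT.
rewrite /moment_bound EFinD leeD2l// ge0_integralZl//.
rewrite [leRHS]EFinM; apply: lee_wpmul2l; first by rewrite lee_fin powR_ge0.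
rewrite ge0_integralD//; last 4 first.
- by move=> w _; rewrite lee_fin powR_ge0.
- exact: measurable_enorm_powR.
- by move=> w _; rewrite lee_fin powR_ge0.
- by apply: measurable_enorm_powR; exact: measurable_funB_rV.
by rewrite EFinD leeD.
Qed.

(** X 0 and X0 agree wherever B 0 = 0, thus almost surely, and have the same law. *)
Lemma scheme_initial_density : rv_density P (X 0) lnu.
Proof.
have zT : 0 <= (0 : R) <= T by rewrite lexx ltW.
have mX := scheme_measurable zT.
have [ml l0 nuE] := initial_density bA.
have [mX0 lawX0] := X0nu.
split => // A mA; rewrite -nuE// -lawX0//.
have mA1 : measurable (X 0 @^-1` A) by exact: measurable_preimage.
have mA2 : measurable (X0 @^-1` A) by exact: measurable_preimage.
rewrite -(setIT (X 0 @^-1` A)) -(setIT (X0 @^-1` A)) -!integral_indic//.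
apply: ge0_ae_eq_integral => //.
- by apply/measurable_EFinP; exact: measurable_indic.
- by apply/measurable_EFinP; exact: measurable_indic.
apply: filterS (brownian_start BM) => w B0 _.
have E : X 0 w = X0 w by rewrite (scheme0 T0 ES) B0 scaler0 addr0.
congr (_%:E); rewrite !indicE; congr (nat_of_bool _)%:R.
by apply/idP/idP; rewrite !inE/= E.
Qed.

End scheme_moments.

(** * Proof of the estimates *)

Section holder_norms.
Context (R : realType) (d : nat).
Implicit Types (f : 'rV[R]_d -> R) (a b alpha : R).

Lemma sup_norm_le f a : (forall x, `|f x| <= a) -> (sup_norm f <= a%:E)%E.
Proof. by move=> fa; apply: ge_ereal_sup => _ [x _ <-]; rewrite lee_fin. Qed.

Lemma holder_norm_le f a b alpha : (forall x, `|f x| <= a) ->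
  (forall y h, `|f (y + h) - f y| <= b * enorm h `^ alpha) ->
  (holder_norm alpha f <= (a + b)%:E)%E.
Proof.
move=> fa fb; rewrite EFinD; apply: leeD; first exact: sup_norm_le.
apply: ge_ereal_sup => _ [z /= z12 <-]; rewrite lee_fin.
have z0 : 0 < enorm (z.1 - z.2).
  by rewrite lt_def enorm_ge0 andbT enorm_eq0 subr_eq0.
rewrite ler_pdivrMr ?powR_gt0//.
by have := fb z.2 (z.1 - z.2); rewrite [z.2 + _]addrC subrK.
Qed.

Lemma holder_norm_fin f alpha : (0 < d)%N -> 0 < alpha ->
  (holder_norm alpha f < +oo)%E ->
  exists A L : R, [/\ 0 <= A, 0 <= L, holder_norm alpha f = (A + L)%:E,
    forall x, `|f x| <= A & forall y h, `|f (y + h) - f y| <= L * enorm h `^ alpha].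
Proof.
move=> d0 alpha0; rewrite /holder_norm => foo.
have s0 : (0 <= sup_norm f)%E.
  apply: (@le_trans _ _ (`|f 0|%:E)); first by rewrite lee_fin.
  by apply: ereal_sup_ubound; exists 0.
have h0 : (0 <= holder_seminorm alpha f)%E.
  (* A point different from 0, which exists as d > 0. Without two distinct points the seminorm would
     be the supremum of the empty set. *)
  pose o : 'rV[R]_d := const_mx 1.
  apply: (@le_trans _ _ (`|f 0 - f o| / enorm (0 - o) `^ alpha)%:E).
    by rewrite lee_fin divr_ge0// powR_ge0.
  apply: ereal_sup_ubound; exists (0, o) => //=.
  apply/eqP => /rowP /(_ (Ordinal d0)); rewrite !mxE => /eqP.
  by rewrite eq_sym oner_eq0.
have sfin : sup_norm f \is a fin_num.
  by rewrite ge0_fin_numE// (le_lt_trans _ foo)// leeDl.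
have hfin : holder_seminorm alpha f \is a fin_num.
  by rewrite ge0_fin_numE// (le_lt_trans _ foo)// leeDr.
exists (fine (sup_norm f)), (fine (holder_seminorm alpha f)).
split; [exact: fine_ge0|exact: fine_ge0|by rewrite EFinD !fineK| |].
  move=> x; rewrite -lee_fin fineK//; apply: ereal_sup_ubound.
  by exists x.
move=> y h; have [->|hn0] := eqVneq h 0.
  by rewrite addr0 subrr normr0 mulr_ge0 ?fine_ge0 ?powR_ge0.
have e0 : 0 < enorm h by rewrite lt_def enorm_ge0 andbT enorm_eq0.
rewrite -ler_pdivrMr ?powR_gt0// -lee_fin fineK//; apply: ereal_sup_ubound.
exists (y + h, y) => /=; last by rewrite addrAC subrr add0r.
by rewrite -subr_eq0 addrAC subrr add0r.
Qed.

End holder_norms.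

(** * The bounds with explicit constants *)

Section final_estimates.
Context (R : realType) (d : nat) (p : R) dO (Omega : measurableType dO)
  (P : probability Omega R) (T K : R) (n : nat) (g : nat -> R)
  (X : R -> Omega -> 'rV[R]_d) (ell : R -> 'rV[R]_d -> R).
Hypothesis p0 : 0 < p.
Hypothesis T0 : 0 < T.
Hypothesis K0 : 0 < K.
Hypothesis E : euler_system P T K n g X ell.
Variables (a A L W Kh C : R).
Hypothesis a01 : 0 < a < 1.
Hypothesis A0 : 0 <= A.
Hypothesis L0 : 0 <= L.
Hypothesis W0 : 0 <= W.
Hypothesis Kh0 : 0 < Kh.
Hypothesis C0 : 0 < C.
Hypothesis HKh : @heat_holder_bound R d Kh.
Hypothesis ellA : forall x, `|ell 0 x| <= A.
Hypothesis ellL : forall y h, `|ell 0 (y + h) - ell 0 y| <= L * enorm h `^ a.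
Hypothesis XW : forall t, 0 <= t <= T ->
  (\int[P]_v (weight p (X t v))%:E <= W%:E)%E.
Local Notation w := (@weight R d p).
Local Notation q := (smooth_mass d p T W).
Implicit Types (s t : R) (y h : 'rV[R]_d).

Let a0 : 0 < a. Proof. by case/andP: a01. Qed.
Let a1 : a < 1. Proof. by case/andP: a01. Qed.
Let zT : 0 <= (0 : R) <= T. Proof. by rewrite lexx ltW. Qed.
Let q0 : 0 <= q. Proof. exact: smooth_mass_ge0. Qed.

Definition exp_const : R := expR (sup_rate T K * T).

Lemma density_sup t : 0 <= t <= T -> forall y, ell t y <= 2 * A * exp_const.
Proof.
move=> tT y; have /andP[t0 tT'] := tT.
apply: (le_trans (density_sup_exp T0 K0 E A0 _ tT y)).
  by move=> x; rewrite (le_trans (ler_norm _)).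
rewrite ler_wpM2l ?mulr_ge0// ler_expR ler_wpM2l// exprn_ge0//.
by rewrite !mulr_ge0 ?powR_ge0// ltW.
Qed.

Let M0 : 0 <= 2 * A * exp_const. Proof. by rewrite !mulr_ge0 ?expR_ge0. Qed.

Definition holder_const : R :=
  1 + 2 * exp_const + 8 * K * exp_const / (1 - a) * T `^ ((1 - a) / 2).

(** The supremum is linear in A and the Hölder constant is linear in A and L, so A + L factors out
    and [holder_const] is free of nu. *)
Lemma density_holder_norm t : 0 <= t <= T ->
  (holder_norm a (ell t) <= (holder_const * (A + L))%:E)%E.
Proof.
move=> tT; apply: (le_trans (holder_norm_le (a := 2 * A * exp_const) _
   (fun y h => density_holder T0 K0 E M0 density_sup a01 L0 ellL y h tT))).
  move=> x; have [_ _ ell0 _] := es_density E tT.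
  by rewrite ger0_norm// density_sup.
rewrite lee_fin /holder_const.
have e0 : 0 <= exp_const by exact: expR_ge0.
have c0 : 0 <= 8 * K * exp_const / (1 - a) * T `^ ((1 - a) / 2).
  rewrite mulr_ge0 ?powR_ge0// divr_ge0 ?subr_ge0 ?(ltW a1)//.
  by rewrite !mulr_ge0// ltW.
set c := 8 * K * _ / _ * _ in c0 *.
have -> : 4 * K * (2 * A * exp_const) / (1 - a) * T `^ ((1 - a) / 2) = c * A.
  by rewrite /c; ring.
have h1 : 0 <= exp_const * L by rewrite mulr_ge0.
have h2 : 0 <= c * L by rewrite mulr_ge0.
have -> : (1 + 2 * exp_const + c) * (A + L) = 2 * A * exp_const + (L + c * A) +
   (A + 2 * (exp_const * L) + c * L) by ring.
rewrite lerDl; apply: addr_ge0 h2; apply: addr_ge0 A0 _; exact: mulr_ge0 h1.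
Qed.

Definition sup_time_const : R :=
  (L + 4 * K * (2 * A * exp_const) / (1 - a) * T `^ ((1 - a) / 2)) *
  (Num.sqrt 2 ^+ d * expR (2 * a ^+ 2)) +
  2 * K * (2 * A * exp_const) * T `^ ((1 - a) / 2).

Lemma density_time_sup s t : 0 <= s -> s < t -> t <= T ->
  (sup_norm (ell t \- ell s)%R <= (sup_time_const * (t - s) `^ (a / 2))%:E)%E.
Proof.
move=> s0 st tT; apply: sup_norm_le => y.
exact: (density_time T0 K0 E M0 density_sup a01 L0 ellL y s0 st tT).
Qed.

Lemma sqrt_time_le c s t : 0 <= s -> s < t -> t <= T -> 0 <= c <= 1 ->
  (t - s) `^ 2^-1 <= T `^ ((1 - c) / 2) * (t - s) `^ (c / 2).
Proof.
move=> s0 st tT /andP[c0 c1]; have ts0 : 0 < t - s by rewrite subr_gt0.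
rewrite [leLHS](_ : _ = (t - s) `^ ((1 - c) / 2 + c / 2)); last first.
  by congr (_ `^ _); field.
rewrite powRD; last by rewrite (lt0r_neq0 ts0) implybT.
rewrite ler_wpM2r ?powR_ge0//.
apply: ge0_ler_powR; rewrite ?nnegrE ?divr_ge0 ?subr_ge0 ?(ltW T0) ?(ltW st)//.
by rewrite lerBlDr (le_trans tT)// lerDl.
Qed.

Definition drift_modulus (c : R) : R := 4 * K * 2 `^ p * q / (1 - c) * T `^ ((1 - c) / 2).

Lemma drift_modulus_ge0 c : c < 1 -> 0 <= drift_modulus c.
Proof.
move=> c1; rewrite mulr_ge0 ?powR_ge0// divr_ge0 ?subr_ge0 ?(ltW c1)//.
by apply: mulr_ge0 q0; rewrite mulr_ge0 ?powR_ge0// mulr_ge0// ltW.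
Qed.

Lemma weighted_time_le s t c m : 0 <= s -> s < t -> t <= T -> 0 <= c < 1 -> 0 <= m ->
  (forall h, weighted_L1 p
     (fun y => initial_profile P X ell s (y + h) - initial_profile P X ell s y)%R <=
    (m * (enorm h `^ c * w h))%:E)%E ->
  (weighted_L1 p (ell t \- ell s)%R <=
   (((m + drift_modulus c) * weight_const d p T c +
     2 * K * q * T `^ ((1 - c) / 2)) * (t - s) `^ (c / 2))%:E)%E.
Proof.
move=> s0 st tT c01 m0 H; have /andP[c0 c1] := c01.
have sT : 0 <= s <= T by rewrite s0 (le_trans (ltW st)).
have m'0 : 0 <= m + drift_modulus c by rewrite addr_ge0// drift_modulus_ge0.
have mod_ h := weighted_modulus p0 T0 K0 E W0 XW sT c01 m0 (H h).
apply: (le_trans (weighted_time p0 K0 E W0 XW s0 st tT c0 m'0 mod_)).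
rewrite lee_fin [leRHS]mulrDl; apply: lerD; first by rewrite mulrA.
rewrite -[leRHS]mulrA; apply: ler_wpM2l.
  by apply: mulr_ge0 q0; rewrite mulr_ge0// ltW.
by apply: sqrt_time_le => //; rewrite c0 ltW.
Qed.

Definition weighted_time_const : R :=
  (2 * 2 `^ p * q * Kh + drift_modulus a * T `^ (a / 2)) * weight_const d p T a +
  2 * K * q * T `^ ((1 - a) / 2) * T `^ (a / 2).

(** [heat_holder] at age s bounds the increments of the smoothed initial law by (|h| / sqrt s)^a,
    whence s^(-a/2); only the mass of the initial law enters, not its regularity. *)
Lemma density_time_weighted s t : 0 < s -> s < t -> t <= T ->
  (weighted_L1 p (ell t \- ell s)%R <=
   (weighted_time_const * (t - s) `^ (a / 2) * s `^ (- (a / 2)))%:E)%E.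
Proof.
move=> s0 st tT; have s0' := ltW s0; have sT : s <= T by rewrite (le_trans (ltW st)).
pose S := s `^ (- (a / 2)).
have S0 : 0 <= S by exact: powR_ge0.
pose m := 2 * 2 `^ p * q * Kh * S.
have m0 : 0 <= m.
  by rewrite mulr_ge0// mulr_ge0 ?(ltW Kh0)//; apply: mulr_ge0 q0; rewrite mulr_ge0 ?powR_ge0.
have SE : (Num.sqrt s)^-1 `^ a = S.
  rewrite -(powR12_sqrt s0') -powRN -powRrM /S; congr (_ `^ _).
  by rewrite mulNr mulrC.
have H h : (weighted_L1 p
     (fun y => initial_profile P X ell s (y + h) - initial_profile P X ell s y)%R <=
    (m * (enorm h `^ a * w h))%:E)%E.
  have -> : initial_profile P X ell s = smooth P s (X 0) by rewrite /initial_profile s0.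
  have [mX _ _ _] := es_density E zT.
  have mS u := measurable_smooth_X E u zT.
  have k0 : 0 <= Kh * enorm h `^ a * S.
    by rewrite mulr_ge0// mulr_ge0 ?powR_ge0// ltW.
  apply: (@le_trans _ _ (weighted_L1 p
      (fun y => Kh * enorm h `^ a * S * smooth_pair P X h (2 * s) 0 y))).
    apply: weighted_L1_le.
    - exact: measurable_increment.
    - by apply: measurable_funM => //; exact: (measurable_smooth_pair E).
    - move=> y; have a01' : 0 <= a <= 1 by rewrite !ltW.
      apply: (le_trans (smooth_holder P y h HKh s0 a01' mX)).
      by rewrite powR_div_sqrt SE mulrA ler_norm.
  rewrite (weighted_L1Z p k0 (measurable_smooth_pair E h (2 * s) zT)).
  have s2 : 0 < 2 * s by rewrite mulr_gt0.
  have s2T : 2 * s <= 2 * T by rewrite ler_wpM2l.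
  have k0' : (0 <= (Kh * enorm h `^ a * S)%:E)%E by rewrite lee_fin.
  apply: (le_trans (lee_wpmul2l k0' (smooth_pair_le p0 E W0 XW h s2 s2T zT))).
  by rewrite -EFinM lee_fin /m le_eqVlt; apply/orP; left; apply/eqP; ring.
have c01 : 0 <= a < 1 by rewrite ltW.
apply: (le_trans (weighted_time_le s0' st tT c01 m0 H)); rewrite lee_fin.
rewrite [leRHS]mulrAC; apply: ler_wpM2r; first exact: powR_ge0.
(* The contributions of the drift carry no power of s; this factor, at least 1, gives them the
   common one. *)
have TS : 1 <= T `^ (a / 2) * S.
  rewrite /S powRN ler_pdivlMr ?powR_gt0// mul1r.
  by apply: ge0_ler_powR; rewrite ?nnegrE ?divr_ge0 ?(ltW T0) ?(ltW a0).
have D0 := drift_modulus_ge0 a1.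
have wc0 := weight_const_ge0 d p T a.
have B0 : 0 <= 2 * K * q * T `^ ((1 - a) / 2).
  by apply: mulr_ge0 (powR_ge0 _ _); apply: mulr_ge0 q0; rewrite mulr_ge0// ltW.
have -> : weighted_time_const * S =
  (m + drift_modulus a * (T `^ (a / 2) * S)) * weight_const d p T a +
  2 * K * q * T `^ ((1 - a) / 2) * (T `^ (a / 2) * S).
  by rewrite /weighted_time_const /m; ring.
apply: lerD; last by rewrite ler_peMr.
by rewrite ler_wpM2r// lerD2l ler_peMr.
Qed.

(* From |u - v| <= sqrt |u - v| (sqrt u + sqrt v) and the Hölder bound on ell 0. *)
Definition root_modulus : R := Num.sqrt L * (2 * (2 `^ p * C)).

Definition root_time_const : R :=
  let c := a / 2 in
  (root_modulus + 2 `^ p * weight_const d p T 0 * root_modulus + drift_modulus c) *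
   weight_const d p T c + 2 * K * q * T `^ ((1 - c) / 2).

(** The square root halves the Hölder exponent: the weighted modulus of [ell 0] is of order
    |h|^(a/2), which becomes (t - s)^(a/4) in time. Smoothing up to s preserves that modulus up to a
    constant. *)
Lemma density_time_root s t : 0 <= s -> s < t -> t <= T ->
  (\int[lebesgue_rV R d]_x (w x * Num.sqrt (ell 0 x))%:E <= C%:E)%E ->
  (weighted_L1 p (ell t \- ell s)%R <=
   (root_time_const * (t - s) `^ (a / 4))%:E)%E.
Proof.
move=> s0 st tT HC; have sT : s <= T by rewrite (le_trans (ltW st)).
have Xd := es_density E zT; have [mX ml l0 _] := Xd.
have r0 : 0 <= root_modulus.
  by rewrite mulr_ge0 ?sqrtr_ge0// mulr_ge0// mulr_ge0 ?powR_ge0// ltW.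
have wc0 := weight_const_ge0 d p T 0.
(* The first summand serves s = 0, where the profile is [ell 0]; the second serves s > 0, after
   [smooth_modulus]. *)
pose m := root_modulus + 2 `^ p * weight_const d p T 0 * root_modulus.
have m20 : 0 <= 2 `^ p * weight_const d p T 0 * root_modulus.
  by rewrite mulr_ge0// mulr_ge0 ?powR_ge0.
have m0 : 0 <= m by rewrite addr_ge0.
have ms : measurable_fun setT (fun x => Num.sqrt (ell 0 x)).
  by apply: (measurableT_comp (continuous_measurable_fun (@sqrt_continuous R))).
have Hr : (weighted_L1 p (fun x => Num.sqrt (ell 0 x)) <= C%:E)%E.
  rewrite weighted_L1E; apply: le_trans HC.
  rewrite le_eqVlt; apply/orP; left; apply/eqP; apply: eq_integral => x _.
  by rewrite ger0_norm ?sqrtr_ge0.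
have sqrt_incr (u v : R) : 0 <= u -> 0 <= v -> `|u - v| <=
    Num.sqrt `|u - v| * (Num.sqrt u + Num.sqrt v).
  move=> u0 v0; rewrite -{1}(sqr_sqrtr (normr_ge0 (u - v))) expr2.
  rewrite ler_wpM2l ?sqrtr_ge0//.
  rewrite -ler_sqr ?nnegrE ?addr_ge0 ?sqrtr_ge0// (sqr_sqrtr (normr_ge0 (u - v))).
  rewrite sqrrD !sqr_sqrtr//.
  have su := sqrtr_ge0 u; have sv := sqrtr_ge0 v.
  have : 0 <= Num.sqrt u * Num.sqrt v by rewrite mulr_ge0.
  by rewrite ler_norml => h; apply/andP; split; lra.
have H0 h : (weighted_L1 p (fun y => ell 0 (y + h) - ell 0 y)%R <=
    (root_modulus * (enorm h `^ (a / 2) * w h))%:E)%E.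
  have k0 : 0 <= Num.sqrt L * enorm h `^ (a / 2) by rewrite mulr_ge0 ?sqrtr_ge0 ?powR_ge0.
  have msh : measurable_fun [set: 'rV[R]_d] (fun y : 'rV[R]_d => Num.sqrt (ell 0 (y + h))).
    exact: (measurable_shift_rV h ms).
  pose b1 (y : 'rV[R]_d) := Num.sqrt L * enorm h `^ (a / 2) * Num.sqrt (ell 0 (y + h)).
  pose b2 (y : 'rV[R]_d) := Num.sqrt L * enorm h `^ (a / 2) * Num.sqrt (ell 0 y).
  have hw : (weighted_L1 p (fun y => Num.sqrt (ell 0 (y + h))) <=
      (2 `^ p * w h * C)%:E)%E.
    apply: (le_trans (weighted_L1_shift p0 h ms)); rewrite [leRHS]EFinM.
    by apply: lee_wpmul2l => //; rewrite lee_fin mulr_ge0 ?powR_ge0 ?weight_ge0.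
  have B1 : (weighted_L1 p b1 <=
      (Num.sqrt L * enorm h `^ (a / 2) * (2 `^ p * w h * C))%:E)%E.
    by rewrite (weighted_L1Z p k0 msh) [leRHS]EFinM; apply: lee_wpmul2l => //; rewrite lee_fin.
  have B2 : (weighted_L1 p b2 <= (Num.sqrt L * enorm h `^ (a / 2) * C)%:E)%E.
    by rewrite (weighted_L1Z p k0 ms) [leRHS]EFinM; apply: lee_wpmul2l => //; rewrite lee_fin.
  have mb1 : measurable_fun setT b1 by exact: measurable_funM.
  have mb2 : measurable_fun setT b2 by exact: measurable_funM.
  apply: (le_trans (@weighted_L1_sum R d p 1 _ b1 (fun=> b2) _
    (fun=> Num.sqrt L * enorm h `^ (a / 2) * C)
    (measurable_increment h ml) mb1 (fun=> mb2) _ B1 (fun _ _ => B2))).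
    move=> y; rewrite big_ord1.
    have y1 : 0 <= b1 y by apply: mulr_ge0 => //; exact: sqrtr_ge0.
    have y2 : 0 <= b2 y by apply: mulr_ge0 => //; exact: sqrtr_ge0.
    rewrite (ger0_norm y1) (ger0_norm y2) /b1 /b2 -mulrDr.
    have q1 := sqrt_incr _ _ (l0 (y + h)) (l0 y).
    apply: (@le_trans _ R _ _ _ q1).
    apply: ler_wpM2r; first by rewrite addr_ge0 ?sqrtr_ge0.
    apply: (@le_trans _ _ (Num.sqrt (L * enorm h `^ a))); first by rewrite ler_wsqrtr.
    by rewrite sqrtrM// -(powR12_sqrt (powR_ge0 _ _)) -powRrM.
  rewrite big_ord1 lee_fin.
  have c1 : C <= 2 `^ p * w h * C.
    rewrite ler_peMl ?(ltW C0)// -[leLHS]mulr1.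
    by apply: ler_pM => //; [exact: powR2_ge1|exact: weight_ge1].
  rewrite [leRHS](_ : _ = Num.sqrt L * enorm h `^ (a / 2) *
    (2 `^ p * w h * C + 2 `^ p * w h * C)); last by rewrite /root_modulus; ring.
  by rewrite -mulrDr ler_wpM2l// lerD2l.
have H h : (weighted_L1 p
     (fun y => initial_profile P X ell s (y + h) - initial_profile P X ell s y)%R <=
    (m * (enorm h `^ (a / 2) * w h))%:E)%E.
  have hw0 : 0 <= enorm h `^ (a / 2) * w h by rewrite mulr_ge0 ?powR_ge0 ?weight_ge0.
  rewrite /initial_profile; case: ifPn => [s0'|].
    have uU : 0 < s <= T by rewrite s0'.
    have rh0 : 0 <= root_modulus * (enorm h `^ (a / 2) * w h) by rewrite mulr_ge0.
    apply: (le_trans (smooth_modulus p0 Xd uU rh0 (H0 h))).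
    by rewrite lee_fin mulrA ler_wpM2r// lerDr.
  rewrite -leNgt => s0'; have -> : s = 0 by apply/eqP; rewrite eq_le s0 s0'.
  apply: (le_trans (H0 h)); rewrite lee_fin ler_wpM2r// lerDl.
  by [].
have c01 : 0 <= a / 2 < 1.
  by rewrite divr_ge0 ?(ltW a0)//= ltr_pdivrMr// mul1r (lt_trans a1)// ltr1n.
have := weighted_time_le s0 st tT c01 m0 H.
by have -> : a / 2 / 2 = a / 4 by field.
Qed.

End final_estimates.

Lemma finite_moment_le (R : realType) (d : nat) (q r : R)
    (nu : probability 'rV[R]_d R) :
  0 <= q -> q <= r -> finite_moment r nu -> finite_moment q nu.
Proof.
move=> q0 qr nur; rewrite /finite_moment.
have me s : measurable_fun setT (fun x : 'rV[R]_d => (enorm x `^ s)%:E).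
  by apply/measurable_EFinP; apply: (measurableT_comp (measurable_powR s));
    exact: measurable_enorm.
apply: (@le_lt_trans _ _ (\int[nu]_x (1 + (enorm x `^ r)%:E))%E); last first.
  rewrite ge0_integralD//; last by move=> x _; rewrite lee_fin powR_ge0.
  by rewrite integral_cst// mul1e lte_add_pinfty// (le_lt_trans (probability_le1 _ _))// ltry.
apply: ge0_le_integral => //; first by move=> x _; rewrite lee_fin powR_ge0.
  by apply: emeasurable_funD => //; exact: me.
move=> x _; rewrite -EFinD lee_fin.
have [x1|x1] := leP 1 (enorm x).
  by apply: (@le_trans _ _ (enorm x `^ r)); [exact: ler_powR|rewrite lerDr].
apply: (@le_trans _ _ 1); last by rewrite lerDl powR_ge0.
have -> : (1 : R) = 1 `^ q by rewrite powR1.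
apply: ge0_ler_powR => //.
- by rewrite nnegrE enorm_ge0.
- by rewrite nnegrE.
- exact: ltW.
Qed.

Theorem theorem1p1 (R : realType) (d : nat) (T alpha p C : R)
  (hd : (0 < d)%N) (hT : 0 < T) (halpha : 0 < alpha < 1) (hp : 1 <= p)
  (hC : 0 < C) :
  exists2 c1 : R, 0 < c1 &
  forall nu : probability 'rV[R]_d R,
  exists2 c2 : R, 0 < c2 &
  forall (lnu : 'rV[R]_d -> R) (b : R -> 'rV[R]_d -> R -> Pq d p -> 'rV[R]_d)
    (dO : measure_display) (Omega : measurableType dO) (P : probability Omega R)
    (F : R -> set (set Omega)) (B : R -> Omega -> 'rV[R]_d)
    (X0 : Omega -> 'rV[R]_d)
    (X : nat -> R -> Omega -> 'rV[R]_d) (mu : nat -> R -> Pq d p)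
    (ell : nat -> R -> 'rV[R]_d -> R),
  drift_measurable T b ->
  assumption_A T alpha C b nu lnu ->
  usual_filtration P F ->
  brownian_motion P F B ->
  sub_measurable (F 0) X0 ->
  has_law P X0 nu ->
  (forall n, (0 < n)%N -> euler_scheme T P b X0 B n (X n) (mu n) (ell n)) ->
  let N := [set n : nat | (0 < n)%N] in
  [/\ (ereal_sup [set ereal_sup [set holder_norm alpha (ell n r)
                                | r in `[0%R, T]%classic] | n in N]
       <= c1%:E * holder_norm alpha lnu)%E,
      forall s t : R, 0 <= s -> s < t -> t <= T ->
        [/\ (ereal_sup [set sup_norm (ell n t \- ell n s)%R | n in N]
             <= (c2 * (t - s) `^ (alpha / 2))%R%:E)%E,
            (ereal_sup [set Wass p (mu n t) (mu n s) | n in N]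
             <= (c1 * (t - s) `^ (1 / 2))%R%:E)%E &
            0 < s ->
            (ereal_sup [set weighted_L1 p (ell n t \- ell n s)%R | n in N]
             <= (c2 * (t - s) `^ (alpha / 2) * s `^ (- (alpha / 2)))%R%:E)%E] &
      (\int[lebesgue_rV R d]_x ((1 + enorm x `^ p) * Num.sqrt (lnu x))%R%:E
         <= C%:E)%E ->
      forall s t : R, 0 <= s -> s < t -> t <= T ->
        (ereal_sup [set weighted_L1 p (ell n t \- ell n s)%R | n in N]
         <= (c2 * (t - s) `^ (alpha / 4))%R%:E)%E].
Proof.
have p0 : 0 < p by exact: lt_le_trans hp.
have /andP[alpha0 alpha1] := halpha.
have zT : 0 <= (0 : R) <= T by rewrite lexx ltW.
(* The bound on the ratio of a drift displacement to sqrt u_j, increased by 1 because the kernel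
   estimates ask for a bound of at least 1. *)
have D1 : 1 <= 1 + d%:R * C * Num.sqrt T.
  by rewrite lerDl mulr_ge0 ?sqrtr_ge0// mulr_ge0// ltW.
have [Ks Ks0 HKs] := heat_shift_bound_exists d D1.
have [Kh Kh0 HKh] := heat_holder R d.
pose K := Ks * (d%:R * C).
have K0 : 0 < K by apply: mulr_gt0 => //; apply: mulr_gt0 => //; rewrite ltr0n.
have h1 : 1 <= holder_const T K alpha.
  rewrite /holder_const -addrA lerDl addr_ge0//.
    by rewrite mulr_ge0// expR_ge0.
  rewrite mulr_ge0 ?powR_ge0// divr_ge0 ?subr_ge0 ?(ltW alpha1)//.
  by rewrite mulr_ge0 ?expR_ge0// mulr_ge0// ltW.
have i0 : 0 <= increment_const d T p C `^ p^-1 by exact: powR_ge0.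
exists (holder_const T K alpha + increment_const d T p C `^ p^-1).
  by rewrite ltr_pwDl// (lt_le_trans _ h1).
move=> nu.
(* As c2 may depend on nu but not on lnu, the continuous density l of nu is chosen
   first and identified with lnu later. *)
have [[l [[ml l0 lE] lfin nup]]|noL] := pselect (exists l, [/\ is_density nu l,
    (holder_norm alpha l < +oo)%E & finite_moment (p + alpha) nu]); last first.
  (* Without such a density assumption (A) cannot hold for this nu. *)
  exists 1 => // lnu b dO Omega P F B X0 X mu ell _ [_ nup nul lfin _].
  by exfalso; apply: noL; exists lnu.
have [A [L [A0 L0 lAL lA lL]]] := holder_norm_fin hd alpha0 lfin.
have cl : continuous l := holder_continuous_rV alpha0 L0 lL.
have mep : measurable_fun setT (fun x : 'rV[R]_d => enorm x `^ p).
  by apply: (measurableT_comp (measurable_powR p)); exact: measurable_enorm.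
have nupp : finite_moment p nu.
  by apply: (finite_moment_le (ltW p0) _ nup); rewrite lerDl ltW.
(* nu is the law of the identity on R^d. Its moment and that of X n 0 are then the same integral
   against l. *)
have nuD : rv_density nu (fun x => x) l by split => // A' mA'; rewrite -lE.
pose m := fine (\int[nu]_x (enorm x `^ p)%:E).
have mE : (\int[nu]_x (enorm x `^ p)%:E = m%:E)%E.
  by rewrite fineK// ge0_fin_numE// integral_ge0// => x _; rewrite lee_fin powR_ge0.
have m0 : 0 <= m.
  by rewrite fine_ge0// integral_ge0// => x _; rewrite lee_fin powR_ge0.
pose W := moment_bound d T p C m.
have W0 : 0 <= W.
  rewrite addr_ge0// mulr_ge0 ?powR_ge0// addr_ge0// mulr_ge0 ?powR_ge0//.
  exact: increment_const_ge0.
pose q1 := sup_time_const d T K alpha A L.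
pose q2 := weighted_time_const d p T K alpha W Kh.
pose q3 := root_time_const d p T K alpha L W C.
(* Absolute values and the 1 give positivity and domination of each constant whatever their
   signs. *)
exists (1 + `|q1| + `|q2| + `|q3|).
  by rewrite -!addrA ltr_pwDl// !addr_ge0.
have q1E : q1 <= 1 + `|q1| + `|q2| + `|q3|.
  have := ler_norm q1; have := normr_ge0 q2; have := normr_ge0 q3; lra.
have q2E : q2 <= 1 + `|q1| + `|q2| + `|q3|.
  have := ler_norm q2; have := normr_ge0 q1; have := normr_ge0 q3; lra.
have q3E : q3 <= 1 + `|q1| + `|q2| + `|q3|.
  have := ler_norm q3; have := normr_ge0 q1; have := normr_ge0 q2; lra.
move=> lnu b dO Omega P F B X0 X mu ell mb bA UF BM FX0 X0nu ES N.
have lnuE : lnu = l.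
  have [_ _ [mlnu lnu0 lnuE] lnufin _] := bA.
  have [A' [L' [_ L'0 _ _ lL']]] := holder_norm_fin hd alpha0 lnufin.
  apply: continuous_density_unique => //.
    exact: (holder_continuous_rV alpha0 L'0 lL').
  by move=> D mD; rewrite -lnuE// lE.
subst lnu.
have sysn n : (0 < n)%N -> euler_system P T K n (grid T n) (X n) (ell n).
  move=> n0; exact: (scheme_system hT hC n0 mb bA UF BM FX0 (ES n n0) (ltW Ks0) HKs).
have init n : (0 < n)%N -> rv_density P (X n 0) l.
  by move=> n0; exact: (scheme_initial_density hT bA BM X0nu (ES n n0)).
have ell0 n : (0 < n)%N -> ell n 0 = l.
  move=> n0; apply: (rv_density_unique (scheme_density (ES n n0) zT) (init n n0)) => //.
  exact: (euler_density_continuous (ES n n0) zT).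
have ellA n : (0 < n)%N -> forall x, `|ell n 0 x| <= A by move=> n0; rewrite ell0.
have ellL n : (0 < n)%N ->
    forall y h, `|ell n 0 (y + h) - ell n 0 y| <= L * enorm h `^ alpha.
  by move=> n0; rewrite ell0.
have XW n : (0 < n)%N -> forall t, 0 <= t <= T ->
    (\int[P]_v (weight p (X n t v))%:E <= W%:E)%E.
  move=> n0 t tT.
  apply: (scheme_weight hT hC n0 hp mb bA UF BM (ES n n0) _ tT).
  have e0 (x : 'rV[R]_d) : 0 <= enorm x `^ p by exact: powR_ge0.
  by rewrite (integral_rv_density (init n n0) mep e0) -mE (integral_rv_density nuD mep e0).
split.
- rewrite lAL -EFinM; apply: ge_ereal_sup => _ [n n0 <-].
  apply: ge_ereal_sup => _ [r rT' <-].
  have rT : 0 <= r <= T by move: rT'; rewrite /= in_itv.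
  apply: (le_trans (density_holder_norm hT K0 (sysn n n0) halpha A0 L0
    (ellA n n0) (ellL n n0) rT)).
  by rewrite lee_fin ler_wpM2r ?addr_ge0// lerDl.
- move=> s t s0 st tT; split.
  + apply: ge_ereal_sup => _ [n n0 <-].
    apply: (le_trans (density_time_sup hT K0 (sysn n n0) halpha A0 L0
      (ellA n n0) (ellL n n0) s0 st tT)).
    by rewrite lee_fin ler_wpM2r ?powR_ge0.
  + apply: ge_ereal_sup => _ [n n0 <-].
    apply: (le_trans (scheme_Wass hT hC n0 hp mb bA UF BM (ES n n0) s0 st tT)).
    by rewrite lee_fin ler_wpM2r ?powR_ge0// lerDr (le_trans _ h1).
  + move=> s1; apply: ge_ereal_sup => _ [n n0 <-].
    apply: (le_trans (density_time_weighted p0 hT K0 (sysn n n0) halpha W0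
      Kh0 HKh (XW n n0) s1 st tT)).
    by rewrite lee_fin ler_wpM2r ?powR_ge0// ler_wpM2r ?powR_ge0.
- move=> Hroot s t s0 st tT; apply: ge_ereal_sup => _ [n n0 <-].
  have Hn : (\int[lebesgue_rV R d]_x (weight p x * Num.sqrt (ell n 0 x))%:E <=
      C%:E)%E by rewrite ell0.
  apply: (le_trans (density_time_root p0 hT K0 (sysn n n0) halpha L0 W0 hC
    (ellL n n0) (XW n n0) s0 st tT Hn)).
  by rewrite lee_fin ler_wpM2r ?powR_ge0.
Qed.
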